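(* Let $A\ge0$, $B>0$, $\alpha>0$ and let $$\lambda(r)=(1-r^2)^A\exp\left(\frac{-B}{(1-r^2)^{\alpha}}\right),\qquad 0\le r<1,\qquad \lambda(1)=0,$$ and consider the radial weight $\lambda(z)=\lambda(|z|)$ on the unit disc $\mathbb{D}\subset\mathbb{C}$. Then $\lambda$ satisfies: (1) $\lambda(r)$ is a smooth function on $[0,1]$; (2) $\lambda^{(n)}(1)=0$ for every integer $n\ge0$; (3) for every integer $n\ge0$ there exists $a_n\in(0,1)$ such that $(-1)^n\lambda^{(n)}(r)$ is non-negative on $(a_n,1)$. Moreover, for $p\in(1,\infty)$, the weighted Bergman projection $\mathbf{B}_\lambda$ is bounded from $L^p(\mathbb{D},\lambda)$ to $L^p(\mathbb{D},\lambda)$ only for $p=2$, and it is unbounded for $p\in(1,2)$.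
   Context: For a non-negative measurable function (weight) $\mu$ on $\mathbb{D}$ and $p\in[1,\infty)$, $L^p(\mathbb{D},\mu)$ is the space of measurable functions $f$ with $\|f\|_{p,\mu}^p=\int_{\mathbb{D}} |f|^p\mu\,dA<\infty$, where $dA$ is Lebesgue measure. $L^2_a(\mathbb{D},\mu)$ is the subspace of holomorphic functions in $L^2(\mathbb{D},\mu)$, which is closed if $\mu$ is continuous and non-vanishing inside $\mathbb{D}$. The weighted Bergman projection $\mathbf{B}_\mu:L^2(\mathbb{D},\mu)\to L^2_a(\mathbb{D},\mu)$ is the orthogonal projection. It is said to be bounded on $L^p(\mathbb{D},\mu)$ if there is $C>0$ with $\|\mathbf{B}_{\mu}f\|_{p,\mu}\le C\|f\|_{p,\mu}$ for all $f\in L^2(\mathbb{D},\mu)\cap L^p(\mathbb{D},\mu)$, and unbounded otherwise. *)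

(* Defs.v *)
From HB Require Import structures.
From mathcomp Require Import all_boot all_order all_algebra.
From mathcomp Require Import complex.
From mathcomp Require Import all_classical all_reals all_analysis.
Set Implicit Arguments.
Unset Strict Implicit.
Unset Printing Implicit Defensive.
Import Order.TTheory GRing.Theory Num.Theory.
Import numFieldNormedType.Exports.
Local Open Scope classical_set_scope.
Local Open Scope ring_scope.
Local Open Scope complex_scope.
Import ComplexField.Normc.

Section one_variable.
Context {R : realType}.
Implicit Types (D : set R) (f : R -> R) (r : R).

(* Derivatives relative to a set D: the difference quotient at r is taken along
   points of D only, so they are one-sided at the endpoints of an interval and
   coincide with the usual ones in its interior. *)
Definition derivable_on D f r : Prop :=
  cvg ((f s - f r) / (s - r) @[s --> within D r^']).

Definition derive_on D f r : R :=
  lim ((f s - f r) / (s - r) @[s --> within D r^']).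

Definition deriven_on D n f : R -> R := iter n (derive_on D) f.

Definition smooth_on D f : Prop :=
  forall n r, D r -> derivable_on D (deriven_on D n f) r.

(* The test [r < 1] cannot be dropped: for A = 0 the formula would give 1 at
   r = 1, because 0 `^ 0 = 1 and division by zero returns zero. *)
Definition exp_weight (A B alpha : R) : R -> R := fun r =>
  if r < 1 then (1 - r ^+ 2) `^ A * expR (- B / (1 - r ^+ 2) `^ alpha) else 0.

End one_variable.

Section weighted_bergman.
Context {R : realType}.
Implicit Types (mu : R[i] -> R) (f g h : R[i] -> R[i]) (p : R).

Definition radial (w : R -> R) : R[i] -> R := fun z => w (normc z).

Definition cplx (w : R * R) : R[i] := w.1 +i* w.2.

Local Notation dA := (@lebesgue_measure R \x @lebesgue_measure R)%E.

Definition udisc : set R[i] := [set z | normc z < 1].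

(* The library has no measure on R[i]; all measurability and integration is
   expressed in the real coordinates w = (x, y) through cplx. *)
Definition udisc2 : set (R * R) := cplx @^-1` udisc.

Definition cmeasurable f : Prop :=
  measurable_fun udisc2 (@complex.Re R \o f \o cplx) /\
  measurable_fun udisc2 (@complex.Im R \o f \o cplx).

Definition cintegral f : R[i] :=
  (\int[dA]_(w in udisc2) @complex.Re R (f (cplx w))) +i*
  (\int[dA]_(w in udisc2) @complex.Im R (f (cplx w))).

Definition wnorm mu p f : \bar R :=
  ((\int[dA]_(w in udisc2)
     ((normc (f (cplx w)) `^ p * mu (cplx w))%:E)) `^ p^-1)%E.

Definition Lp mu p : set (R[i] -> R[i]) :=
  [set f | cmeasurable f /\ (wnorm mu p f < +oo)%E].

Definition inner mu f g : R[i] :=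
  cintegral (fun z => f z * (g z)^* * (mu z)%:C).

(* The filter of [derivable] ranges over the complex increments, so in the
   direction 1 it is complex differentiability. *)
Definition holomorphic_on_disc f : Prop :=
  forall z, udisc z -> derivable (f : R[i]^o -> R[i]^o) z 1.

Definition L2a mu : set (R[i] -> R[i]) :=
  [set f | Lp mu 2 f /\ holomorphic_on_disc f].

Definition orth_proj_L2a mu f : set (R[i] -> R[i]) :=
  [set g | L2a mu g /\ forall h, L2a mu h -> inner mu (f \- g) h = 0].

(* The set [orth_proj_L2a mu f] has exactly one element, up to values off the
   disc, whenever f is in L^2(mu) and L2a mu is closed, in particular for mu
   continuous and non-vanishing in the disc; the default value of xget is then
   irrelevant. *)
Definition bergman_projection mu f : R[i] -> R[i] :=
  xget (fun=> 0) (orth_proj_L2a mu f).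

Definition bergman_bounded mu p : Prop :=
  exists2 C : R, 0 < C & forall f, Lp mu 2 f -> Lp mu p f ->
    (wnorm mu p (bergman_projection mu f) <= C%:E * wnorm mu p f)%E.

End weighted_bergman.

(* Main.v *)
(* With u = 1 - r^2, every derivative of the weight is a finite sum of terms
   c r^k u^a exp(-B/u^alpha), which is flat at r = 1; the term with the smallest
   exponent a has the sign (-1)^n, which gives (1)-(3).

   For the projection, test on f(z) = z^(2m) |z|^(2m(q-2)), with 1/p + 1/q = 1.
   Its projection is c z^(2m), c being a ratio of moments of the weight: the
   conjugate of f - c z^(2m), times the weight, is the derivative in conj(z) of
   z^(-2m-1) Y(|z|^2) for some Y vanishing at 0 and 1, so that orthogonality to
   holomorphic functions is Green's formula.  Green's formula is proved by
   Goursat's bisection, because holomorphic functions are only assumed to be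
   differentiable.  A bound on L^p then reads M(mq)^p M(mp) <= K M(2m)^p M(mq) for
   the moments M, whereas log M(s) ~ -kappa s^beta with beta = alpha/(1+alpha) < 1;
   letting m tend to infinity contradicts the strict concavity of s^beta
   unless p = q = 2. *)

(* The test function is g |g|^(q-2) for g = z^(2m), which is the equality case of Hölder's
   inequality between L^p and L^q: it pairs with z^(2m) as strongly as its L^p norm permits. Even
   powers make all moduli powers of u = |z|^2, so that everything reduces to moments in u.

   The obstacle is that Green's formula does not apply to h(z) z^(-2m-1) Y(|z|^2) itself: this
   function is singular at 0, and a square integrable holomorphic h has no control at the unit
   circle. Hence Y is multiplied by a cutoff in u (1 - u), which is then removed by dominated
   convergence. The derivative of the cutoff is of size 1 / (u (1 - u)), uniformly in the cutoff
   parameter, and is harmless because Y is at most a multiple of u (1 - u) u^m w(u). At the end u =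
   1 this estimate requires Y(1) = 0, and that condition is what determines c.

   The projection is only a chosen element of a set; a bound on it becomes a bound on c z^(2m)
   because two orthogonal projections of f agree almost everywhere. *)
Require Import Defs.
From mathcomp Require Import all_boot all_order all_algebra.
From mathcomp Require Import complex.
From mathcomp Require Import all_classical all_reals all_analysis.
From mathcomp Require Import measurable_realfun.
From mathcomp Require Import ring lra.
Set Implicit Arguments.
Unset Strict Implicit.
Unset Printing Implicit Defensive.
Import Order.TTheory GRing.Theory Num.Theory.
Import numFieldNormedType.Exports.
Local Open Scope classical_set_scope.
Local Open Scope ring_scope.

(** * Derivatives of the weight *)

Section derivatives.
Context {R : realType}.
Implicit Types (f g : R -> R) (x l : R).

Lemma cvg_dnbhs_epsP (T : R -> R) x l :
  (T y @[y --> x^'] --> l) <->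
  (forall e, 0 < e -> exists2 d, 0 < d &
     forall y, y != x -> `|y - x| < d -> `|T y - l| <= e).
Proof.
split=> [/cvgrPdist_le H e e0|H].
  have /nbhs_ballP[d /= d0 Hd] := H _ e0; exists d => // y yx yd.
  by rewrite distrC; apply: Hd => //; rewrite /ball/= distrC.
apply/cvgrPdist_le => e e0; have [d d0 Hd] := H _ e0.
apply/nbhs_ballP; exists d => //= y; rewrite /ball/= distrC => yd yx.
by rewrite distrC; apply: Hd.
Qed.

(** A product instead of a quotient allows y = x: in the chain rule [wirtinger_comp] the inner
    increment may vanish. *)
Lemma is_derive_epsP f x l : is_derive x 1 f l <->
  (forall e, 0 < e -> exists2 d, 0 < d &
     forall y, `|y - x| < d -> `|f y - f x - l * (y - x)| <= e * `|y - x|).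
Proof.
have eqd : is_derive x 1 f l <->
    (h^-1 *: ((f \o shift x) (h *: 1) - f x) @[h --> 0^'] --> l).
  split=> [[df <-]|H]; first exact: df.
  split; [by apply/cvg_ex; exists l | exact: (cvg_lim _ H)].
rewrite eqd cvg_dnbhs_epsP; split=> H e e0; have [d d0 Hd] := H _ e0;
    exists d => // y.
  move=> yd; have [->|yx] := eqVneq y x.
    by rewrite !subrr mulr0 subr0 normr0 mulr0.
  have h0 : y - x != 0 by rewrite subr_eq0.
  have := Hd (y - x) h0; rewrite subr0 => /(_ yd) /=.
  rewrite -(ler_pM2r (_ : 0 < `|y - x|)) ?normr_gt0// -normrM.
  by rewrite /GRing.scale/= mulr1 subrK mulrBl mulrAC mulVf// mul1r.
move=> y0; rewrite subr0 => yd.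
have := Hd (y + x); rewrite addrK => /(_ yd) /=.
rewrite -(ler_pM2r (_ : 0 < `|y|^-1)) ?invr_gt0 ?normr_gt0// mulfK ?normr_eq0//.
by rewrite -normrV ?unitfE// -normrM mulrBl mulfK// /GRing.scale/= mulr1 mulrC.
Qed.

Lemma is_derive_slope f x l : is_derive x 1 f l ->
  (f s - f x) / (s - x) @[s --> x^'] --> l.
Proof.
move=> /is_derive_epsP H; apply/cvg_dnbhs_epsP => e e0.
have [d d0 Hd] := H _ e0; exists d => // y yx yd.
have h0 : y - x != 0 by rewrite subr_eq0.
rewrite -(ler_pM2r (_ : 0 < `|y - x|)) ?normr_gt0// -normrM.
by rewrite mulrBl divfK//; exact: Hd.
Qed.

(** Properness makes the [lim] in [derive_on] computable: it gives uniqueness of the limit in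
    [cvg_lim]. *)
Lemma within_itv01_proper x : 0 <= x <= 1 ->
  ProperFilter (within (`[0, 1]%classic : set R) x^').
Proof.
move=> /andP[x0 x1]; split; last exact: within_filter.
rewrite /within/= => /nbhs_ballP[d /= d0 Hd].
(* From the left half step to the right, otherwise to the left; a step of at most 1/2 stays in
   [0, 1]. *)
have [xh|xh] := leP x 2^-1.
  pose e := Num.min (d / 2) (2^-1).
  have e0 : 0 < e by rewrite lt_min; apply/andP; split; lra.
  have ed : e <= d / 2 by rewrite ge_min lexx.
  have eh : e <= 2^-1 by rewrite ge_min lexx orbT.
  apply: (Hd (x + e)).
  - by rewrite /ball/= opprD addNKr normrN gtr0_norm//; lra.
  - by rewrite -subr_eq0 addrAC subrr add0r gt_eqF.
  - by rewrite /= in_itv/=; apply/andP; split; lra.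
pose e := Num.min (d / 2) (2^-1).
have e0 : 0 < e by rewrite lt_min; apply/andP; split; lra.
have ed : e <= d / 2 by rewrite ge_min lexx.
have eh : e <= 2^-1 by rewrite ge_min lexx orbT.
apply: (Hd (x - e)).
- by rewrite /ball/= opprB addrC subrK gtr0_norm//; lra.
- by rewrite -subr_eq0 addrAC subrr add0r oppr_eq0 gt_eqF.
- by rewrite /= in_itv/=; apply/andP; split; lra.
Qed.

(** Meant for [g] an iterated relative derivative, which is known on [0, 1] only, and [f] an
    explicit formula with a two-sided derivative even at the endpoints. *)
Lemma derive_on_itv01 f g x l : 0 <= x <= 1 ->
  (forall y, 0 <= y <= 1 -> g y = f y) -> is_derive x 1 f l ->
  derivable_on `[0, 1]%classic g x /\ derive_on `[0, 1]%classic g x = l.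
Proof.
move=> x01 gf /is_derive_slope df.
have pf := within_itv01_proper x01.
have H : (g s - g x) / (s - x) @[s --> within (`[0, 1]%classic : set R) x^'] --> l.
  have {}df : (f s - f x) / (s - x) @[s --> within (`[0, 1]%classic : set R) x^'] --> l.
    by apply: cvg_within_filter; exact: df.
  apply: cvg_trans df; apply: fmap_within_eq => s; rewrite inE/= in_itv/= => s01.
  by rewrite !gf.
split; first by apply/cvg_ex; exists l.
exact: (cvg_lim _ H).
Qed.

End derivatives.

(** * Flatness and signs of the derivatives at r = 1 *)

Section exp_weight_derivatives.
Context {R : realType}.
Variables (B alpha : R).
Hypotheses (B0 : 0 < B) (alpha0 : 0 < alpha).
Implicit Types (a r : R).

Local Notation ew a := (exp_weight a B alpha).

Lemma exp_weight_ge0 a r : 0 <= ew a r.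
Proof.
by rewrite /exp_weight; case: ifP => // _; rewrite mulr_ge0 ?powR_ge0 ?expR_ge0.
Qed.

(** By exp(y) >= y^k / k! at y = B / u^alpha, the exponential is at most a multiple of u^(alpha k),
    and k is taken with a + alpha k >= 2. The exponent [a] may be negative, since each
    differentiation lowers it. *)
Lemma powR_expR_flat a : exists2 C, 0 < C &
  forall u : R, 0 < u <= 1 -> u `^ a * expR (- B / u `^ alpha) <= C * u ^+ 2.
Proof.
pose N := Num.bound `|(2 - a) / alpha|.
have Na : 2 <= a + alpha * N.+1%:R.
  have : (2 - a) / alpha <= N.+1%:R.
    apply: le_trans (ler_norm _) (ltW _).
    by apply: lt_le_trans (archi_boundP (normr_ge0 _)) _; rewrite ler_nat.
  by rewrite ler_pdivrMr// mulrC => ?; lra.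
have C0 : 0 < N.+1`!%:R / B ^+ N.+1.
  by rewrite divr_gt0 ?exprn_gt0// ltr0n fact_gt0.
exists (N.+1`!%:R / B ^+ N.+1) => // u /andP[u0 u1].
have ua0 : 0 < u `^ alpha by rewrite powR_gt0.
have y0 : 0 < B / u `^ alpha by rewrite divr_gt0.
have Ey : expR (- B / u `^ alpha) <= N.+1`!%:R / (B / u `^ alpha) ^+ N.+1.
  rewrite mulNr expRN -[leRHS]invf_div lef_pV2 ?posrE ?expR_gt0//; last first.
    by rewrite divr_gt0 ?exprn_gt0// ltr0n fact_gt0.
  by apply: le_trans (expR_ge1Dxn N (ltW y0)); rewrite lerDr.
apply: le_trans (ler_wpM2l (powR_ge0 _ _) Ey) _.
rewrite expr_div_n invf_div -[(u `^ alpha) ^+ _]powR_mulrn ?powR_ge0//.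
have -> : u ^+ 2 = u `^ 2 by rewrite powR_mulrn// ltW.
rewrite -powRrM.
set K := _ / B ^+ _ in C0 *.
have -> : u `^ a * (N.+1`!%:R * (u `^ (alpha * N.+1%:R) / B ^+ N.+1)) =
    K * (u `^ a * u `^ (alpha * N.+1%:R)) by rewrite /K; ring.
rewrite ler_pM2l// -powRD; last by apply/implyP => _; rewrite gt_eqF.
by rewrite ger_powR// u0.
Qed.

(** At r = 1 the derivative is two-sided: the weight is 0 beyond 1 and O((1 - r)^2) before it, so
    the derivative vanishes, as does the formula. Going down to -1 makes 0 an interior point. *)
Lemma exp_weight_derive a r : -1 < r <= 1 -> is_derive r 1 (ew a)
  (- (2 * B * alpha) * r * ew (a - alpha - 1) r - 2 * a * r * ew (a - 1) r).
Proof.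
move=> /andP[rN1]; rewrite le_eqVlt => /predU1P[->|r1].
  rewrite /exp_weight ltxx !mulr0 subr0.
  apply/is_derive_epsP => e e0; have [C C0 HC] := powR_expR_flat a.
  (* The 4 comes from squaring 1 - y^2 <= 2 (1 - y); the bound 1 keeps y positive. *)
  exists (Num.min 1 (e / (4 * C))).
    by rewrite lt_min ltr01/= divr_gt0// mulr_gt0.
  move=> y; rewrite lt_min => /andP[y1].
  rewrite ltr_pdivlMr ?mulr_gt0// => yC.
  rewrite ltxx !subr0 mul0r subr0; case: ltP => [yl1|]; last first.
    by rewrite normr0 mulr_ge0// ltW.
  have y0 : 0 < y by move: y1; rewrite ltr_norml => /andP[]; lra.
  have u01 : 0 < 1 - y ^+ 2 <= 1 by apply/andP; split; nra.
  rewrite ger0_norm ?mulr_ge0 ?powR_ge0 ?expR_ge0//.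
  apply: le_trans (HC _ u01) _.
  have ny : `|y - 1| = 1 - y by rewrite distrC gtr0_norm// subr_gt0.
  rewrite ny in yC *.
  have u2 : 1 - y ^+ 2 <= 2 * (1 - y) by nra.
  have : (1 - y ^+ 2) ^+ 2 <= 4 * (1 - y) ^+ 2.
    have -> : 4 * (1 - y) ^+ 2 = (2 * (1 - y)) ^+ 2 by ring.
    by rewrite ler_pXn2r// nnegrE; nra.
  move=> /(ler_wpM2l (ltW C0)) /le_trans; apply.
  have -> : C * (4 * (1 - y) ^+ 2) = ((1 - y) * (4 * C)) * (1 - y) by ring.
  by rewrite ler_pM2r ?subr_gt0// ltW.
have u0 : 0 < 1 - r ^+ 2 by nra.
have v0 : 0 < (1 - r ^+ 2) `^ alpha by rewrite powR_gt0.
have nearE : \forall y \near r, (1 - y ^+ 2) `^ a * expR (- B / (1 - y ^+ 2) `^ alpha) = ew a y.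
  near=> y; rewrite /exp_weight ifT//; near: y; exact: lt_nbhsl.
apply: near_eq_is_derive nearE _ => //.
have du : is_derive r 1 (fun y : R => 1 - y ^+ 2) (- (2 * r)).
  by apply: is_derive_eq; rewrite /GRing.scale/=; ring.
have dv b : is_derive r 1 (fun y : R => (1 - y ^+ 2) `^ b)
    (b * (1 - r ^+ 2) `^ (b - 1) * - (2 * r)).
  exact: (@is_derive1_comp _ (@powR R ^~ b) _ r _ _ (is_derive1_powR b u0) du).
have dE : is_derive r 1 (fun y : R => expR (- B / (1 - y ^+ 2) `^ alpha))
    (expR (- B / (1 - r ^+ 2) `^ alpha) *
     (- B * (- alpha * (1 - r ^+ 2) `^ (- alpha - 1) * - (2 * r)))).
  have -> : (fun y : R => expR (- B / (1 - y ^+ 2) `^ alpha)) =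
      expR \o (fun y : R => - B * (1 - y ^+ 2) `^ (- alpha)).
    by apply/funext => y /=; rewrite powRN.
  rewrite -[in X in is_derive _ _ _ X]powRN.
  apply: is_derive1_comp; exact: (is_deriveZ _ (dv _)).
apply: (is_derive_eq (is_deriveM (dv a) dE)).
rewrite /exp_weight r1 /GRing.scale/=.
have -> : (1 - r ^+ 2) `^ (a - alpha - 1) =
    (1 - r ^+ 2) `^ a * (1 - r ^+ 2) `^ (- alpha - 1).
  by rewrite -powRD ?addrA//; apply/implyP => _; rewrite gt_eqF.
ring.
Unshelve. all: by end_near.
Qed.

(* [derive_terms] differentiates a sum of terms c r^k ew a, a term being encoded
   as (c, k, a); the first of its three summands has the lowest power of
   [1 - r^2] and hence governs the sign near 1. *)
Definition eval_terms (t : seq (R * nat * R)) r : R :=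
  \sum_(x <- t) x.1.1 * r ^+ x.1.2 * ew x.2 r.

Definition derive_term (x : R * nat * R) : seq (R * nat * R) :=
  [:: (- (2 * B * alpha) * x.1.1, x.1.2.+1, x.2 - alpha - 1);
      (- 2 * x.2 * x.1.1, x.1.2.+1, x.2 - 1);
      (x.1.1 * x.1.2%:R, x.1.2.-1, x.2)].

Definition derive_terms t := flatten (map derive_term t).

Lemma eval_terms_derive t r : -1 < r <= 1 ->
  is_derive r 1 (eval_terms t) (eval_terms (derive_terms t) r).
Proof.
move=> rI; elim: t => [|[[c k] a] t IH].
  have E0 : eval_terms [::] = cst 0 by apply/funext => y; rewrite /eval_terms big_nil.
  by rewrite /derive_terms/= E0; exact: is_derive_cst.
have -> : eval_terms ((c, k, a) :: t) =
    (fun y => c * y ^+ k * ew a y) + eval_terms t.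
  by apply/funext => y; rewrite /eval_terms big_cons.
have -> : eval_terms (derive_terms ((c, k, a) :: t)) r =
    eval_terms (derive_term (c, k, a)) r + eval_terms (derive_terms t) r.
  by rewrite /eval_terms /derive_terms/= -cat1s big_cat/= !big_cons big_nil; ring.
apply: is_deriveD.
have dk : is_derive r 1 (fun y : R => c * y ^+ k) (c * (k%:R * r ^+ k.-1)).
  apply: is_deriveZ.
  have H := @is_deriveX _ _ id k r 1 _ (is_derive_id r 1).
  rewrite (_ : (fun x : R => x ^+ k) = id ^+ k); last first.
    by apply/funext => x; rewrite exprfctE.
  by apply: (is_derive_eq H); rewrite /GRing.scale/= mulr1.
apply: (is_derive_eq (is_deriveM dk (exp_weight_derive a rI))).
rewrite /eval_terms !big_cons big_nil /GRing.scale/= !exprS.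
ring.
Qed.

Lemma deriven_on_exp_weight A n r : 0 <= r <= 1 ->
  deriven_on `[0, 1]%classic n (ew A) r =
  eval_terms (iter n derive_terms [:: (1, 0%N, A)]) r.
Proof.
elim: n r => [|n IH] r rI.
  by rewrite /deriven_on/= /eval_terms big_seq1 mul1r expr0 mul1r.
rewrite /deriven_on iterS -/(deriven_on _ n _).
have rI' : -1 < r <= 1 by lra.
by have [_ ->] := derive_on_itv01 rI IH (eval_terms_derive _ rI').
Qed.

Lemma exp_weight_smooth A : smooth_on `[0, 1]%classic (ew A).
Proof.
move=> n r /=; rewrite in_itv/= => rI.
have rI' : -1 < r <= 1 by lra.
by have [] := derive_on_itv01 rI (@deriven_on_exp_weight A n)
  (eval_terms_derive _ rI').
Qed.

Lemma exp_weight_deriven1 A n : deriven_on `[0, 1]%classic n (ew A) 1 = 0.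
Proof.
rewrite deriven_on_exp_weight ?lexx ?ler01// /eval_terms big1// => x _.
by rewrite /exp_weight ltxx mulr0.
Qed.

Lemma exp_weight_shift a b r : `|r| < 1 ->
  ew b r = ew a r * (1 - r ^+ 2) `^ (b - a).
Proof.
move=> r1; have u0 : 0 < 1 - r ^+ 2.
  by rewrite subr_gt0 -real_normK ?num_real// expr_lt1.
have rl : r < 1 by apply: le_lt_trans r1; exact: ler_norm.
rewrite /exp_weight rl mulrAC -powRD ?subrKC//.
by apply/implyP => _; rewrite gt_eqF.
Qed.

(** With u = 1 - r^2, a term of exponent a > b is [ew b r] times a bounded multiple of u^(a - b),
    which tends to 0 at r = 1. *)
Lemma terms_small b (t : seq (R * nat * R)) (e : R) : 0 < e ->
  (forall x, x \in t -> b < x.2) ->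
  exists2 d, 0 < d < 1 & forall r, d < r < 1 ->
    `|eval_terms t r| <= e * ew b r.
Proof.
move=> e0; elim: t e e0 => [|[[c k] a] t IH] e e0 Ht.
  exists 2^-1 => [|r rI]; first by apply/andP; split; lra.
  by rewrite /eval_terms big_nil normr0 mulr_ge0 ?exp_weight_ge0 ?ltW.
have [||d1 /andP[d10 d11] H1] := IH (e / 2); first lra.
  by move=> x xt; apply: Ht; rewrite inE xt orbT.
have ab : 0 < a - b by rewrite subr_gt0 (Ht (c, k, a))// mem_head.
(* For u <= w one has |c| u^(a - b) <= e / 2; the + 1 guards against c = 0. Below, r > 1 - w / 2
   gives u <= 2 (1 - r) < w. *)
pose w : R := Num.min 1 ((e / 2 / (`|c| + 1)) `^ (a - b)^-1).
have q0 : 0 < e / 2 / (`|c| + 1) by rewrite divr_gt0 ?ltr_wpDl//; lra.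
have w0 : 0 < w by rewrite lt_min ltr01/= powR_gt0.
exists (Num.max d1 (1 - w / 2)).
  rewrite lt_max gt_max d10 d11/=.
  by rewrite ltrBlDr ltrDl divr_gt0.
move=> r; rewrite gt_max => /andP[/andP[r1 r2] r3].
have r0 : 0 < r by apply: lt_trans r1.
have rn : `|r| < 1 by rewrite gtr0_norm.
rewrite /eval_terms big_cons -/(eval_terms t r)/=.
apply: le_trans (ler_normD _ _) _.
have -> : e * ew b r = e / 2 * ew b r + e / 2 * ew b r by field.
apply: lerD; last by apply: H1; rewrite r1 r3.
rewrite (exp_weight_shift b a rn) !normrM mulrCA [leRHS]mulrC.
rewrite (ger0_norm (exp_weight_ge0 _ _)).
apply: ler_wpM2l; first exact: exp_weight_ge0.
have u0 : 0 < 1 - r ^+ 2 by nra.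
have uw : 1 - r ^+ 2 <= w by nra.
have pw : (1 - r ^+ 2) `^ (a - b) <= e / 2 / (`|c| + 1).
  have wq : w <= (e / 2 / (`|c| + 1)) `^ (a - b)^-1 by rewrite ge_min lexx orbT.
  have := ge0_ler_powR (ltW ab) _ _ (le_trans uw wq).
  rewrite !nnegrE powR_ge0 -powRrM mulVf ?gt_eqF// powRr1 ?(ltW q0)//.
  by apply=> //; exact: ltW.
rewrite (ger0_norm (powR_ge0 _ _)) normrX (gtr0_norm r0).
have rk : r ^+ k <= 1 by rewrite exprn_ile1// ltW.
have rk0 : 0 <= r ^+ k by rewrite exprn_ge0// ltW.
have cp : 0 < `|c| + 1 by rewrite ltr_wpDl.
have : `|c| * r ^+ k <= `|c| + 1.
  by apply: (@le_trans _ _ `|c|); rewrite ?ler_piMr ?lerDl.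
move=> H; have := ler_pM (mulr_ge0 (normr_ge0 c) rk0) (powR_ge0 _ _) H pw.
move=> {}H; apply: le_trans _ (le_trans H _); last first.
  by rewrite mulrC divfK ?gt_eqF.
by [].

Qed.

(** Each differentiation multiplies the leading coefficient by -2 B alpha, whence the sign (-1)^n,
    and lowers its exponent by alpha + 1. No other term loses more than that, and the two new ones
    lose at most 1, so the leading exponent stays strictly smallest. *)
Lemma iter_derive_terms A n : exists c t,
  [/\ iter n derive_terms [:: (1, 0%N, A)] = (c, n, A - n%:R * (alpha + 1)) :: t,
     0 < (-1) ^+ n * c &
     forall x, x \in t -> A - n%:R * (alpha + 1) < x.2].
Proof.
have al0 := alpha0.
have lt1 (z : R) : z - alpha - 1 < z - 1 by lra.
have lt2 (z : R) : z - alpha - 1 < z by lra.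
have lt3 (z w : R) : z < w -> z - alpha - 1 < w - alpha - 1 by lra.
elim: n => [|n [c [t [E c0 Ht]]]].
  by exists 1, [::]; split => //; rewrite ?mul0r ?subr0// mulr1.
exists (- (2 * B * alpha) * c).
exists ((- 2 * (A - n%:R * (alpha + 1)) * c, n.+1, A - n%:R * (alpha + 1) - 1) ::
  (c * n%:R, n.-1, A - n%:R * (alpha + 1)) :: derive_terms t).
have -> : A - n.+1%:R * (alpha + 1) = A - n%:R * (alpha + 1) - alpha - 1.
  by rewrite -natr1; ring.
split.
- by rewrite iterS E /derive_terms/= /derive_term/=.
- rewrite exprS.
  have -> : -1 * (-1) ^+ n * (- (2 * B * alpha) * c) =
    (2 * B * alpha) * ((-1) ^+ n * c) by ring.
  by rewrite mulr_gt0// !mulr_gt0.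
- move=> x; rewrite !inE => /or3P[/eqP->|/eqP->|]; [exact: lt1|exact: lt2|].
  move=> /flattenP[s /mapP[y /Ht /lt3 yt ->]].
  rewrite !inE => /or3P[] /eqP-> //; apply: (lt_trans yt); [exact: lt1|exact: lt2].
Qed.

Lemma exp_weight_deriven_sign A n : exists2 a : R, 0 < a < 1 &
  forall r, a < r < 1 -> 0 <= (-1) ^+ n * deriven_on `[0, 1]%classic n (ew A) r.
Proof.
have [c [t [E c0 Ht]]] := iter_derive_terms A n.
set b := A - _ in E Ht.
(* For r > 1/2 one has r^n >= 2^-n, so the leading term, times (-1)^n, is at least this constant
   times [ew b r]; the tail is made at most that. *)
have e0 : 0 < (-1) ^+ n * c * 2^-1 ^+ n by rewrite mulr_gt0// exprn_gt0// invr_gt0.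
have [d /andP[d0 d1] Hd] := terms_small e0 Ht.
exists (Num.max d 2^-1).
  by rewrite lt_max d0/= gt_max d1/=; lra.
move=> r; rewrite gt_max => /andP[/andP[dr hr] r1].
have r0 : 0 < r by lra.
rewrite deriven_on_exp_weight; last by rewrite !ltW.
rewrite E /eval_terms big_cons -/(eval_terms t r)/=.
have := Hd r; rewrite dr r1 => /(_ isT); rewrite ler_norml => /andP[H1 H2].
have hn : 2^-1 ^+ n <= r ^+ n by rewrite lerXn2r// ?nnegrE ?ltW// invr_gt0.
have {}hn : (-1) ^+ n * c * 2^-1 ^+ n * ew b r <= (-1) ^+ n * c * r ^+ n * ew b r.
  by rewrite ler_wpM2r ?exp_weight_ge0// ler_pM2l.
have ns : `|(-1) ^+ n * eval_terms t r| <= (-1) ^+ n * c * 2^-1 ^+ n * ew b r.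
  by rewrite normrM normrX normrN1 expr1n mul1r ler_norml H1 H2.
move: ns; rewrite ler_norml => /andP[ns _].
rewrite mulrDr !mulrA; lra.
Qed.

End exp_weight_derivatives.

(** * Green's formula in the plane *)

Section green.
Context {R : realType}.
Implicit Types (P Q : R -> R -> R) (D : R * R -> R).
Local Notation mu := (@lebesgue_measure R).
Local Notation dA := (@lebesgue_measure R \x @lebesgue_measure R)%E.

Lemma nested_intervals (a b : nat -> R) :
  (forall n, a n <= a n.+1) -> (forall n, b n.+1 <= b n) ->
  (forall n, a n <= b n) -> exists x, forall n, a n <= x <= b n.
Proof.
move=> ha hb hab.
have ndec : {homo a : n m / (n <= m)%N >-> n <= m}.
  by apply: (@homo_leq _ a (fun x y => x <= y)) => // y x z; exact: le_trans.
have ninc : {homo b : n m / (n <= m)%N >-> m <= n}.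
  apply: (@homo_leq _ b (fun x y => y <= x)) => // y x z xy yz.
  exact: le_trans yz xy.
have ab n m : a n <= b m.
  apply: le_trans (ndec _ _ (leq_maxl n m)) (le_trans (hab _) _).
  exact: ninc (leq_maxr n m).
exists (sup (range a)) => n; apply/andP; split.
  apply: ub_le_sup; last by exists n.
  by exists (b 0%N) => _ [m _ <-].
apply: ge_sup; first by exists (a 0%N), 0%N.
by move=> _ [m _ <-].
Qed.

(** Total differentiability at a single point: a function that is merely complex differentiable
    comes with no continuity of its partial derivatives. *)
Definition diff2 P x0 y0 p1 p2 := forall e, 0 < e -> exists2 d, 0 < d &
  forall x y, `|x - x0| < d -> `|y - y0| < d ->
  `|P x y - P x0 y0 - p1 * (x - x0) - p2 * (y - y0)| <= e * (`|x - x0| + `|y - y0|).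

(** The increment of [K] over the rectangle [a, b] x [c, d]. It is additive under subdivision, which
    is what bisection needs. *)
Definition cross_diff (K : R -> R -> R) a b c d := K b d - K b c - K a d + K a c.

(* Goursat's bisection: a failure of the conclusion is inherited by one quarter
   of the square, hence contradicts the hypothesis at the limit point. *)
Lemma cross_diff_eq0 (K : R -> R -> R) L a c l : 0 < l -> L <= a -> L <= c ->
  (forall x0 y0 e, 0 < e -> exists2 d, 0 < d & forall a c l,
    L <= a -> L <= c -> 0 < l < d -> a <= x0 <= a + l -> c <= y0 <= c + l ->
    `|cross_diff K a (a + l) c (c + l)| <= e * l ^+ 2) ->
  cross_diff K a (a + l) c (c + l) = 0.
Proof.
move=> l0 La Lc H; apply/eqP; apply: contraT => N0.
pose E a c l := cross_diff K a (a + l) c (c + l).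
(* Half of the initial ratio, so that the starting square is [bad]. The four quarters share e l^2
   equally, so a bad square has a bad quarter. *)
pose e := `|E a c l| / (2 * l ^+ 2).
have l20 : 0 < l ^+ 2 by rewrite exprn_gt0.
have e0 : 0 < e by rewrite divr_gt0 ?normr_gt0// mulr_gt0.
pose bad a c l := e * l ^+ 2 < `|E a c l|.
have badN : bad a c l.
  have E0 : 0 < `|E a c l| by rewrite normr_gt0.
  rewrite /bad {1}/e [X in X < _](_ : _ = `|E a c l| / 2); first by lra.
  by field; rewrite gt_eqF.
have split4 a' c' l' : bad a' c' l' -> [\/ bad a' c' (l' / 2),
    bad (a' + l' / 2) c' (l' / 2), bad a' (c' + l' / 2) (l' / 2) |
    bad (a' + l' / 2) (c' + l' / 2) (l' / 2)].
  move=> B; apply: contrapT => nB.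
  have nbad x y z : ~ bad x y z -> `|E x y z| <= e * z ^+ 2.
    by move/negP; rewrite -leNgt.
  have [b1 b2 b3 b4] : [/\ ~ bad a' c' (l' / 2),
    ~ bad (a' + l' / 2) c' (l' / 2), ~ bad a' (c' + l' / 2) (l' / 2) &
    ~ bad (a' + l' / 2) (c' + l' / 2) (l' / 2)].
    by split=> b; apply: nB;
      [apply: Or41|apply: Or42|apply: Or43|apply: Or44].
  have E4 : E a' c' l' = E a' c' (l' / 2) + E (a' + l' / 2) c' (l' / 2) +
     E a' (c' + l' / 2) (l' / 2) + E (a' + l' / 2) (c' + l' / 2) (l' / 2).
    rewrite /E /cross_diff -!addrA -!splitr; ring.
  move: B; rewrite /bad E4 ltNge => /negP; apply.
  apply: le_trans (ler_normD _ _) _.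
  have -> : e * l' ^+ 2 = e * (l' / 2) ^+ 2 + e * (l' / 2) ^+ 2 +
    e * (l' / 2) ^+ 2 + e * (l' / 2) ^+ 2 by field.
  apply: lerD; last exact: nbad.
  apply: le_trans (ler_normD _ _) _; apply: lerD; last exact: nbad.
  by apply: le_trans (ler_normD _ _) _; apply: lerD; apply: nbad.
pose next (s : R * R * R) : R * R * R :=
  let: (a, c, l) := s in let h := l / 2 in
  if `[< bad a c h >] then (a, c, h) else
  if `[< bad (a + h) c h >] then (a + h, c, h) else
  if `[< bad a (c + h) h >] then (a, c + h, h) else (a + h, c + h, h).
pose s n := iter n next (a, c, l).
pose A n := (s n).1.1; pose C n := (s n).1.2; pose S n := (s n).2.
have S_E n : S n = l / 2 ^+ n.
  elim: n => [|n IH]; first by rewrite /S /= expr0 divr1.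
  rewrite exprS invfM mulrCA mulrC -IH /S /s iterS -/(s n).
  by case: (s n) => [[x y] z] /=; repeat case: ifP => _.
have S0 n : 0 < S n by rewrite S_E divr_gt0// exprn_gt0.
have sbad n : bad (A n) (C n) (S n).
  elim: n => [//|n]; rewrite /A /C /S /s iterS -/(s n).
  case: (s n) => [[x y] z] /= /split4 B; case: asboolP => [//|n1].
  case: asboolP => [//|n2]; case: asboolP => [//|n3] /=.
  by case: B.
have step n : [/\ A n <= A n.+1, C n <= C n.+1,
    A n.+1 + S n.+1 <= A n + S n & C n.+1 + S n.+1 <= C n + S n].
  have := S0 n; rewrite /A /C /S /s iterS -/(s n).
  by case: (s n) => [[x y] z] /= z0; repeat case: ifP => _ /=; split; lra.
have [x0 Hx] := @nested_intervals A (fun n => A n + S n)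
  (fun n => let: And4 p _ _ _ := step n in p)
  (fun n => let: And4 _ _ p _ := step n in p)
  (fun n => ltW (ltr_pwDr (S0 n) (lexx _))).
have [y0 Hy] := @nested_intervals C (fun n => C n + S n)
  (fun n => let: And4 _ p _ _ := step n in p)
  (fun n => let: And4 _ _ _ p := step n in p)
  (fun n => ltW (ltr_pwDr (S0 n) (lexx _))).
have LA n : L <= A n /\ L <= C n.
  elim: n => [//|n [h1 h2]]; have [p1 p2 _ _] := step n.
  by split; [apply: le_trans p1 | apply: le_trans p2].
have [d d0 Hd] := H x0 y0 e e0.
pose n := Num.bound (l / d).
have nd : S n < d.
  rewrite S_E ltr_pdivrMr ?exprn_gt0// mulrC -ltr_pdivrMr//.
  apply: lt_le_trans (archi_boundP _) _; first by rewrite divr_ge0// ltW.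
  by rewrite -natrX ler_nat ltnW// ltn_expl.
have := Hd (A n) (C n) (S n) (LA n).1 (LA n).2.
rewrite S0 nd => /(_ isT (Hx n) (Hy n)).
by have := sbad n; rewrite /bad /E => /lt_le_trans /[apply]; rewrite ltxx.
Qed.

Lemma continuous_integrable_itv (f : R -> R) (L b : R) : continuous f ->
  mu.-integrable `[L, b] (EFin \o f).
Proof.
move=> cf; apply: continuous_compact_integrable; first exact: segment_compact.
exact: continuous_subspaceT.
Qed.

Lemma integral_increment (f : R -> R) L a b v e : continuous f -> L <= a -> a <= b ->
  (forall x, a <= x <= b -> `|f x - v| <= e) ->
  `|\int[mu]_(x in `[L, b]) f x - \int[mu]_(x in `[L, a]) f x - v * (b - a)|
    <= e * (b - a).
Proof.
move=> cf La ab H.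
have intf : mu.-integrable `[L, b] (EFin \o f) by exact: continuous_integrable_itv.
have intab : mu.-integrable `]a, b] (EFin \o f).
  apply: integrableS intf => //; apply: subset_itvr.
  by rewrite bnd_simp.
have intc k : mu.-integrable `]a, b] (EFin \o (fun=> k)).
  have intk : mu.-integrable `[a, b] (EFin \o (fun=> k)).
    by apply: continuous_integrable_itv; exact: cst_continuous.
  by apply: integrableS intk => //; apply: subset_itvr; rewrite bnd_simp.
have cE k : \int[mu]_(x in `]a, b]) k = k * (b - a).
  rewrite Rintegral_cst//= lebesgue_measure_itv/=.
  case: ifP => //=; rewrite lte_fin => /negbT; rewrite -leNgt => ba.
  by rewrite (le_anti (introT andP (conj ab ba))) subrr.
rewrite Rintegral_itvB ?bnd_simp//.
rewrite ler_norml; apply/andP; split.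
- rewrite -mulNr lerBrDr -mulrDl -cE; apply: le_Rintegral => // x /=.
  rewrite in_itv/= => /andP[/ltW ax xb].
  by have := H x; rewrite ax xb => /(_ isT); rewrite ler_norml => /andP[]; lra.
- rewrite lerBlDr -mulrDl -cE; apply: le_Rintegral => // x /=.
  rewrite in_itv/= => /andP[/ltW ax xb].
  by have := H x; rewrite ax xb => /(_ isT); rewrite ler_norml => /andP[]; lra.
Qed.

Lemma diff2_slicel P x0 y0 p1 p2 : diff2 P x0 y0 p1 p2 ->
  {for x0, continuous (P ^~ y0)}.
Proof.
move=> H; apply/cvgrPdist_le => e e0; have [d d0 Hd] := H 1 ltr01.
pose k := `|p1| + 1; have k0 : 0 < k by rewrite ltr_wpDl.
apply/nbhs_ballP; exists (Num.min d (e / k)) => /=.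
  by rewrite lt_min d0 divr_gt0.
move=> x; rewrite /ball/= distrC lt_min ltr_pdivlMr// => /andP[xd xe].
have := Hd x y0 xd; rewrite subrr normr0 => /(_ d0).
rewrite mul1r mulr0 subr0 addr0 => {}Hd.
apply: le_trans (ltW xe); rewrite mulrDr mulr1 [leLHS]distrC /=.
have -> : P x y0 - P x0 y0 = (P x y0 - P x0 y0 - p1 * (x - x0)) + p1 * (x - x0).
  by rewrite subrK.
apply: le_trans (ler_normD _ _) _.
by rewrite normrM [`|p1| * _]mulrC addrC lerD2l.
Qed.

Lemma diff2C P x0 y0 p1 p2 : diff2 P x0 y0 p1 p2 ->
  diff2 (fun x y => P y x) y0 x0 p2 p1.
Proof.
move=> H e e0; have [d d0 Hd] := H e e0; exists d => // x y xd yd.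
by have := Hd y x yd xd; rewrite addrAC [in leRHS]addrC.
Qed.

(** The two horizontal edges of a small square: P(x, c + l) - P(x, c) is p2 l up to e l, uniformly
    in x, and is integrated over a length l. Exchanging the coordinates by [diff2C] gives the
    vertical edges. *)
Lemma edge_increment P x0 y0 p1 p2 L e : 0 < e -> diff2 P x0 y0 p1 p2 ->
  (forall y, continuous (P ^~ y)) ->
  exists2 d, 0 < d & forall a c l, L <= a -> 0 < l < d ->
    a <= x0 <= a + l -> c <= y0 <= c + l ->
    `|cross_diff (fun u y => \int[mu]_(x in `[L, u]) P x y) a (a + l) c (c + l)
      - p2 * l ^+ 2| <= e * l ^+ 2.
Proof.
(* Two values of [P] enter, each with an error of at most e / 4 times 2 l. *)
move=> e0 dP cP; have e40 : 0 < e / 4 by rewrite divr_gt0.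
have [d d0 Hd] := dP _ e40; exists d => // a c l La /andP[l0 ld] hx hy.
have al : a <= a + l by rewrite lerDl ltW.
pose f x := P x (c + l) - P x c.
have cf : continuous f by move=> x; apply: continuousB; exact: cP.
have Hf x : a <= x <= a + l -> `|f x - p2 * l| <= e * l.
  move=> xI.
  have nx : `|x - x0| <= l by rewrite ler_norml; lra.
  have ny1 : `|c + l - y0| <= l by rewrite ler_norml; lra.
  have ny2 : `|c - y0| <= l by rewrite ler_norml; lra.
  have h1 := Hd x (c + l) (le_lt_trans nx ld) (le_lt_trans ny1 ld).
  have h2 := Hd x c (le_lt_trans nx ld) (le_lt_trans ny2 ld).
  set u := (X in `|X| <= _) in h1; set v := (X in `|X| <= _) in h2.
  have -> : f x - p2 * l = u - v by rewrite /f /u /v; ring.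
  apply: le_trans (ler_normB _ _) _.
  have b1 : e / 4 * (`|x - x0| + `|c + l - y0|) <= e / 4 * (l + l).
    by rewrite ler_pM2l// lerD.
  have b2 : e / 4 * (`|x - x0| + `|c - y0|) <= e / 4 * (l + l).
    by rewrite ler_pM2l// lerD.
  lra.
have := integral_increment cf La al Hf.
have IB u : \int[mu]_(x in `[L, u]) f x =
    \int[mu]_(x in `[L, u]) P x (c + l) - \int[mu]_(x in `[L, u]) P x c.
  by rewrite RintegralB//; apply: continuous_integrable_itv.
have -> : a + l - a = l by ring.
rewrite !IB /cross_diff => H.
have -> : e * l ^+ 2 = e * l * l by ring.
by apply: le_trans H; rewrite le_eqVlt; apply/orP; left; apply/eqP; congr (`| _ |); ring.
Qed.

Lemma rectangle_measure (a b c d : R) : a <= b -> c <= d ->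
  dA (`]a, b] `*` `]c, d]) = ((b - a) * (d - c))%:E.
Proof.
move=> ab cd.
have E (u v : R) : u <= v -> mu `]u, v] = (v - u)%:E.
  move=> uv; rewrite lebesgue_measure_itv/=.
  case: ifP => //=; rewrite lte_fin => /negbT; rewrite -leNgt => vu.
  by rewrite (le_anti (introT andP (conj uv vu))) subrr.
rewrite product_measure1E//= (_ : (_ * _)%E = ((b - a)%:E * (d - c)%:E)%E)//.
by congr (_ * _)%E; exact: E.
Qed.


Lemma setXUl (T U : Type) (A B : set T) (C : set U) :
  (A `|` B) `*` C = (A `*` C) `|` (B `*` C).
Proof.
apply/seteqP; split => -[x y] /=; first by move=> [[?|?] ?]; [left|right].
by move=> [] [? ?]; split => //; [left|right].
Qed.

Lemma setXUr (T U : Type) (A : set T) (B C : set U) :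
  A `*` (B `|` C) = (A `*` B) `|` (A `*` C).
Proof.
apply/seteqP; split => -[x y] /=; first by move=> [? [?|?]]; [left|right].
by move=> [] [? ?]; split => //; [left|right].
Qed.

Lemma rectangle_integral_approx D L a b c d v e : L <= a -> a <= b -> L <= c -> c <= d ->
  (forall u w, dA.-integrable (`]L, u] `*` `]L, w]) (EFin \o D)) ->
  (forall x y, a <= x <= b -> c <= y <= d -> `|D (x, y) - v| <= e) ->
  `|cross_diff (fun u w => \int[dA]_(z in `]L, u] `*` `]L, w]) D z) a b c d
    - v * ((b - a) * (d - c))| <= e * ((b - a) * (d - c)).
Proof.
move=> La ab Lc cd intD H.
have mI (u u' w w' : R) : measurable (`]u, u']%classic `*` `]w, w']%classic : set (R * R)).
  exact: measurableX.
have ioc_setU (u w : R) : L <= u -> u <= w ->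
    `]L, w]%classic = `]L, u]%classic `|` `]u, w]%classic.
  by move=> Lu uw; rewrite -itv_bndbnd_setU// bnd_simp.
have ioc_disj (u w : R) (x : R) : `]L, u]%classic x -> `]u, w]%classic x -> False.
  by rewrite /= !in_itv/= => /andP[_ xu] /andP[/lt_le_trans/(_ xu)]; rewrite ltxx.
pose J (u u' w w' : R) := \int[dA]_(z in `]u, u'] `*` `]w, w']) D z.
have J1 w : J L b L w = J L a L w + J a b L w.
  rewrite /J {1}(ioc_setU _ _ La ab) setXUl Rintegral_setU; [by []|exact: measurableX|exact: measurableX| |].
    by rewrite -setXUl -ioc_setU.
  by apply/disj_setPS => -[x y] /= [[x1 _] [x2 _]]; exact: ioc_disj x1 x2.
have sub w : L <= w -> w <= d ->
    `]a, b]%classic `*` `]L, w]%classic `<=` `]L, b]%classic `*` `]L, w]%classic.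
  move=> Lw wd [x y] /= [+ hy]; rewrite !in_itv/= => /andP[ax xb]; split => //.
  by rewrite xb (le_lt_trans La).
have J2 : J a b L d = J a b L c + J a b c d.
  rewrite /J {1}(ioc_setU _ _ Lc cd) setXUr Rintegral_setU; [by []|exact: measurableX|exact: measurableX| |].
    rewrite -setXUr -ioc_setU//; apply: integrableS (intD b d); [exact: measurableX|exact: measurableX|].
    exact: (sub d (le_trans Lc cd) (lexx d)).
  by apply/disj_setPS => -[x y] /= [[_ x1] [_ x2]]; exact: ioc_disj x1 x2.
have -> : cross_diff (fun u w => J L u L w) a b c d = J a b c d.
  by rewrite /cross_diff !J1 J2; ring.
have intJ : dA.-integrable (`]a, b] `*` `]c, d]) (EFin \o D).
  apply: integrableS (intD b d); [exact: measurableX|exact: measurableX|] => -[x y] /=; rewrite !in_itv/=.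
  move=> [/andP[ax ->] /andP[cy ->]].
  by rewrite (le_lt_trans La ax) (le_lt_trans Lc cy).
have mJ : (dA (`]a, b] `*` `]c, d]) < +oo)%E by rewrite rectangle_measure ?ltry.
have intc (k : R) : dA.-integrable (`]a, b] `*` `]c, d]) (EFin \o (fun=> k)).
  apply: measurable_bounded_integrable => //; [exact: measurableX|]; exists `|k|; split => // x kx y _.
  exact: ltW.
have cE (k : R) : \int[dA]_(x in `]a, b] `*` `]c, d]) k = k * ((b - a) * (d - c)).
  rewrite Rintegral_cst; last exact: measurableX.
  by rewrite [X in fine X]rectangle_measure.
rewrite ler_norml; apply/andP; split.
- rewrite -mulNr lerBrDr -mulrDl -cE; apply: le_Rintegral => //; first exact: measurableX.
  move=> [x y] /=.
  rewrite !in_itv/= => -[/andP[/ltW ax xb] /andP[/ltW cy yd]].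
  have := H x y; rewrite ax xb cy yd => /(_ isT isT); rewrite ler_norml => /andP[].
  lra.
- rewrite lerBlDr -mulrDl -cE; apply: le_Rintegral => //; first exact: measurableX.
  move=> [x y] /=.
  rewrite !in_itv/= => -[/andP[/ltW ax xb] /andP[/ltW cy yd]].
  have := H x y; rewrite ax xb cy yd => /(_ isT isT); rewrite ler_norml => /andP[].
  lra.
Qed.

(** On a small square around (x0, y0), the boundary integral and the integral of [D] are both (q1 -
    p2) l^2 up to a small multiple of l^2. Their difference is the increment of [K] below, so it is
    0 on the large square by [cross_diff_eq0], and there the boundary integral vanishes. Continuity
    is asked of the combination [D], not of the partial derivatives. *)
Lemma green_compact_support P Q D L l : 0 < l ->
  (forall x y, exists p1 p2 q1 q2, [/\ diff2 P x y p1 p2, diff2 Q x y q1 q2 &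
     q1 - p2 = D (x, y)]) ->
  continuous D -> measurable_fun setT D ->
  (forall x, P x L = 0 /\ P x (L + l) = 0) ->
  (forall y, Q L y = 0 /\ Q (L + l) y = 0) ->
  \int[dA]_(z in `]L, L + l] `*` `]L, L + l]) D z = 0.
Proof.
move=> l0 dPQ cD mD P0 Q0.
have cP y : continuous (P ^~ y).
  move=> x; have [p1 [p2 [q1 [q2 [dP _ _]]]]] := dPQ x y; exact: diff2_slicel dP.
have cQ x : continuous (Q x).
  move=> y; have [p1 [p2 [q1 [q2 [_ dQ _]]]]] := dPQ x y.
  exact: (diff2_slicel (diff2C dQ)).
have mI (u u' w w' : R) : measurable (`]u, u']%classic `*` `]w, w']%classic : set (R * R)).
  exact: measurableX.
have intD u w : dA.-integrable (`]L, u] `*` `]L, w]) (EFin \o D).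
  have [M HM] : exists M, forall z, (`]L, u] `*` `]L, w]) z -> `|D z| <= M.
    have cpt : compact (`[L, u]%classic `*` `[L, w]%classic : set (R * R)).
      by apply: compact_setX; exact: segment_compact.
    have /compact_bounded[M [_ HM]] := continuous_compact (continuous_subspaceT cD) cpt.
    exists (M + 1) => -[x y] /= [hx hy]; apply: (HM (M + 1)); first by rewrite ltrDl.
    by exists (x, y) => //; split => /=; exact: subset_itv_oc_cc.
  apply: measurable_bounded_integrable; first exact: measurableX.
  - have itv0 (v : R) : v < L -> `]L, v]%classic = set0.
      by move=> vL; rewrite set_itv_ge// bnd_simp -leNgt ltW.
    have dA0 : (dA set0 < +oo)%E by rewrite (_ : dA set0 = 0%E) ?ltry//; exact: measure0.
    have [Lu|/itv0->] := leP L u; last by rewrite set0X.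
    have [Lw|/itv0->] := leP L w; last by rewrite setX0.
    exact: (eq_ind_r (fun t => (t < +oo)%E) (ltry _) (rectangle_measure Lu Lw)).
  - exact: measurable_funS mD.
  - exists M; split; first exact: num_real.
    move=> x Mx y Hy; exact: le_trans (HM y Hy) (ltW Mx).
pose KP u y := \int[mu]_(x in `[L, u]) P x y.
pose KQ x u := \int[mu]_(y in `[L, u]) Q x y.
pose KD u w := \int[dA]_(z in `]L, u] `*` `]L, w]) D z.
pose K a c := KQ a c - KP a c - KD a c.
have : cross_diff K L (L + l) L (L + l) = 0.
  apply: (@cross_diff_eq0 K L) => // x0 y0 e e0.
  have [p1 [p2 [q1 [q2 [dP dQ pqD]]]]] := dPQ x0 y0.
  have e3 : 0 < e / 3 by rewrite divr_gt0.
  have [d1 d10 H1] := edge_increment L e3 dP cP.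
  have [d2 d20 H2] := edge_increment L e3 (diff2C dQ) cQ.
  have /cvgrPdist_le/(_ _ e3)/nbhs_ballP[d3 /= d30 H3] := cD (x0, y0).
  exists (Num.min (Num.min d1 d2) d3); first by rewrite !lt_min d10 d20.
  move=> a c h La Lc; rewrite !lt_min => /andP[h0 /andP[/andP[h1 h2] h3]] hx hy.
  have := H1 a c h La; rewrite h0 h1 => /(_ isT hx hy) {}H1.
  have := H2 c a h Lc; rewrite h0 h2 => /(_ isT hy hx) {}H2.
  have ah : a <= a + h by rewrite lerDl ltW.
  have ch : c <= c + h by rewrite lerDl ltW.
  have HD : forall x y, a <= x <= a + h -> c <= y <= c + h ->
      `|D (x, y) - D (x0, y0)| <= e / 3.
    move=> x y xI yI; rewrite distrC; apply: H3.
    by split; rewrite /ball/= ltr_norml; apply/andP; split; lra.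
  have := rectangle_integral_approx La ah Lc ch intD HD.
  have -> : (a + h - a) * (c + h - c) = h ^+ 2 by ring.
  rewrite -pqD => {}H3.
  set u := (X in `|X| <= _) in H1; set v := (X in `|X| <= _) in H2.
  set w := (X in `|X| <= _) in H3.
  have -> : cross_diff K a (a + h) c (c + h) = v - u - w.
    by rewrite /K /u /v /w /cross_diff /KP /KQ /KD; ring.
  apply: le_trans (ler_normB _ _) _.
  have := ler_normB v u; lra.
have int0 (f : R -> R) u : (forall x, f x = 0) -> \int[mu]_(x in `[L, u]) f x = 0.
  move=> f0; rewrite (@eq_Rintegral _ _ _ _ _ (fun=> 0))//.
  by rewrite Rintegral_cst ?mul0r.
rewrite /cross_diff /K.
have KP0 u : KP u L = 0 /\ KP u (L + l) = 0.
  by split; apply: int0 => x; case: (P0 x).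
have KQ0 u : KQ L u = 0 /\ KQ (L + l) u = 0.
  by split; apply: int0 => x; case: (Q0 x).
have KD0 u : KD L u = 0 /\ KD u L = 0.
  have LL : `]L, L]%classic = set0 by rewrite set_itv_ge// bnd_simp ltxx.
  by split; rewrite /KD LL ?set0X ?setX0 Rintegral_set0.
rewrite (KP0 _).1 !(KP0 _).2 !(KQ0 _).1 !(KQ0 _).2 !(KD0 _).1 !(KD0 _).2.
by rewrite !(KP0 _).1 !subr0 !sub0r; rewrite -/(KD _ _); lra.
Qed.

End green.

(** * Wirtinger calculus *)

Section complex_plane.
Context {R : realType}.
Local Notation C := (R[i]%type).
Local Notation Re := (@complex.Re R).
Local Notation Im := (@complex.Im R).
Local Notation normc := (@ComplexField.Normc.normc R).
Local Notation dA := (@lebesgue_measure R \x @lebesgue_measure R)%E.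
Implicit Types (z w a b : C) (F G h : C -> C).

Lemma normcE_Re_Im z : normc z ^+ 2 = Re z ^+ 2 + Im z ^+ 2.
Proof. by case: z => x y /=; rewrite sqr_sqrtr// addr_ge0// sqr_ge0. Qed.

Lemma normc_ge0 z : 0 <= normc z.
Proof. by case: z => x y /=; exact: sqrtr_ge0. Qed.

Lemma normc_real (x : R) : normc x%:C%C = `|x|.
Proof. by rewrite /= expr0n addr0 sqrtr_sqr. Qed.

Lemma Re_le_normc z : `|Re z| <= normc z.
Proof.
rewrite -(@ler_pXn2r _ 2)// ?nnegrE ?normc_ge0// normcE_Re_Im.
by rewrite real_normK ?num_real// lerDl sqr_ge0.
Qed.

Lemma Im_le_normc z : `|Im z| <= normc z.
Proof.
rewrite -(@ler_pXn2r _ 2)// ?nnegrE ?normc_ge0// normcE_Re_Im.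
by rewrite real_normK ?num_real// lerDr sqr_ge0.
Qed.

Lemma normc_le_Re_Im z : normc z <= `|Re z| + `|Im z|.
Proof.
rewrite -(@ler_pXn2r _ 2)// ?nnegrE ?normc_ge0 ?addr_ge0// normcE_Re_Im.
rewrite sqrrD !real_normK ?num_real// lerD2r lerDl.
by rewrite mulrn_wge0// mulr_ge0.
Qed.

Lemma normc_conjc z : normc (conjc z) = normc z.
Proof. by case: z => x y /=; rewrite sqrrN. Qed.

Lemma normc_conjCM z : z * conjc z = (normc z ^+ 2)%:C%C.
Proof. by rewrite normcE_Re_Im; case: z => x y; simpc; congr (_ +i* _)%C; ring. Qed.

Lemma normcX z n : normc (z ^+ n) = normc z ^+ n.
Proof.
elim: n => [|n IH]; first by rewrite !expr0 -[LHS]/(normc 1%C) ComplexField.Normc.normc1.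
by rewrite !exprS ComplexField.Normc.normcM IH.
Qed.

Lemma conjCE z : z^* = conjc z.
Proof.
rewrite [in LHS](complexE z) rmorphD rmorphM /=.
have cr (x : R) : (x%:C%C : C)^* = x%:C%C.
  by apply/CrealP; rewrite complex_real.
by rewrite !cr complexiE conjCi; case: z => x y; rewrite -complexiE; simpc.
Qed.

(** Real differentiability in terms of w and conj(w): [a] and [b] are the derivatives in z and in
    conj(z), and b = 0 means complex differentiability. *)
Definition wirtinger F z a b := forall e : R, 0 < e -> exists2 d : R, 0 < d &
  forall w, normc w < d -> normc (F (z + w) - F z - a * w - b * conjc w) <= e * normc w.

Definition ccontinuous F z := forall e : R, 0 < e -> exists2 d : R, 0 < d &
  forall w, normc w < d -> normc (F (z + w) - F z) <= e.

Lemma wirtinger_eq F z a b a' b' : a = a' -> b = b' ->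
  wirtinger F z a b -> wirtinger F z a' b'.
Proof. by move=> -> ->. Qed.

Lemma wirtinger_lipschitz F z a b : wirtinger F z a b -> exists2 d : R, 0 < d &
  forall w, normc w < d -> normc (F (z + w) - F z) <= (1 + normc a + normc b) * normc w.
Proof.
move=> H; have [d d0 Hd] := H 1 ltr01; exists d => // w wd.
have -> : F (z + w) - F z = (F (z + w) - F z - a * w - b * conjc w) + a * w + b * conjc w.
  by ring.
rewrite !mulrDl; apply: le_trans (le_normcD _ _) _; apply: lerD; last first.
  by rewrite ComplexField.Normc.normcM normc_conjc.
apply: le_trans (le_normcD _ _) _; rewrite ComplexField.Normc.normcM lerD2r.
exact: Hd.
Qed.

Lemma wirtinger_ccontinuous F z a b : wirtinger F z a b -> ccontinuous F z.
Proof.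
move=> /wirtinger_lipschitz[d d0 Hd] e e0.
pose k := 1 + normc a + normc b.
have k0 : 0 < k by rewrite /k; have := normc_ge0 a; have := normc_ge0 b; lra.
exists (Num.min d (e / k)); first by rewrite lt_min d0 divr_gt0.
move=> w; rewrite lt_min ltr_pdivlMr// mulrC => /andP[/Hd H /ltW]; exact: le_trans.
Qed.

Lemma ccontinuousM F G z : ccontinuous F z -> ccontinuous G z ->
  ccontinuous (fun z => F z * G z) z.
Proof.
move=> cF cG e e0.
pose k := 1 + normc (F z) + normc (G z).
have k0 : 0 < k by rewrite /k; have := normc_ge0 (F z); have := normc_ge0 (G z); lra.
pose e' := Num.min 1 (e / k).
have e'0 : 0 < e' by rewrite lt_min ltr01 divr_gt0.
have [d1 d10 H1] := cF _ e'0; have [d2 d20 H2] := cG _ e'0.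
exists (Num.min d1 d2); first by rewrite lt_min d10.
move=> w; rewrite lt_min => /andP[/H1 {}H1 /H2 {}H2].
have -> : F (z + w) * G (z + w) - F z * G z =
  (F (z + w) - F z) * (G (z + w) - G z) + (F (z + w) - F z) * G z +
  F z * (G (z + w) - G z) by ring.
apply: le_trans (le_normcD _ _) _.
apply: le_trans (lerD (le_normcD _ _) (lexx _)) _.
rewrite !ComplexField.Normc.normcM.
have ee : e' <= 1 by rewrite ge_min lexx.
have ek : e' * k <= e by rewrite -ler_pdivlMr// ge_min lexx orbT.
have := normc_ge0 (F z); have := normc_ge0 (G z).
have := normc_ge0 (F (z + w) - F z); have := normc_ge0 (G (z + w) - G z).
move: H1 H2 ek; rewrite /k.
set p := normc (F (z + w) - F z); set q := normc (G (z + w) - G z).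
move=> p1 q1 ek q0 p0 gz fz.
have : p * q <= e' * 1 by apply: ler_pM => //; exact: le_trans ee.
have : p * normc (G z) <= e' * normc (G z) by rewrite ler_wpM2r.
have : normc (F z) * q <= normc (F z) * e' by rewrite ler_wpM2l.
lra.
Qed.

Lemma wirtingerM F G z a b a' b' : wirtinger F z a b -> wirtinger G z a' b' ->
  wirtinger (fun z => F z * G z) z (a * G z + F z * a') (b * G z + F z * b').
Proof.
move=> dF dG e e0.
have [dl dl0 Hl] := wirtinger_lipschitz dF.
set k := 1 + normc a + normc b in Hl.
have k0 : 0 < k by rewrite /k; have := normc_ge0 a; have := normc_ge0 b; lra.
pose K := k + 1 + normc (F z) + normc (G z).
have K0 : 0 < K by rewrite /K; have := normc_ge0 (F z); have := normc_ge0 (G z); lra.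
have eK : 0 < e / K by rewrite divr_gt0.
have [d1 d10 H1] := dF _ eK; have [d2 d20 H2] := dG _ eK.
have [d3 d30 H3] := wirtinger_ccontinuous dG eK.
exists (Num.min (Num.min d1 d2) (Num.min d3 dl)).
  by rewrite !lt_min d10 d20 d30.
move=> w; rewrite !lt_min => /andP[/andP[/H1 {}H1 /H2 {}H2] /andP[/H3 {}H3 /Hl {}Hl]].
set X := F (z + w) - F z - a * w - b * conjc w in H1.
set Y := G (z + w) - G z - a' * w - b' * conjc w in H2.
have -> : F (z + w) * G (z + w) - F z * G z - (a * G z + F z * a') * w -
  (b * G z + F z * b') * conjc w =
  (F (z + w) - F z) * (G (z + w) - G z) + X * G z + F z * Y.
  by rewrite /X /Y; ring.
apply: le_trans (le_normcD _ _) _.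
apply: le_trans (lerD (le_normcD _ _) (lexx _)) _.
rewrite !ComplexField.Normc.normcM.
have w0 := normc_ge0 w.
have p1 : normc (F (z + w) - F z) * normc (G (z + w) - G z) <= k * normc w * (e / K).
  by apply: ler_pM => //; exact: normc_ge0.
have p2 : normc X * normc (G z) <= e / K * normc w * normc (G z).
  by rewrite ler_wpM2r// normc_ge0.
have p3 : normc (F z) * normc Y <= normc (F z) * (e / K * normc w).
  by rewrite ler_wpM2l// normc_ge0.
apply: le_trans (lerD (lerD p1 p2) p3) _.
have -> : e * normc w = e / K * normc w * K by field; rewrite gt_eqF.
have : 0 <= e / K * normc w by rewrite mulr_ge0// ltW.
rewrite /K; lra.
Qed.

Lemma wirtinger_id z : wirtinger id z 1 0.
Proof.
move=> e e0; exists 1 => // w _.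
have -> : z + w - z - 1 * w - 0 * conjc w = 0 by ring.
by rewrite ComplexField.Normc.normc0 mulr_ge0// ?normc_ge0// ltW.
Qed.

Lemma wirtinger_conjc z : wirtinger conjc z 0 1.
Proof.
move=> e e0; exists 1 => // w _.
have -> : conjc (z + w) - conjc z - 0 * w - 1 * conjc w = 0 by rewrite rmorphD /=; ring.
by rewrite ComplexField.Normc.normc0 mulr_ge0// ?normc_ge0// ltW.
Qed.

Lemma wirtinger_cst c z : wirtinger (fun=> c) z 0 0.
Proof.
move=> e e0; exists 1 => // w _.
have -> : c - c - 0 * w - 0 * conjc w = 0 by ring.
by rewrite ComplexField.Normc.normc0 mulr_ge0// ?normc_ge0// ltW.
Qed.

Lemma wirtinger_conjcX n z :
  wirtinger (fun z => conjc z ^+ n) z 0 (n%:R * conjc z ^+ n.-1).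
Proof.
elim: n => [|n IH].
  by rewrite mul0r; exact: wirtinger_cst.
have -> : (fun z : C => conjc z ^+ n.+1) = fun z => conjc z * conjc z ^+ n.
  by apply/funext => w; rewrite exprS.
have := wirtingerM (wirtinger_conjc z) IH.
apply: wirtinger_eq => /=; first by ring.
by rewrite -natr1; case: n {IH} => [|n]; rewrite ?expr0 ?exprS/=; ring.
Qed.

Lemma wirtinger_comp (s : C -> R) (g : R -> R) z a b g' :
  wirtinger (fun z => (s z)%:C%C) z a b -> is_derive (s z) 1 g g' ->
  wirtinger (fun z => (g (s z))%:C%C) z (g'%:C%C * a) (g'%:C%C * b).
Proof.
move=> ds /is_derive_epsP dg e e0.
have [dl dl0 Hl] := wirtinger_lipschitz ds.
set k := 1 + normc a + normc b in Hl.
have k0 : 0 < k by rewrite /k; have := normc_ge0 a; have := normc_ge0 b; lra.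
pose g1 := `|g'| + 1; have g10 : 0 < g1 by rewrite ltr_wpDl.
have ek : 0 < e / (2 * k) by rewrite divr_gt0// mulr_gt0.
have eg : 0 < e / (2 * g1) by rewrite divr_gt0// mulr_gt0.
have [d1 d10 H1] := dg _ ek.
have [d2 d20 H2] := ds _ eg.
have [d3 d30 H3] : exists2 d : R, 0 < d & forall w, normc w < d -> `|s (z + w) - s z| < d1.
  have d12 : 0 < d1 / 2 by rewrite divr_gt0.
  have [d d0 H] := wirtinger_ccontinuous ds d12; exists d => // w /H.
  by rewrite -rmorphB normc_real => /le_lt_trans; apply; lra.
exists (Num.min (Num.min d2 d3) dl); first by rewrite !lt_min d20 d30.
move=> w; rewrite !lt_min => /andP[/andP[/H2 {}H2 /H3 {}H3] /Hl].
rewrite -rmorphB normc_real => {}Hl.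
have {}H1 := H1 _ H3.
set X := g (s (z + w)) - g (s z) - g' * (s (z + w) - s z) in H1.
set Y := (s (z + w))%:C%C - (s z)%:C%C - a * w - b * conjc w in H2.
have -> : (g (s (z + w)))%:C%C - (g (s z))%:C%C - g'%:C%C * a * w - g'%:C%C * b * conjc w =
  X%:C%C + g'%:C%C * Y.
  by rewrite /X /Y !rmorphB rmorphM rmorphB /=; ring.
apply: le_trans (le_normcD _ _) _.
rewrite ComplexField.Normc.normcM !normc_real.
have w0 := normc_ge0 w.
have p1 : `|X| <= e / (2 * k) * (k * normc w).
  by apply: le_trans H1 _; rewrite ler_wpM2l// divr_ge0// ?ltW// mulr_gt0.
have p2 : `|g'| * normc Y <= g1 * (e / (2 * g1) * normc w).
  by apply: ler_pM => //; [exact: normc_ge0|rewrite /g1 lerDl].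
apply: le_trans (lerD p1 p2) _.
rewrite le_eqVlt; apply/orP; left; apply/eqP; field.
by rewrite !gt_eqF.
Qed.

Lemma wirtinger_normc2 z : wirtinger (fun z => (normc z ^+ 2)%:C%C) z (conjc z) z.
Proof.
have -> : (fun z => (normc z ^+ 2)%:C%C) = fun z => z * conjc z.
  by apply/funext => w; rewrite normc_conjCM.
have := wirtingerM (wirtinger_id z) (wirtinger_conjc z).
by apply: wirtinger_eq; ring.
Qed.

Lemma wirtinger_near0 F z (d : R) : 0 < d -> (forall w, normc w < d -> F (z + w) = 0) ->
  wirtinger F z 0 0.
Proof.
move=> d0 H e e0; exists d => // w wd.
have Fz : F z = 0 by rewrite -[z]addr0 H// ComplexField.Normc.normc0.
rewrite Fz H// !mul0r !subr0 ComplexField.Normc.normc0.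
by rewrite mulr_ge0 ?normc_ge0// ltW.
Qed.

Lemma holomorphic_wirtinger h z : holomorphic_on_disc h -> udisc z ->
  exists l, wirtinger h z l 0.
Proof.
move=> hh /hh/cvg_ex[l /= /cvgrPdist_le H]; exists l => e e0.
have e0C : (0 : C) < e%:C%C by rewrite ltcR.
have /nbhs_ballP[d /= d0 Hd] := H _ e0C.
(* In the partial order of R[i] a positive element is real. *)
have dE : d = (complex.Re d)%:C%C.
  by case: d d0 {Hd} => x y; rewrite ltcE/= => /andP[/eqP-> _].
have d0' : 0 < Re d by move: d0; rewrite ltcE => /andP[].
exists (Re d) => // w wd.
have [->|w0] := eqVneq w 0.
  rewrite addr0 subrr conjc0 !mulr0 !subr0 ComplexField.Normc.normc0.
  by rewrite mulr0.
have := Hd w; rewrite /ball/= sub0r normrN normc_def.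
have -> : Num.sqrt (complex.Re w ^+ 2 + complex.Im w ^+ 2) = normc w by case: (w).
rewrite {1}dE ltcR => /(_ wd w0).
rewrite normc_def lecR => {}Hd.
rewrite mul0r subr0.
have {}Hd : normc (l - w^-1 * (h (w + z) - h z)) <= e.
  move: Hd; rewrite /GRing.scale/= mulr1; by case: (l - _).
rewrite -[h _ - _ - _]opprK normcN.
have -> : - (h (z + w) - h z - l * w) = (l - w^-1 * (h (w + z) - h z)) * w.
  by rewrite [w + z]addrC mulrBl mulrAC mulVf// mul1r; ring.
by rewrite ComplexField.Normc.normcM ler_wpM2r// normc_ge0.
Qed.

End complex_plane.

(** * Holomorphy as a vanishing derivative in conj(z) *)

Section holomorphic_converse.
Context {R : realType}.
Local Notation C := (R[i]%type).
Local Notation Re := (@complex.Re R).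
Local Notation normc := (@ComplexField.Normc.normc R).
Implicit Types (z w : C) (h : C -> C).

Lemma wirtinger_derivable h z l : wirtinger h z l 0 ->
  derivable (h : C^o -> C^o) z 1.
Proof.
move=> H; apply/cvg_ex; exists l => /=; apply/cvgrPdist_le => e e0.
have eE : e = (Re e)%:C%C.
  by case: e e0 => x y; rewrite ltcE/= => /andP[/eqP-> _].
have e0' : 0 < Re e by move: e0; rewrite ltcE => /andP[].
have [d d0 Hd] := H _ e0'.
have d0C : (0 : C) < d%:C%C by rewrite ltcR.
apply/nbhs_ballP; exists d%:C%C => //= w.
have nE x : Num.sqrt (complex.Re x ^+ 2 + complex.Im x ^+ 2) = normc x by case: x.
rewrite /ball/= sub0r normrN normc_def nE ltcR => /Hd{}Hd w0.
rewrite eE normc_def nE lecR.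
have w1 : w^-1 * w = 1 by rewrite mulVf.
have nw : 0 < normc w.
  rewrite lt_neqAle normc_ge0 andbT eq_sym; apply: contra w0 => /eqP.
  by move=> /ComplexField.Normc.eq0_normc ->.
rewrite -(ler_pM2r nw) -ComplexField.Normc.normcM; apply: le_trans Hd.
rewrite mul0r subr0 -[leRHS]normcN le_eqVlt; apply/orP; left; apply/eqP.
congr normc; rewrite /GRing.scale/= mulr1 [w + z]addrC.
by rewrite mulrBl mulrAC w1 mul1r; ring.
Qed.

Lemma holomorphicP h : holomorphic_on_disc h <->
  forall z, udisc z -> exists l, wirtinger h z l 0.
Proof.
split=> [hh z zu|H z /H[l]]; first exact: holomorphic_wirtinger.
exact: wirtinger_derivable.
Qed.

Lemma holomorphic_cstM (c : C) h : holomorphic_on_disc h ->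
  holomorphic_on_disc (fun z => c * h z).
Proof.
move=> /holomorphicP H; apply/holomorphicP => z /H[l hl]; exists (0 * h z + c * l).
by apply: wirtinger_eq (wirtingerM (wirtinger_cst c z) hl); ring.
Qed.

Lemma holomorphicX (N : nat) : holomorphic_on_disc (fun z : C => z ^+ N).
Proof.
apply/holomorphicP => z _; elim: N => [|N [l hl]]; first by exists 0; exact: wirtinger_cst.
exists (1 * z ^+ N + z * l).
have -> : (fun z : C => z ^+ N.+1) = fun z => z * z ^+ N by apply/funext => w; rewrite exprS.
by apply: wirtinger_eq (wirtingerM (wirtinger_id z) hl); ring.
Qed.

End holomorphic_converse.

(** * Holomorphic functions against radial functions *)

Section complex_green.
Context {R : realType}.
Local Notation C := (R[i]%type).
Local Notation Re := (@complex.Re R).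
Local Notation Im := (@complex.Im R).
Local Notation normc := (@ComplexField.Normc.normc R).
Local Notation dA := (@lebesgue_measure R \x @lebesgue_measure R)%E.
Implicit Types (z w a b : C) (F G h : C -> C).

(** Putting w = dx + i dy gives dF = (a + b) dx + i (a - b) dy; then take real and imaginary
    parts. *)
Lemma wirtinger_diff2 F (x y : R) a b : wirtinger F (x +i* y)%C a b ->
  diff2 (fun x y => Re (F (x +i* y)%C)) x y (Re (a + b)) (- Im (a - b)) /\
  diff2 (fun x y => Im (F (x +i* y)%C)) x y (Im (a + b)) (Re (a - b)).
Proof.
move=> H.
have key (e : R) : 0 < e -> exists2 d : R, 0 < d & forall x' y',
    `|x' - x| < d -> `|y' - y| < d ->
    normc (F (x' +i* y')%C - F (x +i* y)%C - (a + b) * (x' - x)%:C%C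
      - 'i%C * (a - b) * (y' - y)%:C%C) <= e * (`|x' - x| + `|y' - y|).
  move=> e0; have [d d0 Hd] := H e e0.
  exists (d / 2) => [|x' y' xd yd]; first by rewrite divr_gt0.
  have nw := normc_le_Re_Im ((x' - x) +i* (y' - y))%C.
  rewrite /= in nw.
  have wd : normc ((x' - x) +i* (y' - y))%C < d by apply: (le_lt_trans nw); lra.
  have {Hd wd} := Hd _ wd.
  have -> : ((x +i* y) + ((x' - x) +i* (y' - y)) = x' +i* y' :> C)%C.
    by simpc; rewrite !subrKC.
  move=> Hd; apply: le_trans (ler_wpM2l (ltW e0) nw).
  apply: le_trans Hd; rewrite le_eqVlt; apply/orP; left; apply/eqP; congr normc.
  move: (F _) (F _) => [u1 v1] [u2 v2]; case: (a) => a1 a2; case: (b) => b1 b2.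
  by simpc; congr (_ +i* _)%C; ring.
split=> e /key[d d0 Hd]; exists d => // x' y' /Hd /[apply];
  apply: le_trans.
  apply: le_trans (Re_le_normc _); rewrite le_eqVlt; apply/orP; left; apply/eqP.
  congr (`| _ |).
  move: (F _) (F _) => [u1 v1] [u2 v2]; case: (a) => a1 a2; case: (b) => b1 b2.
  by simpc => /=; ring.
apply: le_trans (Im_le_normc _); rewrite le_eqVlt; apply/orP; left; apply/eqP.
congr (`| _ |).
move: (F _) (F _) => [u1 v1] [u2 v2]; case: (a) => a1 a2; case: (b) => b1 b2.
by simpc => /=; ring.
Qed.

Lemma ccontinuous_Re F : (forall z, ccontinuous F z) ->
  continuous (fun w : R * R => Re (F (cplx w))).
Proof.
move=> cF [x y]; apply/cvgrPdist_le => e e0; have [d d0 Hd] := cF (x +i* y)%C e e0.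
apply/(@nbhs_ballP _ (R * R)%type); exists (d / 2) => /=; first by rewrite divr_gt0.
move=> [x' y'] [/= xd yd].
have nw := normc_le_Re_Im ((x' - x) +i* (y' - y))%C.
have wd : normc ((x' - x) +i* (y' - y))%C < d.
  rewrite /ball/= !(distrC _ x') !(distrC _ y') in xd yd.
  by apply: (le_lt_trans nw) => /=; lra.
have {Hd wd} := Hd _ wd.
have -> : ((x +i* y) + ((x' - x) +i* (y' - y)) = x' +i* y' :> C)%C.
  by simpc; rewrite !subrKC.
move=> Hd; rewrite distrC; apply: le_trans Hd; apply: le_trans (Re_le_normc _).
by rewrite /cplx raddfB.
Qed.

Lemma udisc2E (w : R * R) : udisc2 w = (w.1 ^+ 2 + w.2 ^+ 2 < 1) :> Prop.
Proof.
rewrite /udisc2/= /udisc/= /cplx.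
rewrite -(@ltr_pXn2r _ 2)// ?nnegrE ?normc_ge0// expr1n.
by rewrite sqr_sqrtr// addr_ge0// sqr_ge0.
Qed.

Lemma measurable_normc2 : measurable_fun [set: R * R] (fun w : R * R => w.1 ^+ 2 + w.2 ^+ 2).
Proof.
apply: measurable_funD; apply: measurable_funX.
- exact: measurable_fst.
- exact: measurable_snd.
Qed.

Lemma measurable_udisc2 : measurable (@udisc2 R).
Proof.
have -> : @udisc2 R = (fun w : R * R => w.1 ^+ 2 + w.2 ^+ 2) @^-1` `]-oo, 1[%classic.
  by apply/seteqP; split => w; rewrite udisc2E /= in_itv.
by rewrite -[X in measurable X]setTI; exact: measurable_normc2.
Qed.

(** For P and Q the imaginary and real parts of F / 2, the integrand Q_x - P_y of Green's formula is
    Re b. The square [-1, 1]^2 contains the disc, and its edges lie where F vanishes. *)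
Lemma integral_wirtinger_Re F (a b : C -> C) : (forall z, wirtinger F z (a z) (b z)) ->
  (forall z, ccontinuous b z) ->
  (forall z, 1 <= normc z -> F z = 0) -> (forall z, 1 <= normc z -> b z = 0) ->
  measurable_fun udisc2 (Re \o b \o cplx) ->
  \int[dA]_(w in udisc2) Re (b (cplx w)) = 0.
Proof.
move=> dF cb F0 b0 mb.
pose D (w : R * R) := Re (b (cplx w)).
have D0 (w : R * R) : ~ udisc2 w -> D w = 0.
  by rewrite /udisc2/= /udisc/= /D => /negP; rewrite -leNgt => H; rewrite b0.
have mD : measurable_fun setT D.
  rewrite (_ : D = (Re \o b \o cplx) \_ udisc2); last first.
    apply/funext => w; rewrite patchE; case: ifPn => // /negP wN.
    by apply: D0 => wu; apply: wN; rewrite inE.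
  by apply/(measurable_restrictT _ measurable_udisc2).
pose G z := (2^-1)%:C%C * F z.
have dG z : wirtinger G z ((2^-1)%:C%C * a z) ((2^-1)%:C%C * b z).
  by apply: wirtinger_eq (wirtingerM (wirtinger_cst _ z) (dF z)); ring.
have edge (x y : R) : 1 <= x ^+ 2 \/ 1 <= y ^+ 2 -> G (x +i* y)%C = 0.
  move=> xy; rewrite /G F0 ?mulr0// -(@ler_pXn2r _ 2)// ?nnegrE ?normc_ge0//.
  rewrite normcE_Re_Im/= expr1n; have := sqr_ge0 x; have := sqr_ge0 y.
  by case: xy; lra.
have E1 : (1 : R) <= (-1) ^+ 2 by rewrite sqrrN expr1n.
have E2 : (1 : R) <= (-1 + 2) ^+ 2.
  by rewrite (_ : -1 + 2 = 1 :> R) ?expr1n//; ring.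
have H : \int[dA]_(z in `]-1, -1 + 2] `*` `]-1, -1 + 2]) D z = 0.
  apply: (@green_compact_support R (fun x y => Im (G (x +i* y)%C))
    (fun x y => Re (G (x +i* y)%C)) D (-1) 2 (ltr0Sn _ 1)).
  - move=> x y; have [dR dI] := wirtinger_diff2 (dG (x +i* y)%C).
    do 4 eexists; split; [exact: dI|exact: dR|].
    rewrite /D /cplx/=; case: (a _) => a1 a2; case: (b _) => b1 b2.
    by simpc => /=; field.
  - exact: ccontinuous_Re cb.
  - exact: mD.
  - by move=> x; rewrite !edge//; right.
  - by move=> x; rewrite !edge//; left.
rewrite -H [in LHS]Rintegral_mkcond [in RHS]Rintegral_mkcond.
apply: eq_Rintegral => w _; rewrite !patchE.
case: ifPn => [wu|/negP wu].
  rewrite ifT//; rewrite inE udisc2E in wu; case: w wu => x y /= xy1.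
  rewrite inE; split => /=; rewrite in_itv/=; apply/andP; split; nra.
case: ifP => // _; apply/esym/D0 => wu'; apply: wu; exact/mem_set.
Qed.

Lemma integral_wirtinger_Im F (a b : C -> C) : (forall z, wirtinger F z (a z) (b z)) ->
  (forall z, ccontinuous b z) ->
  (forall z, 1 <= normc z -> F z = 0) -> (forall z, 1 <= normc z -> b z = 0) ->
  measurable_fun udisc2 (Im \o b \o cplx) ->
  \int[dA]_(w in udisc2) Im (b (cplx w)) = 0.
Proof.
move=> dF cb F0 b0 mb.
have ImE z : Im z = Re (- 'i%C * z) by case: z => x y; simpc.
under eq_Rintegral do rewrite ImE.
apply: (@integral_wirtinger_Re (fun z => - 'i%C * F z)
  (fun z => - 'i%C * a z) (fun z => - 'i%C * b z)).
- by move=> z; apply: wirtinger_eq (wirtingerM (wirtinger_cst _ z) (dF z)); ring.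
- move=> z; apply: ccontinuousM => //.
  exact: wirtinger_ccontinuous (wirtinger_cst _ z).
- by move=> z /F0 ->; rewrite mulr0.
- by move=> z /b0 ->; rewrite mulr0.
- by apply: eq_measurable_fun mb => w _ /=; rewrite ImE.
Qed.

Lemma cmeasurableM F G : cmeasurable F -> cmeasurable G ->
  cmeasurable (fun z => F z * G z).
Proof.
move=> [mF1 mF2] [mG1 mG2]; split.
- apply: (eq_measurable_fun (fun w : R * R => Re (F (cplx w)) * Re (G (cplx w)) -
    Im (F (cplx w)) * Im (G (cplx w)))).
    by move=> w _ /=; case: (F _) => a b; case: (G _) => c d.
  by apply: measurable_funB; apply: measurable_funM.
- apply: (eq_measurable_fun (fun w : R * R => Re (F (cplx w)) * Im (G (cplx w)) +
    Im (F (cplx w)) * Re (G (cplx w)))).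
    by move=> w _ /=; case: (F _) => a b; case: (G _) => c d.
  by apply: measurable_funD; apply: measurable_funM.
Qed.

Lemma cmeasurable_real (g : R * R -> R) : measurable_fun udisc2 g ->
  cmeasurable (fun z => (g (Re z, Im z))%:C%C).
Proof.
move=> mg; split; last exact: measurable_cst.
by apply: (eq_measurable_fun g) => // -[x y] _.
Qed.

Lemma cmeasurable_radial (g : R -> R) : measurable_fun setT g ->
  cmeasurable (fun z => (g (normc z ^+ 2))%:C%C).
Proof.
move=> mg.
have -> : (fun z => (g (normc z ^+ 2))%:C%C) =
    fun z => (g ((Re z, Im z).1 ^+ 2 + (Re z, Im z).2 ^+ 2))%:C%C.
  by apply/funext => z; rewrite normcE_Re_Im.
apply: (@cmeasurable_real (g \o (fun w : R * R => w.1 ^+ 2 + w.2 ^+ 2))).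
apply: measurable_funTS; apply: measurableT_comp => //; exact: measurable_normc2.
Qed.

Lemma cmeasurable_cst (c : C) : cmeasurable (fun=> c).
Proof. by split; exact: measurable_cst. Qed.

Lemma cmeasurable_id : cmeasurable (@id C).
Proof.
by split; apply: measurable_funTS; [exact: measurable_fst|exact: measurable_snd].
Qed.

Lemma cmeasurable_conjc F : cmeasurable F -> cmeasurable (conjc \o F).
Proof.
move=> [mF1 mF2]; split.
  by apply: eq_measurable_fun mF1 => w _ /=; case: (F _).
apply: (eq_measurable_fun (fun w : R * R => - Im (F (cplx w)))).
  by move=> w _ /=; case: (F _).
exact: measurable_funN.
Qed.

Lemma cmeasurableX F n : cmeasurable F -> cmeasurable (fun z => F z ^+ n).
Proof.
move=> mF; elim: n => [|n IH]; first exact: cmeasurable_cst.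
rewrite (_ : (fun z => F z ^+ n.+1) = fun z => F z * F z ^+ n).
  exact: cmeasurableM.
by apply/funext => z; rewrite exprS.
Qed.

(* The Wirtinger derivative in conj(z) of [conj(z)^(N+1) Z(|z|^2)]. *)
Definition radial_dbar N (Z Z' : R -> R) z : C :=
  conjc z ^+ N *
  (N.+1%:R * Z (normc z ^+ 2) + normc z ^+ 2 * Z' (normc z ^+ 2))%:C%C.

Lemma cmeasurable_radial_dbar N (Z Z' : R -> R) :
  measurable_fun setT Z -> measurable_fun setT Z' -> cmeasurable (radial_dbar N Z Z').
Proof.
move=> mZ mZ'; apply: cmeasurableM.
  apply: cmeasurableX; apply: (@cmeasurable_conjc id); exact: cmeasurable_id.
apply: (@cmeasurable_radial (fun u => N.+1%:R * Z u + u * Z' u)).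
apply: measurable_funD; apply: measurable_funM => //.
Qed.

Lemma wirtinger_radial N (Z Z' : R -> R) z : is_derive (normc z ^+ 2) 1 Z (Z' (normc z ^+ 2)) ->
  exists a, wirtinger (fun z => conjc z ^+ N.+1 * (Z (normc z ^+ 2))%:C%C) z a
    (radial_dbar N Z Z' z).
Proof.
move=> dZ; eexists.
apply: wirtinger_eq (wirtingerM (wirtinger_conjcX N.+1 z)
  (wirtinger_comp (wirtinger_normc2 z) dZ)); first by reflexivity.
have cE (x y u : R) : (N.+1%:R * x + u * y)%:C%C = N.+1%:R * x%:C%C + u%:C%C * y%:C%C :> C.
  by rewrite rmorphD !rmorphM rmorph_nat.
rewrite /radial_dbar cE -normc_conjCM /=.
by move: (Z _) (Z' _) => u v; rewrite exprS; ring.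
Qed.

Lemma ccontinuous_radial_dbar N (Z Z' : R -> R) z :
  {for normc z ^+ 2, continuous Z} -> {for normc z ^+ 2, continuous Z'} ->
  ccontinuous (radial_dbar N Z Z') z.
Proof.
move=> cZ cZ'; apply: ccontinuousM.
  exact: wirtinger_ccontinuous (wirtinger_conjcX N z).
have cg : {for normc z ^+ 2, continuous (fun u : R => N.+1%:R * Z u + u * Z' u)}.
  by apply: cvgD; apply: cvgM => //; exact: cvg_cst.
move=> e e0; move/cvgrPdist_le : cg => /(_ _ e0)/nbhs_ballP[d /= d0 Hd].
have d20 : 0 < d / 2 by rewrite divr_gt0.
have [d' d'0 H] := wirtinger_ccontinuous (wirtinger_normc2 z) d20.
exists d' => // w /H; rewrite -rmorphB normc_real => {}H.
rewrite subrr expr0n addr0 sqrtr_sqr distrC; apply: Hd; rewrite /ball/= distrC; apply: le_lt_trans H _; lra.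
Qed.

(** As h has no derivative in conj(z), the integrand is the derivative in conj(z) of h conj(z)^(N+1)
    Z(|z|^2). The values of h off the disc are arbitrary, but Z vanishes beyond rho < 1, so this
    product is 0 near every point with |z| >= 1. *)
Lemma holomorphic_orth_radial_dbar h N (Z Z' : R -> R) (rho : R) :
  holomorphic_on_disc h -> cmeasurable h -> rho < 1 ->
  (forall u : R, is_derive u 1 Z (Z' u)) -> continuous Z' ->
  (forall u, rho < u -> Z u = 0 /\ Z' u = 0) ->
  \int[dA]_(w in udisc2) Re (h (cplx w) * radial_dbar N Z Z' (cplx w)) = 0 /\
  \int[dA]_(w in udisc2) Im (h (cplx w) * radial_dbar N Z Z' (cplx w)) = 0.
Proof.
move=> hh mh rho1 dZ cZ' Z0.
pose F z := h z * (conjc z ^+ N.+1 * (Z (normc z ^+ 2))%:C%C).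
pose b z := h z * radial_dbar N Z Z' z.
have cZ : continuous Z.
  move=> u; apply: differentiable_continuous; apply/derivable1_diffP.
  by case: (dZ u).
have far z : 1 <= normc z -> exists2 d : R, 0 < d & forall w, normc w < d -> F (z + w) = 0 /\ b (z + w) = 0.
  move=> z1.
  have r1 : rho < normc z ^+ 2 by apply: (lt_le_trans rho1); rewrite exprn_ege1.
  have e0 : 0 < (normc z ^+ 2 - rho) / 2 by rewrite divr_gt0// subr_gt0.
  have [d d0 Hd] := wirtinger_ccontinuous (wirtinger_normc2 z) e0.
  exists d => // w /Hd; rewrite -rmorphB normc_real ler_norml => /andP[H _].
  have [|Z1 Z2] := Z0 (normc (z + w) ^+ 2); first by lra.
  by rewrite /F /b /radial_dbar Z1 Z2 !mulr0 addr0 !mulr0.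
have dF z : exists a, wirtinger F z a (b z).
  have [z1|z1] := ltP (normc z) 1; last first.
    have [d d0 Hd] := far z z1; exists 0.
    have -> : b z = 0 by rewrite -[z]addr0 (Hd 0 _).2// ComplexField.Normc.normc0.
    by apply: (wirtinger_near0 d0) => w /Hd[].
  have [l hl] := holomorphic_wirtinger hh z1.
  have [a' ha'] := wirtinger_radial N (dZ (normc z ^+ 2)).
  eexists; apply: wirtinger_eq (wirtingerM hl ha'); first by reflexivity.
  by rewrite mul0r add0r.
have cb z : ccontinuous b z.
  have [z1|z1] := ltP (normc z) 1; last first.
    have [d d0 Hd] := far z z1.
    by apply: wirtinger_ccontinuous; apply: (wirtinger_near0 d0) => w /Hd[].
  have [l hl] := holomorphic_wirtinger hh z1.
  apply: ccontinuousM; first exact: wirtinger_ccontinuous hl.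
  by apply: ccontinuous_radial_dbar; [exact: cZ|exact: cZ'].
have [a Ha] := choice dF.
have at_z z : 1 <= normc z -> F z = 0 /\ b z = 0.
  by move=> /far[d d0 /(_ 0)]; rewrite addr0 ComplexField.Normc.normc0 => /(_ d0).
have [mR mI] : cmeasurable b.
  apply: cmeasurableM => //; apply: cmeasurable_radial_dbar.
    exact: continuous_measurable_fun.
  exact: continuous_measurable_fun.
split; [apply: (integral_wirtinger_Re Ha) => // z /at_z[]//
       |apply: (integral_wirtinger_Im Ha) => // z /at_z[]//].
Qed.

End complex_green.

(** * Cutoff of radial profiles *)

Section cutoff.
Context {R : realType}.
Local Notation mu := (@lebesgue_measure R).
Implicit Types (u v e : R).

(** The square makes the positive part C^1, so that the cutoff has a continuous derivative. *)
Definition pos2 (t : R) := Num.max 0 t ^+ 2.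

Lemma is_derive_pos2 (t : R) : is_derive t 1 pos2 (2 * Num.max 0 t).
Proof.
apply/is_derive_epsP => e e0; exists e => // y yt.
have key : `|pos2 y - pos2 t - 2 * Num.max 0 t * (y - t)| <= `|y - t| ^+ 2.
  rewrite real_normK ?num_real// /pos2.
  have [y0|y0] := leP 0 y; have [t0|t0] := leP 0 t; rewrite ler_norml;
    apply/andP; split; have := sqr_ge0 (y - t); rewrite !expr2 => h; try lra; nra.
by apply: le_trans key _; rewrite expr2 ler_wpM2r// ltW.
Qed.

Variables (w phi : R -> R) (c K : R) (m : nat).
Hypothesis w_cont : forall u, u < 1 -> {for u, continuous w}.
Hypothesis w_gt0 : forall u, u < 1 -> 0 < w u.
Hypothesis w_noninc : forall u v, 0 <= u -> u <= v -> v < 1 -> w v <= w u.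
Hypothesis phi_cont : forall u, 0 < u < 1 -> {for u, continuous phi}.
Hypothesis phi_bound : forall u, 0 < u < 1 -> `|u ^+ m * phi u| <= K.

(** The derivative of Y: if Z = Y / v^(2m+1), then (2m+1) Z + v Z' = Y' / v^(2m) = (phi - c) w, so
    conj(z)^(2m) (phi - c) w is the derivative in conj(z) of conj(z)^(2m+1) Z(|z|^2). *)
Definition profile v := v ^+ m.*2 * (phi v - c) * w v.

(** One factor v^m absorbs [phi], which may blow up at 0; the other one survives. *)
Lemma profile_bound v : 0 < v < 1 -> `|profile v| <= (K + `|c|) * v ^+ m * w v.
Proof.
move=> v01; have /andP[v0 v1] := v01.
have vm : 0 <= v ^+ m by rewrite exprn_ge0// ltW.
have vm1 : v ^+ m <= 1 by rewrite exprn_ile1// ltW.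
rewrite /profile normrM (gtr0_norm (w_gt0 v1)) ler_wpM2r ?(ltW (w_gt0 v1))//.
rewrite -addnn exprD -mulrA normrM (ger0_norm vm) mulrC ler_wpM2r//.
rewrite mulrBr; apply: le_trans (ler_normB _ _) _.
by rewrite lerD ?phi_bound// normrM (ger0_norm vm) ler_piMl.
Qed.

Let K0 : 0 <= K.
Proof.
by apply: le_trans (phi_bound (u := 2^-1) _); rewrite ?normr_ge0//; apply/andP; split; lra.
Qed.

Let Kc0 : 0 <= K + `|c|. Proof. by rewrite addr_ge0. Qed.

Lemma profile_le_w0 v : 0 < v < 1 -> `|profile v| <= (K + `|c|) * w 0.
Proof.
move=> v01; have /andP[v0 v1] := v01.
apply: le_trans (profile_bound v01) _; rewrite -mulrA ler_wpM2l//.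
have w0v : w v <= w 0 by rewrite w_noninc// ltW.
apply: le_trans w0v; rewrite ler_piMl ?(ltW (w_gt0 v1))//.
by rewrite exprn_ile1// ltW.
Qed.

Lemma profile_cont v : 0 < v < 1 -> {for v, continuous profile}.
Proof.
move=> v01; have /andP[v0 v1] := v01.
apply: cvgM; last exact: w_cont.
apply: cvgM; first exact: exprn_continuous.
by apply: cvgB; [exact: phi_cont|exact: cvg_cst].
Qed.

Lemma profile_integrable (A : set R) : measurable A -> A `<=` `]0, 1[%classic ->
  mu.-integrable A (EFin \o profile).
Proof.
move=> mA A01.
apply: (@integrableS _ _ _ mu `]0, 1[%classic) => //.
apply: measurable_bounded_integrable => //.
- by rewrite /= lebesgue_measure_itv/= lte_fin ltr01 oppr0 adde0 ltry.
- apply: open_continuous_measurable_fun; first exact: itv_open.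
  by move=> v; rewrite inE/= in_itv/= => v01; exact: profile_cont.
- exists ((K + `|c|) * w 0); split; first exact: num_real.
  move=> x Kx v /=; rewrite in_itv/= => /profile_le_w0/le_trans; apply; exact: ltW.
Qed.

Definition primitive u := \int[mu]_(v in `]0, u]) profile v.

Lemma primitive_derive u : 0 < u < 1 -> is_derive u 1 primitive (profile u).
Proof.
move=> u01; have /andP[u0 u1] := u01.
have uh : u < (u + 1) / 2 by lra.
have int : mu.-integrable [set` Interval (BRight 0) (BRight ((u + 1) / 2))] (EFin \o profile).
  apply: profile_integrable => //= v /=; rewrite !in_itv/= => /andP[-> vu] /=; lra.
have au : (BRight 0 < BRight u)%O by rewrite bnd_simp.
have [] := @continuous_FTC1 R profile (BRight 0) u _ uh int au (profile_cont u01).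
move=> dY YE; apply: DeriveDef; first exact: dY.
by rewrite -derive1E.
Qed.

Hypothesis mean0 : \int[mu]_(v in `]0, 1[) profile v = 0.

Lemma integral_itv_bound (a b k : R) b0 b1 : 0 <= a -> a <= b -> b <= 1 -> 0 <= k ->
  [set` Interval (BSide b0 a) (BSide b1 b)] `<=` `]0, 1[%classic ->
  (forall v, [set` Interval (BSide b0 a) (BSide b1 b)] v -> `|profile v| <= k) ->
  `|\int[mu]_(v in [set` Interval (BSide b0 a) (BSide b1 b)]) profile v| <= k * (b - a).
Proof.
move=> a0 ab b1' k0 sub H.
set I := [set` _] in sub H *.
have mI : measurable I by exact: measurable_itv.
have intI : mu.-integrable I (EFin \o profile) by exact: profile_integrable.
apply: le_trans (le_normr_Rintegral _ intI) _ => //.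
have muI : (mu I <= (b - a)%:E)%E.
  rewrite lebesgue_measure_itv/=; case: ifP => // _.
  by rewrite lee_fin subr_ge0.
have muIf : (mu I < +oo)%E by apply: le_lt_trans muI _; exact: ltry.
have : \int[mu]_(v in I) `|profile v| <= \int[mu]_(v in I) k.
  apply: le_Rintegral => //.
    exact: integrable_norm.
  apply: measurable_bounded_integrable => //.
  by exists `|k|; split => // x kx v _; exact: ltW.
move=> /le_trans; apply; rewrite Rintegral_cst// ler_wpM2l//.
rewrite -lee_fin fineK//; apply/fin_real.
by rewrite muIf andbT; apply: lt_le_trans (measure_ge0 _ _); exact: ltNyr.
Qed.

(** On the left half the integral is estimated from 0, on the right half from 1, thanks to [mean0].
    As [w] is monotone, this produces the factors u and 1 - u that will compensate the derivative of
    the cutoff. *)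
Lemma primitive_bound : exists2 K1, 0 <= K1 & forall u, 0 < u < 1 ->
  `|primitive u| <= K1 * (u * (1 - u)) * (u ^+ m * w u).
Proof.
(* [k1] serves u <= 1/2, where w(u) >= w(1/2) and 2 (1 - u) >= 1; [k2] serves u > 1/2, where (2
   u)^(m+1) >= 1. *)
pose k1 := 2 * (K + `|c|) * w 0 / w 2^-1.
pose k2 := (K + `|c|) * 2 ^+ m.+1.
have wh : 0 < w 2^-1 by apply: w_gt0; lra.
have w00 : 0 < w 0 by apply: w_gt0.
have k10 : 0 <= k1 by rewrite divr_ge0 ?(ltW wh)// !mulr_ge0 ?(ltW w00).
have k20 : 0 <= k2 by rewrite mulr_ge0// exprn_ge0.
exists (k1 + k2) => [|u u01]; first exact: addr_ge0.
have /andP[u0 u1] := u01.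
have um0 : 0 < u ^+ m by rewrite exprn_gt0.
have wu := w_gt0 u1.
have X0 : 0 <= (u * (1 - u)) * (u ^+ m * w u).
  by rewrite !mulr_ge0 ?subr_ge0 ?(ltW u0) ?(ltW u1) ?(ltW um0) ?(ltW wu).
rewrite -mulrA mulrDl.
have [uh|uh] := leP u 2^-1.
  apply: ler_wpDr; first exact: mulr_ge0.
  have : `|primitive u| <= (K + `|c|) * u ^+ m * w 0 * (u - 0).
    apply: integral_itv_bound => //; try exact: ltW.
    - by rewrite !mulr_ge0 ?(ltW um0) ?(ltW w00).
    - by move=> v /=; rewrite !in_itv/= => /andP[-> /le_lt_trans->].
    - move=> v /=; rewrite in_itv/= => /andP[v0 vu].
      have v1 : v < 1 by apply: le_lt_trans u1.
      apply: le_trans (profile_bound _) _; first by rewrite v0.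
      apply: ler_pM => //; first by rewrite mulr_ge0// exprn_ge0// ltW.
      - by rewrite ltW// w_gt0.
      - by rewrite ler_wpM2l// lerXn2r// nnegrE ltW.
      - by apply: w_noninc => //; exact: ltW.
  move=> /le_trans; apply; rewrite subr0.
  have wm : w 2^-1 <= w u by apply: w_noninc => //; [exact: ltW|lra].
  have h1 : 1 <= 2 * (1 - u) by lra.
  have -> : (K + `|c|) * u ^+ m * w 0 * u = ((K + `|c|) * w 0 * (u * u ^+ m)) * (1 * 1) by ring.
  have -> : k1 * (u * (1 - u) * (u ^+ m * w u)) =
    ((K + `|c|) * w 0 * (u * u ^+ m)) * ((2 * (1 - u)) * (w u / w 2^-1)) by rewrite /k1; ring.
  apply: ler_wpM2l; first by rewrite !mulr_ge0// ltW.
  by apply: ler_pM => //; rewrite ler_pdivlMr// mul1r.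
apply: ler_wpDl; first exact: mulr_ge0.
have E : primitive u = - \int[mu]_(v in `]u, 1[) profile v.
  have i01 : `]0, 1[%classic = `]0, u]%classic `|` `]u, 1[%classic :> set R.
    by rewrite -itv_bndbnd_setU// bnd_simp// ltW.
  apply/eqP; rewrite -addr_eq0 /primitive -Rintegral_setU//.
  - by rewrite -i01 mean0.
  - by rewrite -i01; exact: profile_integrable.
  - apply/disj_setPS => v [/=]; rewrite !in_itv/= => /andP[_ vu] /andP[].
    by rewrite ltNge vu.
rewrite E normrN.
have : `|\int[mu]_(v in `]u, 1[) profile v| <= (K + `|c|) * w u * (1 - u).
  apply: integral_itv_bound => //; try exact: ltW.
  - by rewrite !mulr_ge0 ?(ltW wu).
  - by move=> v /=; rewrite !in_itv/= => /andP[/(lt_trans u0) -> ->].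
  - move=> v /=; rewrite in_itv/= => /andP[vu v1].
    have v0 : 0 < v by apply: lt_trans vu.
    apply: le_trans (profile_bound _) _; first by rewrite v0.
    rewrite -mulrA ler_wpM2l//.
    have wvu : w v <= w u by apply: w_noninc => //; exact: ltW.
    apply: le_trans wvu; rewrite ler_piMl ?(ltW (w_gt0 v1))//.
    by rewrite exprn_ile1// ltW.
move=> /le_trans; apply.
have -> : k2 * (u * (1 - u) * (u ^+ m * w u)) =
  (K + `|c|) * w u * (1 - u) * (2 ^+ m.+1 * u ^+ m.+1) by rewrite /k2 !exprS; ring.
rewrite ler_peMr//; first by by rewrite !mulr_ge0 ?subr_ge0 ?(ltW u1) ?(ltW wu).
by rewrite -exprMn exprn_ege1//; lra.
Qed.

Local Notation g u := (u * (1 - u)).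

(* [cutZ e] is [eta u * primitive u / u^(2m+1)] for the cutoff
   [eta u = (max(0, g u - e) / g u)^2], which vanishes near 0 and 1 and tends
   to 1 on ]0, 1[ as e tends to 0; [cutZ' e] is its derivative. *)
Definition cutZ e u := pos2 (g u - e) * (primitive u / (u ^+ m.*2.+1 * g u ^+ 2)).

Definition cutZ' e u :=
  (2 * Num.max 0 (g u - e) * e * (1 - 2 * u) / g u ^+ 3 * primitive u +
   pos2 (g u - e) / g u ^+ 2 * profile u) / u ^+ m.*2.+1
  - m.*2.+1%:R * cutZ e u / u.

Lemma cutZ_far e u : g u <= e -> cutZ e u = 0 /\ cutZ' e u = 0.
Proof.
move=> ue; have M0 : Num.max 0 (g u - e) = 0.
  by apply/max_idPl; rewrite subr_le0.
by rewrite /cutZ' /cutZ /pos2 M0 expr0n/= !(mulr0, mul0r, addr0, subr0).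
Qed.

Lemma cont_g u : {for u, continuous (fun u : R => g u)}.
Proof.
apply: cvgM; first exact: cvg_id.
by apply: cvgB; [exact: cvg_cst|exact: cvg_id].
Qed.

Lemma cutZ_near0 e u : g u < e -> \forall v \near u, cutZ e v = 0 /\ cutZ' e v = 0.
Proof.
move=> ue; near=> v; apply: cutZ_far; apply: ltW; near: v.
exact: (cvgr_lt _ (@cont_g u)).
Unshelve. all: by end_near.
Qed.

Lemma g_gt0 u : (0 < g u) = (0 < u < 1).
Proof.
apply/idP/idP => [gu|/andP[u0 u1]]; last by rewrite mulr_gt0// subr_gt0.
apply/andP; split; rewrite ltNge; apply/negP => h; move: gu; rewrite ltNge => /negP; apply; nra.
Qed.

Lemma cutZ_derive e u : 0 < e -> is_derive u 1 (cutZ e) (cutZ' e u).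
Proof.
move=> e0; have [gu|gu] := leP (g u) 0.
  have ue : g u < e by apply: le_lt_trans e0.
  rewrite (cutZ_far (ltW ue)).2.
  have : is_derive u 1 (cst 0 : R -> R) 0 by exact: is_derive_cst.
  apply: near_eq_is_derive => //.
  by apply: filterS (cutZ_near0 ue) => v [-> _].
have u01 : 0 < u < 1 by rewrite -g_gt0.
have /andP[u0 u1] := u01.
have dg : is_derive u 1 (fun u : R => g u - e) (1 - 2 * u).
  by apply: is_derive_eq; rewrite /GRing.scale/=; ring.
have dp : is_derive u 1 (fun u => pos2 (g u - e)) (2 * Num.max 0 (g u - e) * (1 - 2 * u)).
  exact: (@is_derive1_comp _ pos2 _ u _ _ (is_derive_pos2 _) dg).
have dY := primitive_derive u01.
have dX : is_derive u 1 (fun u : R => u ^+ m.*2.+1) (m.*2.+1%:R * u ^+ m.*2).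
  have H := @is_deriveX _ _ id m.*2.+1 u 1 _ (is_derive_id u 1).
  rewrite (_ : (fun x : R => x ^+ m.*2.+1) = id ^+ m.*2.+1); last first.
    by apply/funext => x; rewrite exprfctE.
  by apply: (is_derive_eq H); rewrite /GRing.scale/= mulr1.
have dG : is_derive u 1 (fun u : R => g u ^+ 2) (2 * g u * (1 - 2 * u)).
  by apply: is_derive_eq; rewrite /GRing.scale/=; ring.
have dD := is_deriveM dX dG.
have D0 : u ^+ m.*2.+1 * g u ^+ 2 != 0 by rewrite mulf_neq0// expf_neq0// gt_eqF.
have dV := @is_deriveV _ (fun u : R => u ^+ m.*2.+1 * g u ^+ 2) u _ 1 D0 dD.
have dd := is_deriveM dp (is_deriveM dY dV).
have -> : cutZ e = (fun u : R => pos2 (g u - e)) *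
  (primitive * (fun u : R => (u ^+ m.*2.+1 * g u ^+ 2)^-1)) by [].
apply: (is_derive_eq dd).
rewrite /GRing.scale/= /cutZ' /cutZ /pos2 fctE.
have ME : Num.max 0 (g u - e) ^+ 2 = Num.max 0 (g u - e) * (g u - e).
  by case: leP => h; rewrite ?expr2// ?mul0r.
have U0 : u ^+ m.*2 != 0 by rewrite expf_neq0// gt_eqF.
have u1' : 1 - u != 0 by rewrite gt_eqF// subr_gt0.
rewrite ME (exprS u m.*2); move: (Num.max _ _) (primitive u) (profile u) U0 => M Y p.
move: (u ^+ m.*2) (m.*2.+1%:R : R) => U n U0.
by field; rewrite U0 u1' gt_eqF.
Qed.

Lemma cutZ'_cont e : 0 < e -> continuous (cutZ' e).
Proof.
move=> e0 u; have [gu|gu] := leP (g u) 0.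
  have ue : g u < e by apply: le_lt_trans e0.
  rewrite /continuous_at (cutZ_far (ltW ue)).2.
  apply: cvg_near_cst; apply: filterS (cutZ_near0 ue) => v [_ ->].
  by [].
have u01 : 0 < u < 1 by rewrite -g_gt0.
have /andP[u0 u1] := u01.
have cY : {for u, continuous primitive}.
  by apply: differentiable_continuous; apply/derivable1_diffP; case: (primitive_derive u01).
have cp := profile_cont u01.
have cg := @cont_g u.
have cx : {for u, continuous (fun u : R => u ^+ m.*2.+1)} by exact: exprn_continuous.
have cM : {for u, continuous (fun u : R => Num.max 0 (g u - e))}.
  by apply: continuous_max; [exact: cvg_cst|apply: cvgB => //; exact: cvg_cst].
have cZ : {for u, continuous (cutZ e)}.
  by apply: differentiable_continuous; apply/derivable1_diffP; case: (cutZ_derive u e0).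
have cX k (h : R -> R) : {for u, continuous h} -> {for u, continuous (fun u => h u ^+ k)}.
  by move=> ch; exact: (cvg_comp _ _ ch (@exprn_continuous R k (h u))).
have g0 k : g u ^+ k != 0 by rewrite expf_neq0// gt_eqF.
have x0 k : u ^+ k != 0 by rewrite expf_neq0// gt_eqF.
have cc (k : R) : {for u, continuous (cst k : R -> R)} by exact: cvg_cst.
have ci : {for u, continuous (id : R -> R)} by exact: cvg_id.
rewrite /continuous_at /cutZ'; apply: cvgB; apply: cvgM.
- apply: cvgD; apply: cvgM => //.
  + apply: cvgM; last by apply: cvgV => //; exact: (cX 3%N).
    apply: cvgM.
      by apply: cvgM; [apply: cvgM; [exact: cc|exact: cM]|exact: cc].
    by apply: cvgB; [exact: cc|apply: cvgM => //; exact: cc].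
  + apply: cvgM; last by apply: cvgV => //; exact: (cX 2%N).
    exact: (cX 2%N _ cM).
- by apply: cvgV.
- by apply: cvgM => //; exact: cc.
- by apply: cvgV => //; rewrite gt_eqF.
Qed.

(** The contribution of u^(-2m-1) cancels; what remains is u^(-2m) times the derivative of the
    cutoff times [primitive]. *)
Lemma cutZ_dbar e u : 0 < u < 1 ->
  m.*2.+1%:R * cutZ e u + u * cutZ' e u =
  (2 * Num.max 0 (g u - e) * e * (1 - 2 * u) / g u ^+ 3 * primitive u +
   pos2 (g u - e) / g u ^+ 2 * profile u) / u ^+ m.*2.
Proof.
move=> /andP[u0 u1]; rewrite /cutZ'.
have U0 : u ^+ m.*2 != 0 by rewrite expf_neq0// gt_eqF.
have u1' : 1 - u != 0 by rewrite gt_eqF// subr_gt0.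
rewrite (exprS u m.*2); move: (cutZ e u) (primitive u) (profile u) U0 => Z Y p.
move: (u ^+ m.*2) (m.*2.+1%:R : R) => U n U0.
by field; rewrite U0 u1' gt_eqF.
Qed.

(** Uniformity in e is the point. With g = u (1 - u), the derivative of the cutoff is at most 2 / g,
    since max(0, g - e) e <= g^2, and the factor g of [primitive_bound] compensates it. *)
Lemma cutZ_dbar_bound : exists2 K2, 0 <= K2 & forall e u, 0 < e -> 0 < u < 1 ->
  `|u ^+ m * (m.*2.+1%:R * cutZ e u + u * cutZ' e u)| <= K2 * w u.
Proof.
have [K1 K10 HK1] := primitive_bound.
exists (2 * K1 + (K + `|c|)) => [|e u e0 u01].
  by rewrite addr_ge0// mulr_ge0.
have /andP[u0 u1] := u01.
have g0 : 0 < g u by rewrite g_gt0.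
have wu := w_gt0 u1.
have um0 : 0 < u ^+ m by rewrite exprn_gt0.
rewrite cutZ_dbar// -addnn exprD.
set M := Num.max 0 (g u - e).
have M0 : 0 <= M by rewrite le_max lexx.
have Mg : M <= g u by rewrite ge_max ltW//= gerBl ltW.
have Me : M * e <= g u * g u.
  rewrite /M; case: (leP 0 (g u - e)) => h; last by rewrite mul0r mulr_ge0 ?(ltW g0).
  have eg : e <= g u by rewrite -subr_ge0.
  by apply: ler_pM; rewrite ?(ltW e0)// gerBl ltW.
have b1 : `|2 * M * e * (1 - 2 * u) / g u ^+ 3| <= 2 / g u.
  rewrite !normrM normfV normrX (gtr0_norm g0) (ger0_norm M0) (gtr0_norm e0).
  rewrite (gtr0_norm (ltr0Sn _ 1)).
  have h : `|1 - 2 * u| <= 1 by rewrite ler_norml; lra.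
  have -> : 2 / g u = 2 * (g u * g u) * 1 / g u ^+ 3 by field; rewrite !gt_eqF ?subr_gt0.
  apply: ler_wpM2r; first by rewrite invr_ge0 exprn_ge0 ?(ltW g0).
  have h2 : 0 <= 2 * M * e by rewrite !mulr_ge0// ltW.
  have h3 : 2 * M * e <= 2 * (g u * g u) by rewrite -mulrA ler_wpM2l.
  exact: ler_pM.
have b2 : `|pos2 (g u - e) / g u ^+ 2| <= 1.
  rewrite normrM normfV /pos2 -/M !normrX (gtr0_norm g0) (ger0_norm M0).
  by rewrite ler_pdivrMr ?exprn_gt0// mul1r lerXn2r ?nnegrE// ltW.
set a1 := (X in X * primitive u) in b1 *.
set a2 := (X in X * profile u) in b2 *.
have -> : u ^+ m * ((a1 * primitive u + a2 * profile u) / (u ^+ m * u ^+ m)) =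
  (a1 * primitive u + a2 * profile u) / u ^+ m.
  by field; rewrite gt_eqF.
rewrite normrM normfV (gtr0_norm um0) ler_pdivrMr//.
apply: le_trans (ler_normD _ _) _; rewrite (normrM a1) (normrM a2).
have c1 : `|a1| * `|primitive u| <= 2 / g u * (K1 * g u * (u ^+ m * w u)).
  by apply: ler_pM => //; exact: HK1.
have c2 : `|a2| * `|profile u| <= 1 * ((K + `|c|) * u ^+ m * w u).
  by apply: ler_pM => //; exact: profile_bound.
apply: le_trans (lerD c1 c2) _; rewrite le_eqVlt; apply/orP; left; apply/eqP.
by field; rewrite !gt_eqF ?subr_gt0.
Qed.

(** The derivative of the cutoff carries a factor e, and the cutoff itself tends to 1. *)
Lemma cutZ_dbar_cvg (e : nat -> R) u : 0 < u < 1 -> e @ \oo --> 0 ->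
  m.*2.+1%:R * cutZ (e n) u + u * cutZ' (e n) u @[n --> \oo] --> (phi u - c) * w u.
Proof.
move=> u01 e0; have /andP[u0 u1] := u01.
have g0 : 0 < g u by rewrite g_gt0.
under eq_cvg do rewrite cutZ_dbar//.
have cM : Num.max 0 (g u - e n) @[n --> \oo] --> Num.max 0 (g u - 0).
  have H (x y : R) : `|Num.max 0 x - Num.max 0 y| <= `|x - y|.
    by case: (leP 0 x) => ?; case: (leP 0 y) => ?; rewrite ler_norml;
      have := ler_norm (x - y); have := ler_norm (y - x); rewrite (distrC y); lra.
  move/cvgrPdist_le : e0 => e0; apply/cvgrPdist_le => d d0; near=> n.
  apply: le_trans (H _ _) _; rewrite (_ : _ - _ = - (0 - e n)); last by ring.
  by rewrite normrN; near: n; exact: e0.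
have -> : (phi u - c) * w u =
   (2 * Num.max 0 (g u - 0) * 0 * (1 - 2 * u) / g u ^+ 3 * primitive u +
   pos2 (g u - 0) / g u ^+ 2 * profile u) / u ^+ m.*2.
  rewrite /pos2 subr0 (max_idPr (ltW g0)) /profile.
  have U0 : u ^+ m.*2 != 0 by rewrite expf_neq0// gt_eqF.
  have u1' : 1 - u != 0 by rewrite gt_eqF// subr_gt0.
  move: (u ^+ m.*2) U0 => U U0.
  by field; rewrite U0 u1' gt_eqF.
apply: cvgM; last exact: cvg_cst.
apply: cvgD; apply: cvgM; try exact: cvg_cst.
  apply: cvgM; last exact: cvg_cst.
  apply: cvgM; last exact: cvg_cst.
  by apply: cvgM => //; apply: cvgM => //; exact: cvg_cst.
apply: cvgM; last exact: cvg_cst.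
exact: (cvg_comp _ _ cM (@exprn_continuous R 2 _)).
Unshelve. all: by end_near.
Qed.

End cutoff.

(** * Removal of the cutoff *)

Section radial_orthogonality.
Context {R : realType}.
Local Notation C := (R[i]%type).
Local Notation Re := (@complex.Re R).
Local Notation Im := (@complex.Im R).
Local Notation normc := (@ComplexField.Normc.normc R).
Local Notation mu := (@lebesgue_measure R).
Local Notation dA := (@lebesgue_measure R \x @lebesgue_measure R)%E.

Variables (w phi : R -> R) (c K : R) (m : nat).
Hypothesis w_cont : forall u, u < 1 -> {for u, continuous w}.
Hypothesis w_gt0 : forall u, u < 1 -> 0 < w u.
Hypothesis w_noninc : forall u v, 0 <= u -> u <= v -> v < 1 -> w v <= w u.
Hypothesis phi_cont : forall u, 0 < u < 1 -> {for u, continuous phi}.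
Hypothesis phi_bound : forall u, 0 < u < 1 -> `|u ^+ m * phi u| <= K.
Hypothesis mean0 : \int[mu]_(v in `]0, 1[) profile w phi c m v = 0.
Hypothesis m_gt0 : (0 < m)%N.

Local Notation Z := (cutZ w phi c m).
Local Notation Z' := (cutZ' w phi c m).

Lemma udisc2_normc2 (p : R * R) : udisc2 p -> 0 <= normc (cplx p) ^+ 2 < 1.
Proof.
rewrite /udisc2/= /udisc/= => p1; rewrite exprn_ge0 ?normc_ge0//=.
by rewrite expr_lt1 ?normc_ge0.
Qed.

(** Dominated convergence. Here [q] stands for the real or imaginary part of h conj(z)^(2m): it
    supplies the factor u^m required by [cutZ_dbar_bound], and a multiple of |h| w dominates. *)
Lemma cutoff_integral_limit (h : C -> C) (q : R * R -> R) :
  dA.-integrable udisc2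
    (fun p => (normc (h (cplx p)) * w (normc (cplx p) ^+ 2))%:E) ->
  measurable_fun udisc2 q ->
  (forall p, `|q p| <= normc (h (cplx p)) * normc (cplx p) ^+ m.*2) ->
  (forall e, 0 < e -> \int[dA]_(p in udisc2) (q p *
    (m.*2.+1%:R * Z e (normc (cplx p) ^+ 2) +
     normc (cplx p) ^+ 2 * Z' e (normc (cplx p) ^+ 2))) = 0) ->
  \int[dA]_(p in udisc2) (q p *
    ((phi (normc (cplx p) ^+ 2) - c) * w (normc (cplx p) ^+ 2))) = 0.
Proof.
move=> ihw mq qh int0.
pose e (n : nat) : R := n.+1%:R^-1.
have e0 n : 0 < e n by rewrite invr_gt0.
have ecv : e @ \oo --> 0 by exact: cvg_harmonic.
pose s n u := m.*2.+1%:R * Z (e n) u + u * Z' (e n) u.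
pose u (p : R * R) := normc (cplx p) ^+ 2.
pose F n (p : R * R) := q p * s n (u p).
pose f (p : R * R) := q p * ((phi (u p) - c) * w (u p)).
have [K2 K20 HK2] := cutZ_dbar_bound w_cont w_gt0 w_noninc phi_cont phi_bound mean0.
have cZ n : continuous (Z (e n)).
  move=> x; apply: differentiable_continuous; apply/derivable1_diffP.
  by case: (cutZ_derive c w_cont w_gt0 w_noninc phi_cont phi_bound x (e0 n)).
have cZ' n : continuous (Z' (e n)).
  exact: (cutZ'_cont w_cont w_gt0 w_noninc phi_cont phi_bound (e0 n)).
have mu2 : measurable_fun udisc2 u.
  have -> : u = fun p : R * R => p.1 ^+ 2 + p.2 ^+ 2.
    by apply/funext => p; rewrite /u normcE_Re_Im.
  by apply: measurable_funTS; exact: measurable_normc2.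
have mF n : measurable_fun udisc2 (F n).
  apply: measurable_funM => //.
  have ms : measurable_fun setT (s n).
    apply: measurable_funD; apply: measurable_funM => //.
      exact: continuous_measurable_fun.
    exact: continuous_measurable_fun.
  exact: (measurableT_comp ms mu2).
have Ff p : udisc2 p -> F n p @[n --> \oo] --> f p.
  move=> /[dup] pu /udisc2_normc2; rewrite -/(u p) => /andP[u0 u1].
  (* [cutZ_dbar_cvg] excludes the origin, where [q] vanishes because m > 0. *)
  have [up0|up0] := leP (u p) 0.
    have q0 : q p = 0.
      apply/eqP; rewrite -normr_le0; apply: le_trans (qh p) _.
      have /eqP : u p = 0 by apply/eqP; rewrite eq_le up0.
      rewrite expf_eq0/= => /eqP ->.
      by rewrite expr0n double_eq0 eqn0Ngt m_gt0 mulr0.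
    by rewrite /F /f q0 mul0r; under eq_cvg do rewrite mul0r; exact: cvg_cst.
  apply: cvgM; first exact: cvg_cst.
  by apply: cutZ_dbar_cvg => //; apply/andP.
have mf : measurable_fun udisc2 f.
  by apply: (measurable_fun_cvg mF) => p /Ff.
have dom p n : udisc2 p -> `|F n p| <= K2 * (normc (h (cplx p)) * w (u p)).
  move=> /[dup] pu /udisc2_normc2; rewrite -/(u p) => /andP[u0 u1].
  rewrite /F normrM; apply: le_trans (ler_wpM2r (normr_ge0 _) (qh p)) _.
  have -> : normc (cplx p) ^+ m.*2 = u p ^+ m by rewrite /u -exprM mul2n.
  have hw0 : 0 <= normc (h (cplx p)) * w (u p) by rewrite mulr_ge0 ?normc_ge0 ?ltW ?w_gt0.
  have [up0|up0] := leP (u p) 0.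
    have -> : u p = 0 by apply/eqP; rewrite eq_le up0.
    rewrite expr0n eqn0Ngt m_gt0/= mulr0 mul0r mulr_ge0// mulr_ge0 ?normc_ge0//.
    by rewrite ltW// w_gt0.
  rewrite -mulrA [leRHS]mulrCA ler_wpM2l ?normc_ge0//.
  have : `|u p ^+ m * s n (u p)| <= K2 * w (u p) by apply: HK2 => //; rewrite up0.
  by rewrite normrM (ger0_norm (exprn_ge0 m u0)).
have mU : (measurable : set (set (measurableTypeR R * measurableTypeR R))) udisc2.
  exact: measurable_udisc2.
have ig : dA.-integrable udisc2 (fun p => (K2 * (normc (h (cplx p)) * w (u p)))%:E).
  have := integrableZl mU K2 ihw.
  by apply: eq_integrable; [exact: mU|move=> p _; rewrite EFinM].
have [] := @dominated_convergence _ _ _ dA udisc2 mU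
  (fun n => EFin \o F n) (EFin \o f) _ _ _ _ ig.
- by move=> n; apply/measurable_EFinP; exact: mF.
- by apply/measurable_EFinP; exact: mf.
- apply: aeW => p pu; apply: cvg_EFin; first by near=> n.
  exact: Ff.
- by apply: aeW => p n pu; rewrite /= lee_fin; exact: dom.
move=> intf _ cvf.
have intF0 n : (\int[dA]_(p in udisc2) (EFin \o F n) p = 0)%E.
  have iF : dA.-integrable udisc2 (EFin \o F n).
    apply: le_integrable ig => //.
      by apply/measurable_EFinP; exact: mF.
    move=> p pu; rewrite /= lee_fin (ger0_norm (le_trans (normr_ge0 _) (dom p n pu))).
    exact: dom.
  by rewrite -[LHS]fineK ?(integrable_fin_num mU)// [X in X%:E]int0.
rewrite /Rintegral.
suff -> : (\int[dA]_(p in udisc2) (f p)%:E = 0)%E by [].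
apply: cvg_unique cvf _ => //.
rewrite [X in X @ _](_ : _ = cst 0%E); first exact: cvg_cst.
by apply/funext => n; exact: intF0.
Unshelve. all: by end_near.
Qed.

Lemma radial_orth (h : C -> C) : holomorphic_on_disc h -> cmeasurable h ->
  dA.-integrable udisc2
    (fun p => (normc (h (cplx p)) * w (normc (cplx p) ^+ 2))%:E) ->
  let F z := h z * conjc z ^+ m.*2 *
    ((phi (normc z ^+ 2) - c) * w (normc z ^+ 2))%:C%C in
  \int[dA]_(p in udisc2) Re (F (cplx p)) = 0 /\
  \int[dA]_(p in udisc2) Im (F (cplx p)) = 0.
Proof.
move=> hh mh ihw F.
pose q z := h z * conjc z ^+ m.*2.
have ReE z (x : R) : Re (z * x%:C%C) = Re z * x by case: z => a b; simpc.
have ImE z (x : R) : Im (z * x%:C%C) = Im z * x by case: z => a b; simpc.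
have [mq1 mq2] : cmeasurable q.
  apply: cmeasurableM => //; apply: cmeasurableX.
  by apply: (@cmeasurable_conjc _ id); exact: cmeasurable_id.
have nq p : normc (q (cplx p)) = normc (h (cplx p)) * normc (cplx p) ^+ m.*2.
  by rewrite /q ComplexField.Normc.normcM normcX normc_conjc.
have orth e : 0 < e ->
    \int[dA]_(w in udisc2) Re (h (cplx w) * radial_dbar m.*2 (Z e) (Z' e) (cplx w)) = 0 /\
    \int[dA]_(w in udisc2) Im (h (cplx w) * radial_dbar m.*2 (Z e) (Z' e) (cplx w)) = 0.
  move=> e0; pose e1 := Num.min e 1.
  have e10 : 0 < e1 by rewrite lt_min e0/=.
  have e1e : e1 <= e by rewrite ge_min lexx.
  have e11 : e1 <= 1 by rewrite ge_min lexx orbT.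
  apply: (@holomorphic_orth_radial_dbar _ h m.*2 (Z e) (Z' e) (1 - e1)) => //.
  - lra.
  - move=> u; exact: (cutZ_derive c w_cont w_gt0 w_noninc phi_cont phi_bound u e0).
  - exact: (cutZ'_cont w_cont w_gt0 w_noninc phi_cont phi_bound e0).
  - by move=> u ue; apply: cutZ_far; nra.
split.
- under eq_Rintegral do rewrite /F ReE.
  apply: (@cutoff_integral_limit h (fun p => Re (q (cplx p)))) => //.
    by move=> p; rewrite -nq Re_le_normc.
  move=> e /orth[+ _].
  by under eq_Rintegral do rewrite /radial_dbar mulrA ReE.
- under eq_Rintegral do rewrite /F ImE.
  apply: (@cutoff_integral_limit h (fun p => Im (q (cplx p)))) => //.
    by move=> p; rewrite -nq Im_le_normc.
  move=> e /orth[_].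
  by under eq_Rintegral do rewrite /radial_dbar mulrA ImE.
Qed.

End radial_orthogonality.

(** * Orthogonal projection *)

Section orthogonal_projection.
Context {R : realType}.
Local Notation C := (R[i]%type).
Local Notation Re := (@complex.Re R).
Local Notation Im := (@complex.Im R).
Local Notation normc := (@ComplexField.Normc.normc R).
Local Notation dA := (@lebesgue_measure R \x @lebesgue_measure R)%E.
Local Notation T2 := (measurableTypeR R * measurableTypeR R)%type.
Implicit Types (f g h : C -> C).

Lemma measurable_disc : measurable (@udisc2 R : set T2).
Proof. exact: measurable_udisc2. Qed.
Let mU := measurable_disc.

Lemma integrable_dominated (F G : T2 -> R) : measurable_fun udisc2 F ->
  (forall p, udisc2 p -> `|F p| <= G p) -> dA.-integrable udisc2 (EFin \o G) ->
  dA.-integrable udisc2 (EFin \o F).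
Proof.
move=> mF FG; apply: le_integrable => //; first exact/measurable_EFinP.
move=> p pu; rewrite /= lee_fin (ger0_norm (le_trans (normr_ge0 _) (FG p pu))).
exact: FG.
Qed.

Lemma measurable_normc f : cmeasurable f ->
  measurable_fun (udisc2 : set T2) (fun p => normc (f (cplx p))).
Proof.
move=> [m1 m2].
have -> : (fun p => normc (f (cplx p))) = Num.sqrt \o
    (fun p : T2 => Re (f (cplx p)) ^+ 2 + Im (f (cplx p)) ^+ 2).
  by apply/funext => p /=; case: (f _).
apply: measurableT_comp.
  by apply: continuous_measurable_fun; exact: sqrt_continuous.
by apply: measurable_funD; apply: measurable_funX.
Qed.

Variable mu : C -> R.
Hypothesis mmu : measurable_fun (udisc2 : set T2) (mu \o cplx).
Hypothesis mu_gt0 : forall p : T2, udisc2 p -> 0 < mu (cplx p).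

Let mu_ge0 (p : T2) (hp : udisc2 p) : 0 <= mu (cplx p) := ltW (mu_gt0 hp).

Definition energy p f : \bar R :=
  (\int[dA]_(w in udisc2) (normc (f (cplx w)) `^ p * mu (cplx w))%:E)%E.

Lemma energy_ge0 p f : (0 <= energy p f)%E.
Proof.
by apply: integral_ge0 => w wu; rewrite lee_fin mulr_ge0 ?powR_ge0 ?mu_ge0.
Qed.

Lemma wnormE p f : wnorm mu p f = (energy p f `^ p^-1)%E.
Proof. by []. Qed.

Lemma Lp_energy p f : 0 < p -> Lp mu p f <-> cmeasurable f /\ (energy p f < +oo)%E.
Proof.
move=> p0; rewrite /Lp/=; split=> -[mf fy]; split => //; move: fy; rewrite wnormE.
  by apply: lty_poweRy; rewrite invr_eq0 gt_eqF.
exact: poweR_lty.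
Qed.

Lemma energy2E f :
  energy 2 f = (\int[dA]_(w in udisc2) (normc (f (cplx w)) ^+ 2 * mu (cplx w))%:E)%E.
Proof.
apply: eq_integral => w _; congr (_ * _)%:E.
by rewrite powR_mulrn ?normc_ge0.
Qed.

Lemma L2_integrable f : Lp mu 2 f ->
  dA.-integrable udisc2 (EFin \o (fun w => normc (f (cplx w)) ^+ 2 * mu (cplx w))).
Proof.
move=> /Lp_energy[|mf]//; rewrite energy2E => fy; apply/integrableP; split.
  apply/measurable_EFinP; apply: measurable_funM; last exact: mmu.
  by apply: measurable_funX; exact: measurable_normc.
apply: le_lt_trans fy; rewrite le_eqVlt; apply/orP; left; apply/eqP.
apply: eq_integral => w; rewrite inE => wu /=.
by rewrite ger0_norm// mulr_ge0 ?sqr_ge0// mu_ge0.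
Qed.

Lemma mul_real_ReIm (z : C) (x : R) : Re (z * x%:C%C) = Re z * x /\ Im (z * x%:C%C) = Im z * x.
Proof. by case: z => a b; simpc. Qed.

Lemma cmeasurable_inner f g : cmeasurable f -> cmeasurable g ->
  cmeasurable (fun z => f z * (g z)^* * (mu z)%:C%C).
Proof.
move=> mf mg; apply: cmeasurableM.
  apply: cmeasurableM => //.
  rewrite (_ : (fun z => (g z)^*) = conjc \o g); first exact: cmeasurable_conjc.
  by apply/funext => z; rewrite conjCE.
have -> : (fun z => (mu z)%:C%C) = fun z => ((mu \o cplx) (Re z, Im z))%:C%C.
  by apply/funext => -[].
exact: cmeasurable_real.
Qed.

Lemma normc_mul_conj_le (x y : C) : normc (x * y^*) <= normc x ^+ 2 + normc y ^+ 2.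
Proof.
rewrite ComplexField.Normc.normcM conjCE normc_conjc.
have := normc_ge0 x; have := normc_ge0 y; have := sqr_ge0 (normc x - normc y); nra.
Qed.

Lemma inner_integrable f g : Lp mu 2 f -> Lp mu 2 g ->
  dA.-integrable udisc2 (EFin \o (fun w =>
    Re (f (cplx w) * (g (cplx w))^* * (mu (cplx w))%:C%C))).
Proof.
move=> Lf Lg; have [mfg _] := cmeasurable_inner Lf.1 Lg.1.
apply: (@integrable_dominated _ (fun w => normc (f (cplx w)) ^+ 2 * mu (cplx w) +
    normc (g (cplx w)) ^+ 2 * mu (cplx w))) => //.
  move=> p pu; rewrite (mul_real_ReIm _ _).1 normrM (gtr0_norm (mu_gt0 pu)) -mulrDl.
  apply: ler_wpM2r; first exact: mu_ge0.
  exact: le_trans (Re_le_normc _) (normc_mul_conj_le _ _).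
by have := integrableD mU (L2_integrable Lf) (L2_integrable Lg).
Qed.

(** Integrate Re((f - g) conj(g)) <= (|f|^2 - |g|^2) / 2; the left side has integral 0, by
    orthogonality tested on g itself. *)
Lemma orth_proj_contraction f g : Lp mu 2 f -> orth_proj_L2a mu f g ->
  (energy 2 g <= energy 2 f)%E.
Proof.
move=> Lf [[Lg hg] /(_ g (conj Lg hg))].
rewrite /inner /cintegral => /(congr1 Re)/= H0.
have If := L2_integrable Lf; have Ig := L2_integrable Lg.
pose F w := normc (f (cplx w)) ^+ 2 * mu (cplx w).
pose G w := normc (g (cplx w)) ^+ 2 * mu (cplx w).
pose H w := Re ((f \- g) (cplx w) * (g (cplx w))^* * (mu (cplx w))%:C%C).
have IH : dA.-integrable udisc2 (EFin \o H).
  rewrite (_ : EFin \o H = fun w => (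
    ((Re (f (cplx w) * (g (cplx w))^* * (mu (cplx w))%:C%C))%:E) -
    (Re (g (cplx w) * (g (cplx w))^* * (mu (cplx w))%:C%C))%:E)%E).
    exact: (integrableB mU (inner_integrable Lf Lg) (inner_integrable Lg Lg)).
  by apply/funext => w; rewrite /H /= !mulrBl raddfB.
have IFG : dA.-integrable udisc2 (EFin \o (fun w => 2^-1 * (F w - G w))).
  have := integrableZl mU 2^-1 (integrableB mU If Ig).
  by apply: eq_integrable; [exact: mU|move=> w _; rewrite /= -EFinB -EFinM].
have : \int[dA]_(w in udisc2) H w <= \int[dA]_(w in udisc2) (2^-1 * (F w - G w)).
  apply: le_Rintegral => // w wu; rewrite /H /F /G (mul_real_ReIm _ _).1 -mulrBl mulrA.
  apply: ler_wpM2r; first exact: mu_ge0.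
  rewrite !normcE_Re_Im conjCE /=.
  case: (f _) => a b; case: (g _) => x y; simpc => /=.
  have := sqr_ge0 (a - x); have := sqr_ge0 (b - y); nra.
have IFG' : dA.-integrable udisc2 (EFin \o (fun w => F w - G w)).
  by have := integrableB mU If Ig; apply: eq_integrable => // w _; rewrite /= -EFinB.
rewrite H0 (RintegralZl _ mU IFG') (RintegralB mU If Ig).
have half_gt0 : 0 < 2^-1 :> R by rewrite invr_gt0.
rewrite (pmulr_rge0 _ half_gt0) subr_ge0 -lee_fin /Rintegral.
rewrite (fineK (integrable_fin_num mU If)) (fineK (integrable_fin_num mU Ig)).
by rewrite !energy2E.
Qed.

Lemma bergman_bounded2 : bergman_bounded mu 2.
Proof.
exists 1 => // f Lf _; rewrite mul1e /bergman_projection.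
have le_wnorm g : (energy 2 g <= energy 2 f)%E -> (wnorm mu 2 g <= wnorm mu 2 f)%E.
  move=> gf; rewrite !wnormE; apply: gt0_ler_poweR => //;
    by rewrite in_itv/= energy_ge0 leey.
(* If the set of projections is empty, [xget] returns 0, whose energy is 0. *)
case: xgetP => [g _ /(orth_proj_contraction Lf)/le_wnorm//|_].
apply: le_wnorm; rewrite {1}/energy integral0_eq ?energy_ge0// => w wu.
by rewrite -[normc _]/(normc 0%C) ComplexField.Normc.normc0 powR0 ?mul0r.
Qed.

(** The four inner products of f - g1 and f - g2 with g1 and g2 vanish, and they combine into the
    squared L^2 distance of g1 and g2. The weight being positive, g1 = g2 almost everywhere, which
    settles every exponent p at once. *)
Lemma orth_proj_unique f g1 g2 p : Lp mu 2 f -> orth_proj_L2a mu f g1 ->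
  orth_proj_L2a mu f g2 -> wnorm mu p g1 = wnorm mu p g2.
Proof.
move=> Lf [L1 o1] [L2 o2].
have h11 := congr1 Re (o1 _ L1); have h12 := congr1 Re (o1 _ L2).
have h21 := congr1 Re (o2 _ L1); have h22 := congr1 Re (o2 _ L2).
pose H g h w := Re ((f \- g) (cplx w) * (h (cplx w))^* * (mu (cplx w))%:C%C).
have IH g h : Lp mu 2 g -> Lp mu 2 h -> dA.-integrable udisc2 (EFin \o H g h).
  move=> Lg Lh.
  rewrite (_ : EFin \o H g h = fun w => (
    ((Re (f (cplx w) * (h (cplx w))^* * (mu (cplx w))%:C%C))%:E) -
    (Re (g (cplx w) * (h (cplx w))^* * (mu (cplx w))%:C%C))%:E)%E).
    exact: (integrableB mU (inner_integrable Lf Lh) (inner_integrable Lg Lh)).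
  by apply/funext => w; rewrite /H /= !mulrBl raddfB.
have Hsum w : H g1 g2 w - H g1 g1 w + (H g2 g1 w - H g2 g2 w) =
    normc (g1 (cplx w) - g2 (cplx w)) ^+ 2 * mu (cplx w).
  rewrite /H !(mul_real_ReIm _ _).1 -!mulrBl -mulrDl; congr (_ * _).
  rewrite normcE_Re_Im !conjCE /=.
  case: (f _) => a b; case: (g1 _) => x y; case: (g2 _) => x' y'; simpc => /=.
  ring.
have I12 := IH _ _ L1.1 L2.1; have I11 := IH _ _ L1.1 L1.1.
have I21 := IH _ _ L2.1 L1.1; have I22 := IH _ _ L2.1 L2.1.
have IB (F G : T2 -> R) : dA.-integrable udisc2 (EFin \o F) ->
    dA.-integrable udisc2 (EFin \o G) ->
    dA.-integrable udisc2 (EFin \o (fun w => F w - G w)).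
  by move=> iF iG; have := integrableB mU iF iG; apply: eq_integrable.
have Idiff : dA.-integrable udisc2 (EFin \o (fun w =>
    normc (g1 (cplx w) - g2 (cplx w)) ^+ 2 * mu (cplx w))).
  have := integrableD mU (IB _ _ I12 I11) (IB _ _ I21 I22).
  by apply: eq_integrable; [exact: mU|move=> w _; rewrite /= -EFinD Hsum].
have D0 : \int[dA]_(w in udisc2) (normc (g1 (cplx w) - g2 (cplx w)) ^+ 2 * mu (cplx w)) = 0.
  under eq_Rintegral do rewrite -Hsum.
  rewrite RintegralD; [|exact: mU|exact: IB|exact: IB].
  rewrite !RintegralB//.
  rewrite [X in X - _]h12 [X in _ - X + _]h11 [X in _ + (X - _)]h21 [X in _ + (_ - X)]h22.
  by rewrite subrr addr0.
have E0 : (\int[dA]_(w in udisc2)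
    `|(normc (g1 (cplx w) - g2 (cplx w)) ^+ 2 * mu (cplx w))%:E| = 0)%E.
  rewrite -[RHS]/((0 : R)%:E) -D0 fineK; last exact: integrable_fin_num.
  apply: eq_integral => w; rewrite inE => wu /=.
  by rewrite ger0_norm// mulr_ge0 ?sqr_ge0// mu_ge0.
have mdiff := measurable_int _ Idiff.
have := (ae_eq_integral_abs dA mU mdiff).1 E0.
move=> ae0; suff E : energy p g1 = energy p g2 by rewrite /wnorm -/(energy p g1) E.
have mE g : cmeasurable g ->
    measurable_fun udisc2 (fun w : T2 => (normc (g (cplx w)) `^ p * mu (cplx w))%:E).
  move=> mg; apply/measurable_EFinP; apply: measurable_funM; last exact: mmu.
  apply: (measurableT_comp (f := @powR R ^~ p)); first exact: measurable_powR.
  exact: measurable_normc.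
apply: (ae_eq_integral _ _ mU (mE _ L1.1.1) (mE _ L2.1.1)).
apply: filterS ae0 => w /= + wu => /(_ wu) [].
move=> /eqP; rewrite mulf_eq0 (gt_eqF (mu_gt0 wu)) orbF expf_eq0/= => /eqP.
by move=> /ComplexField.Normc.eq0_normc/eqP; rewrite subr_eq0 => /eqP ->.
Qed.

Lemma wnorm_bergman f g p : Lp mu 2 f -> orth_proj_L2a mu f g ->
  wnorm mu p (bergman_projection mu f) = wnorm mu p g.
Proof.
move=> Lf og; apply: (orth_proj_unique p Lf _ og).
exact: (xgetI (fun=> 0) og).
Qed.

End orthogonal_projection.

(** * Test functions and moments *)

Section test_functions.
Context {R : realType}.
Local Notation C := (R[i]%type).
Local Notation Re := (@complex.Re R).
Local Notation Im := (@complex.Im R).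
Local Notation normc := (@ComplexField.Normc.normc R).
Local Notation mu1 := (@lebesgue_measure R).
Local Notation dA := (@lebesgue_measure R \x @lebesgue_measure R)%E.
Local Notation T2 := (measurableTypeR R * measurableTypeR R)%type.
Local Notation u p := (normc (cplx p) ^+ 2).

Lemma powR_le1 (s v : R) : 0 <= s -> 0 <= v <= 1 -> v `^ s <= 1.
Proof.
move=> s0 /andP[v0 v1]; have : v `^ s <= 1 `^ s by apply: ge0_ler_powR; rewrite ?nnegrE.
by rewrite powR1.
Qed.

Lemma powR_root_le (K a b p : R) : 0 < p -> 0 <= K -> 0 <= a -> 0 <= b ->
  a `^ p^-1 <= K * b `^ p^-1 -> a <= K `^ p * b.
Proof.
move=> p0 K0 a0 b0 H.
have root (x : R) : 0 <= x -> (x `^ p^-1) `^ p = x.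
  by move=> x0; rewrite -powRrM mulVf ?gt_eqF// powRr1.
have := ge0_ler_powR (ltW p0) _ _ H.
rewrite !nnegrE powR_ge0 mulr_ge0 ?powR_ge0// => /(_ isT isT).
by rewrite powRM ?powR_ge0// !root.
Qed.

Lemma dA_udisc2 : (dA udisc2 <= 4%:E)%E.
Proof.
pose I11 : set R := `]-1, 1]%classic.
have : (dA udisc2 <= dA (I11 `*` I11))%E.
  apply: le_measure; rewrite ?inE.
  - exact: measurable_disc.
  - by apply: measurableX; exact: measurable_itv.
  - move=> [x y]; rewrite udisc2E/= => xy1; split; rewrite /I11 /= in_itv/=; apply/andP; split; nra.
have N11 : (-1 : R) <= 1 by lra.
move=> /le_trans; apply; rewrite rectangle_measure// lee_fin; lra.
Qed.

Lemma bounded_integrable_disc (F : T2 -> R) (M : R) : measurable_fun udisc2 F ->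
  (forall p, udisc2 p -> `|F p| <= M) -> dA.-integrable udisc2 (EFin \o F).
Proof.
move=> mF FM; apply: measurable_bounded_integrable => //.
- exact: measurable_disc.
- by apply: (le_lt_trans dA_udisc2); exact: ltry.
- exists M; split; first exact: num_real.
  by move=> x Mx p pu; apply: le_trans (FM p pu) (ltW Mx).
Qed.

Variables (w : R -> R) (mu : C -> R).
Hypothesis w_meas : measurable_fun setT w.
Hypothesis w_cont : forall v, v < 1 -> {for v, continuous w}.
Hypothesis w_gt0 : forall v, v < 1 -> 0 < w v.
Hypothesis w_noninc : forall v v', 0 <= v -> v <= v' -> v' < 1 -> w v' <= w v.
Hypothesis muE : forall z, udisc z -> mu z = w (normc z ^+ 2).

Lemma mu_gt0 (p : T2) : udisc2 p -> 0 < mu (cplx p).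
Proof. by move=> pu; rewrite muE//; apply: w_gt0; case/andP: (udisc2_normc2 pu). Qed.

Lemma measurable_u : measurable_fun setT (fun p : T2 => u p).
Proof.
have -> : (fun p : T2 => u p) = fun p => p.1 ^+ 2 + p.2 ^+ 2.
  by apply/funext => p; rewrite normcE_Re_Im.
exact: measurable_normc2.
Qed.

Lemma measurable_mu : measurable_fun (udisc2 : set T2) (mu \o cplx).
Proof.
apply: (eq_measurable_fun (fun p : T2 => w (u p))).
  by move=> p; rewrite inE => pu /=; rewrite muE.
apply: measurable_funTS; exact: (measurableT_comp w_meas measurable_u).
Qed.

(** In polar coordinates [moment2] is pi times [moment1]. Both are kept and estimated separately:
    the coefficient c is a ratio of integrals over ]0, 1[, while the norms are integrals over the
    disc. *)
Definition moment1 (s : R) : R := \int[mu1]_(v in `]0, 1[) (v `^ s * w v).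
Definition moment2 (s : R) : R := \int[dA]_(p in udisc2) (u p `^ s * w (u p)).

Lemma w_le_w0 v : 0 <= v < 1 -> w v <= w 0.
Proof. by move=> /andP[v0 v1]; apply: w_noninc. Qed.

Lemma moment_integrand_le (s v : R) : 0 <= s -> 0 <= v < 1 -> 0 <= v `^ s * w v <= w 0.
Proof.
move=> s0 /andP[v0 v1]; rewrite mulr_ge0 ?powR_ge0 ?(ltW (w_gt0 v1))//=.
have wv : w v <= w 0 by apply: w_le_w0; rewrite v0.
apply: le_trans wv; rewrite ler_piMl ?(ltW (w_gt0 v1))//.
by rewrite powR_le1// v0 ltW.
Qed.

Lemma moment1_integrable s : 0 <= s ->
  mu1.-integrable `]0, 1[ (EFin \o (fun v => v `^ s * w v)).
Proof.
move=> s0; apply: measurable_bounded_integrable => //.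
- by rewrite /= lebesgue_measure_itv/= lte_fin ltr01 oppr0 adde0 ltry.
- apply: measurable_funTS; apply: (@measurable_funM _ _ _ setT (@powR R ^~ s) w) => //.
- exists (w 0); split; first exact: num_real.
  move=> x wx v /=; rewrite in_itv/= => /andP[v0 v1].
  have /andP[h1 h2] := @moment_integrand_le s v s0 (introT andP (conj (ltW v0) v1)).
  by rewrite ger0_norm//; apply: le_trans (ltW wx).
Qed.

Lemma moment2_integrable s : 0 <= s ->
  dA.-integrable udisc2 (EFin \o (fun p : T2 => u p `^ s * w (u p))).
Proof.
move=> s0; apply: (@bounded_integrable_disc _ (w 0)).
- apply: measurable_funTS; apply: measurable_funM.
    exact: (measurableT_comp (@measurable_powR R s) measurable_u).
  exact: (measurableT_comp w_meas measurable_u).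
- move=> p /udisc2_normc2/(moment_integrand_le s0)/andP[h1 h2].
  by rewrite ger0_norm.
Qed.

Lemma moment2_energy s p f : 0 <= s ->
  (forall z, udisc z -> normc (f z) `^ p = (normc z ^+ 2) `^ s) ->
  energy mu p f = (moment2 s)%:E.
Proof.
move=> s0 fs; rewrite /moment2 /Rintegral fineK.
  apply: eq_integral => w'; rewrite inE => wu.
  by rewrite fs// muE.
exact: (integrable_fin_num measurable_disc (moment2_integrable s0)).
Qed.

Variables (p q : R).
Hypotheses (p1 : 1 < p) (pq : q * (p - 1) = p).

Let q1 : 1 < q.
Proof.
have h1 := p1; have p10 : 0 < p - 1 by lra.
rewrite -(ltr_pM2r p10) pq; lra.
Qed.

(** The quotient is the coefficient c of the projection, [moment2 (m%:R * p)] is the L^p energy of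
    z^(2m), and [moment2 (m%:R * q)] is that of the test function, because (q - 1) p = q. *)
Lemma moment_inequality : bergman_bounded mu p -> exists2 K, 0 < K &
  forall m : nat, (0 < m)%N ->
  (moment1 (m%:R * q) / moment1 (m%:R * 2)) `^ p * moment2 (m%:R * p) <=
    K * moment2 (m%:R * q).
Proof.
move=> [K K0 HK]; exists (K `^ p) => [|m m0]; first by rewrite powR_gt0.
have mR0 : 0 < m%:R :> R by rewrite ltr0n.
have p0 : 0 < p by exact: lt_trans p1.
have q0 : 0 < q by exact: lt_trans q1.
have qp := pq.
have M1pos s : 0 <= moment1 s.
  by apply: Rintegral_ge0 => v /=; rewrite in_itv/= => /andP[_ v1];
    rewrite mulr_ge0 ?powR_ge0 ?(ltW (w_gt0 v1)).
have M2pos s : 0 <= moment2 s.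
  apply: Rintegral_ge0 => v /udisc2_normc2/andP[_ v1].
  by rewrite mulr_ge0 ?powR_ge0 ?(ltW (w_gt0 v1)).
(* For a zero denominator the quotient is 0 by convention and the claim is trivial. *)
have [M10|M10] := eqVneq (moment1 (m%:R * 2)) 0.
  by rewrite M10 invr0 mulr0 powR0 ?gt_eqF// mul0r mulr_ge0 ?powR_ge0.
pose c := moment1 (m%:R * q) / moment1 (m%:R * 2).
have c0 : 0 <= c by rewrite divr_ge0.
pose phi (v : R) := v `^ (m%:R * (q - 2)).
pose f (z : C) := z ^+ m.*2 * (phi (normc z ^+ 2))%:C%C.
pose g (z : C) := c%:C%C * z ^+ m.*2.
have vm (v : R) (k : nat) : 0 < v -> v ^+ k = v `^ k%:R by move=> v0; rewrite powR_mulrn// ltW.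
have vmphi v : 0 < v -> v ^+ m * phi v = v `^ (m%:R * (q - 1)).
  move=> v0; rewrite vm// /phi -powRD; last by apply/implyP => _; rewrite gt_eqF.
  by congr (_ `^ _); ring.
have vmphi2 v : 0 < v -> v ^+ m.*2 * phi v = v `^ (m%:R * q).
  move=> v0; rewrite vm// /phi -powRD; last by apply/implyP => _; rewrite gt_eqF.
  by congr (_ `^ _); rewrite -mul2n natrM; ring.
have phic v : 0 < v < 1 -> {for v, continuous phi}.
  move=> /andP[v0 _]; apply: differentiable_continuous; apply/derivable1_diffP.
  by case: (is_derive1_powR (m%:R * (q - 2)) v0).
have phib v : 0 < v < 1 -> `|v ^+ m * phi v| <= 1.
  move=> /andP[v0 v1]; rewrite vmphi// ger0_norm ?powR_ge0//.
  by rewrite powR_le1 ?(ltW v0) ?(ltW v1)// mulr_ge0 ?(ltW mR0)// subr_ge0 ltW.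
have mean0 : \int[mu1]_(v in `]0, 1[) profile w phi c m v = 0.
  rewrite (_ : \int[mu1]_(v in `]0, 1[) profile w phi c m v =
    \int[mu1]_(v in `]0, 1[) (v `^ (m%:R * q) * w v - c * (v `^ (m%:R * 2) * w v))); last first.
    apply: eq_Rintegral => v; rewrite inE/= in_itv/= => /andP[v0 _].
    rewrite /profile mulrBr vmphi2// vm// -mul2n natrM mulrBl.
    by rewrite [2 * m%:R]mulrC; ring.
  have i1 := @moment1_integrable (m%:R * q) (mulr_ge0 (ltW mR0) (ltW q0)).
  have i2 := @moment1_integrable (m%:R * 2) (mulr_ge0 (ltW mR0) (ltW (ltr0Sn _ 1))).
  rewrite RintegralB//; last first.
    have mI : (measurable : set (set (measurableTypeR R))) `]0, 1[%classic.
      exact: measurable_itv.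
    by have := integrableZl mI c i2.
  rewrite RintegralZl// -/(moment1 _) -/(moment1 _) /c divfK// subrr//.
have u0_ge z : 0 <= normc z ^+ 2 by rewrite exprn_ge0 ?normc_ge0.
have zN z : normc (z ^+ m.*2) = (normc z ^+ 2) `^ m%:R.
  by rewrite normcX powR_mulrn// -exprM mul2n.
have nf z : normc (f z) = (normc z ^+ 2) `^ (m%:R * (q - 1)).
  rewrite /f ComplexField.Normc.normcM normc_real normcX ger0_norm ?powR_ge0//.
  have := u0_ge z; rewrite le_eqVlt => /predU1P[/esym z0|z0].
    rewrite z0 powR0; last by rewrite mulf_neq0// gt_eqF// subr_gt0.
    by move/eqP : z0; rewrite expf_eq0/= => /eqP ->; rewrite expr0n double_eq0 eqn0Ngt m0 mul0r.
  by rewrite -vmphi// -exprM mul2n.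
have ng z : normc (g z) = c * (normc z ^+ 2) `^ m%:R.
  by rewrite /g ComplexField.Normc.normcM normc_real ger0_norm// zN.
have energy_f s : 0 < s -> energy mu s f = (moment2 (m%:R * (q - 1) * s))%:E.
  move=> s0; apply: moment2_energy => [|z _]; last by rewrite nf -powRrM.
  by rewrite !mulr_ge0 ?ltW// subr_gt0.
have energy_g s : 0 < s -> energy mu s g = (c `^ s * moment2 (m%:R * s))%:E.
  move=> s0; have ms0 : 0 <= m%:R * s by rewrite mulr_ge0// ltW.
  rewrite /moment2 -RintegralZl; [|exact: measurable_disc|exact: moment2_integrable].
  rewrite /Rintegral fineK; last first.
    apply: (integrable_fin_num measurable_disc).
    by have := integrableZl measurable_disc (c `^ s) (moment2_integrable ms0).
  apply: eq_integral => x; rewrite inE => xu.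
  by rewrite ng muE// powRM ?powR_ge0// -powRrM mulrA.
have mX : cmeasurable (fun z : C => z ^+ m.*2).
  by apply: cmeasurableX; exact: cmeasurable_id.
have mf : cmeasurable f.
  apply: cmeasurableM => //; apply: cmeasurable_radial.
  exact: (@measurable_powR R (m%:R * (q - 2))).
have mg : cmeasurable g.
  by apply: cmeasurableM => //; exact: cmeasurable_cst.
have Lf s : 0 < s -> Lp mu s f.
  by move=> s0; apply/Lp_energy => //; split => //; rewrite energy_f// ltry.
have Lg : Lp mu 2 g by apply/Lp_energy => //; split => //; rewrite energy_g// ltry.
have og : orth_proj_L2a mu f g.
  split; first by split; [|apply: holomorphic_cstM; exact: holomorphicX].
  move=> h [Lh hh].
  have ihw : dA.-integrable udisc2
      (fun x => (normc (h (cplx x)) * w (u x))%:E).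
    (* By |h| <= 1 + |h|^2 and w <= w(0), square integrability of h suffices. *)
    apply: (@integrable_dominated _ (fun x => normc (h (cplx x)) * w (u x))
      (fun x => w 0 + normc (h (cplx x)) ^+ 2 * mu (cplx x))).
    - apply: measurable_funM; first exact: measurable_normc Lh.1.
      by apply: measurable_funTS; exact: (measurableT_comp w_meas measurable_u).
    - move=> x xu; have xu' := udisc2_normc2 xu; have /andP[x0 x1] := xu'.
      have wx := w_gt0 x1; have w0 := w_le_w0 xu'; have h0 := normc_ge0 (h (cplx x)).
      rewrite muE// ger0_norm ?mulr_ge0 ?(ltW wx)//.
      have : 0 <= (normc (h (cplx x)) - 2^-1) ^+ 2 * w (u x).
        by rewrite mulr_ge0 ?sqr_ge0// ltW.
      have : 0 <= normc (h (cplx x)) ^+ 2 * w (u x) by rewrite mulr_ge0 ?sqr_ge0// ltW.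
      have : normc (h (cplx x)) * w (u x) <= (1 + normc (h (cplx x)) ^+ 2) * w (u x).
        rewrite ler_wpM2r ?(ltW wx)//.
        by have := sqr_ge0 (normc (h (cplx x)) - 1); nra.
      lra.
    - have i1 := @bounded_integrable_disc (fun=> w 0) `|w 0| (measurable_cst _) (fun _ _ => lexx _).
      by have := integrableD measurable_disc i1 (L2_integrable measurable_mu mu_gt0 Lh).
  (* The inner product has the conjugate of [F] below as integrand, whose imaginary part is -Im F;
     applying the orthogonality to -h supplies this sign. *)
  pose hN (z : C) := -1 * h z.
  have nhN z : normc (hN z) = normc (h z).
    by rewrite /hN mulN1r normcN.
  have [oR _] := radial_orth w_cont w_gt0 w_noninc phic phib mean0 m0 hh Lh.1 ihw.
  have hhN : holomorphic_on_disc hN.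
    exact: holomorphic_cstM.
  have mhN : cmeasurable hN by apply: cmeasurableM; [exact: cmeasurable_cst|exact: Lh.1].
  have ihwN : dA.-integrable udisc2 (fun x => (normc (hN (cplx x)) * w (u x))%:E).
    apply: eq_integrable ihw; first exact: measurable_disc.
    by move=> x _; rewrite nhN.
  have [_ oI] := radial_orth w_cont w_gt0 w_noninc phic phib mean0 m0 hhN mhN ihwN.
  pose F z := h z * conjc z ^+ m.*2 * ((phi (normc z ^+ 2) - c) * w (normc z ^+ 2))%:C%C.
  have E (x : T2) : x \in udisc2 ->
      (f \- g) (cplx x) * (h (cplx x))^* * (mu (cplx x))%:C%C = conjc (F (cplx x)).
    rewrite inE => xu; rewrite muE// conjCE /F.
    have cM (a b : C) : conjc (a * b) = conjc a * conjc b by exact: rmorphM.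
    have cX (a : C) n : conjc (a ^+ n) = conjc a ^+ n by exact: rmorphXn.
    rewrite !cM cX conjcK conjc_real rmorphM rmorphB /= /f /g; ring.
  rewrite /inner /cintegral.
  have ReJ (z : C) : Re (conjc z) = Re z by case: z.
  have ImJ (z : C) : Im (conjc z) = - Im z by case: z.
  pose G x := (f \- g) (cplx x) * (h (cplx x))^* * (mu (cplx x))%:C%C.
  have E1 : \int[dA]_(x in udisc2) Re (G x) = 0.
    by rewrite -[RHS]oR; apply: eq_Rintegral => x /E; rewrite /G => ->; rewrite ReJ.
  have E2 : \int[dA]_(x in udisc2) Im (G x) = 0.
    rewrite -[RHS]oI; apply: eq_Rintegral => x /E; rewrite /G => ->.
    by rewrite ImJ /F /hN !mulN1r !mulNr raddfN.
  rewrite -[LHS]/((\int[dA]_(x in udisc2) Re (G x)) +i* (\int[dA]_(x in udisc2) Im (G x)))%C.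
  by rewrite E1 E2.
have := HK f (Lf _ (ltr0Sn _ 1)) (Lf _ p0).
rewrite (wnorm_bergman measurable_mu mu_gt0 _ (Lf _ (ltr0Sn _ 1)) og) !wnormE.
rewrite (energy_g _ p0) (energy_f _ p0) !poweR_EFin -EFinM lee_fin.
have -> : m%:R * (q - 1) * p = m%:R * q by rewrite -mulrA; congr (_ * _); lra.
apply: powR_root_le => //; [exact: ltW|].
by rewrite mulr_ge0 ?powR_ge0.
Qed.

End test_functions.

(** * Asymptotics of the moments *)

Section moment_asymptotics.
Context {R : realType}.
Local Notation mu1 := (@lebesgue_measure R).
Local Notation dA := (@lebesgue_measure R \x @lebesgue_measure R)%E.
Local Notation T2 := (measurableTypeR R * measurableTypeR R)%type.
Local Notation normc := (@ComplexField.Normc.normc R).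
Local Notation u p := (normc (cplx p) ^+ 2).
Implicit Types (s t v x y e : R).

(** The tangent at 1 lies strictly above. With m = 1 + b (t - 1), apply ln x <= x - 1 at t / m and 1
    / m with weights b and 1 - b: the right-hand sides add up to 0, and the second inequality is
    strict. *)
Lemma powR_strict_concave (b t : R) : 0 < b < 1 -> 0 < t -> t != 1 ->
  t `^ b < 1 + b * (t - 1).
Proof.
move=> /andP[b0 b1] t0 t1.
pose m := 1 + b * (t - 1).
have m0 : 0 < m by rewrite /m; nra.
have m1 : m != 1.
  apply: contra t1 => /eqP; rewrite /m => h; apply/eqP.
  have : b * (t - 1) = 0 by lra.
  by move/eqP; rewrite mulf_eq0 (gt_eqF b0) subr_eq0 => /eqP.
have lnle x : 0 < x -> ln x <= x - 1.
  by move=> x0; have := expR_ge1Dx (ln x); rewrite lnK ?posrE//; lra.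
have lnlt x : 0 < x -> x != 1 -> ln x < x - 1.
  move=> x0 x1; have : ln x != 0 by rewrite ln_eq0.
  by move=> /expR_gt1Dx; rewrite lnK ?posrE//; lra.
have -> : t `^ b = expR (b * ln t) by rewrite /powR gt_eqF.
rewrite -[ltRHS]lnK ?posrE// ltr_expR.
have h1 := lnle (t / m) (divr_gt0 t0 m0).
have h2 : ln m^-1 < m^-1 - 1 by apply: lnlt; rewrite ?invr_gt0// invr_eq1.
rewrite ln_div ?posrE// in h1; rewrite lnV ?posrE// in h2.
have e1 : b * (t / m - 1) + (1 - b) * (m^-1 - 1) = 0.
  have -> : b * (t / m - 1) + (1 - b) * (m^-1 - 1) = (1 + b * (t - 1)) / m - 1.
    by field; rewrite gt_eqF.
  by rewrite -/m divff ?gt_eqF// subrr.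
have h3 : b * (ln t - ln m) <= b * (t / m - 1) by rewrite ler_pM2l.
have h4 : (1 - b) * - ln m < (1 - b) * (m^-1 - 1) by rewrite ltr_pM2l// subr_gt0.
rewrite -/m; lra.
Qed.

(** Use the tangent of x^b at 2, at p with weight 1 and at q with weight p - 1: the linear terms
    cancel because q (p - 1) = p. This quantity is the growth coefficient that [moment_inequality]
    produces. *)
Lemma conjugate_exponent_gap (b p q : R) : 0 < b < 1 -> 1 < p -> p != 2 ->
  q * (p - 1) = p -> 0 < p * 2 `^ b - p * q `^ b - p `^ b + q `^ b.
Proof.
move=> b01 p1 p2 pq.
have q0 : 0 < q by nra.
have h (t : R) : 0 < t -> t != 2 -> t `^ b < 2 `^ b * (1 + b * (t / 2 - 1)).
  move=> t0 t2; rewrite {1}(_ : t = 2 * (t / 2)); last by field.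
  rewrite powRM ?divr_ge0 ?(ltW t0)// ltr_pM2l ?powR_gt0//.
  apply: powR_strict_concave => //; first by rewrite divr_gt0.
  by apply: contra t2 => /eqP e; apply/eqP; lra.
have q2 : q != 2 by apply: contra p2 => /eqP e; apply/eqP; move: pq; rewrite e; lra.
have h1 := h p (lt_trans ltr01 p1) p2.
have h2 : (p - 1) * q `^ b < (p - 1) * (2 `^ b * (1 + b * (q / 2 - 1))).
  by rewrite ltr_pM2l ?subr_gt0//; exact: h.
have E : (p - 1) * (2 `^ b * (1 + b * (q / 2 - 1))) + 2 `^ b * (1 + b * (p / 2 - 1)) =
   p * 2 `^ b + 2 `^ b * b / 2 * (q * (p - 1) - p) by field.
rewrite pq subrr mulr0 addr0 in E.
lra.
Qed.

Lemma powR_le_expR (K r e : R) : 0 < e -> exists2 T, 0 < T &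
  forall t, T <= t -> K * t `^ r <= expR (e * t).
Proof.
move=> e0; pose n := Num.bound `|r|.
have rn : r <= n%:R.
  by apply: le_trans (ler_norm _) (ltW _); exact: archi_boundP.
pose c := e ^+ n.+1 / n.+1`!%:R.
have c0 : 0 < c by rewrite divr_gt0 ?exprn_gt0// ltr0n fact_gt0.
exists (Num.max 1 (`|K| / c)) => [|t]; first by rewrite lt_max ltr01.
rewrite ge_max => /andP[t1 tK].
have t0 : 0 < t by lra.
apply: le_trans (_ : c * t ^+ n.+1 <= _); last first.
  have := expR_ge1Dxn n (ltW (mulr_gt0 e0 t0)).
  rewrite exprMn /c mulrAC => h; apply: le_trans h.
  by rewrite lerDr.
have h1 : t `^ r <= t ^+ n by rewrite -powR_mulrn ?(ltW t0)// ler_powR.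
have h2 : K <= c * t.
  by apply: le_trans (ler_norm K) _; rewrite mulrC -ler_pdivrMr.
rewrite exprS mulrA; apply: le_trans (_ : c * t * t `^ r <= _).
  by rewrite ler_wpM2r ?powR_ge0.
by rewrite ler_wpM2l// mulr_ge0 ?(ltW c0) ?(ltW t0).
Qed.

Variables (A B alpha : R).
Hypotheses (A0 : 0 <= A) (B0 : 0 < B) (alpha0 : 0 < alpha).

Definition wgt v : R :=
  if v < 1 then (1 - v) `^ A * expR (- B / (1 - v) `^ alpha) else 0.

Lemma radial_wgt z : udisc z -> radial (exp_weight A B alpha) z = wgt (normc z ^+ 2).
Proof.
rewrite /udisc/= => z1; rewrite /radial /exp_weight /wgt z1.
by rewrite expr_lt1 ?normc_ge0// z1.
Qed.

Lemma wgt_gt0 v : v < 1 -> 0 < wgt v.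
Proof. by move=> v1; rewrite /wgt v1 mulr_gt0 ?expR_gt0// powR_gt0// subr_gt0. Qed.

Lemma wgt_meas : measurable_fun setT wgt.
Proof.
have ms : measurable_fun [set: R] (fun v : R => 1 - v).
  by apply: measurable_funB => //; exact: measurable_cst.
have mp a : measurable_fun [set: R] (fun v : R => (1 - v) `^ a).
  exact: (measurableT_comp (@measurable_powR R a) ms).
apply: measurable_fun_ifT.
- by apply: measurable_fun_ltr => //; exact: measurable_cst.
- apply: measurable_funM => //; apply: measurableT_comp.
    exact: measurable_expR.
  rewrite (_ : (fun v => - B / (1 - v) `^ alpha) = fun v => - B * (1 - v) `^ (- alpha)).
    by apply: measurable_funM => //; exact: measurable_cst.
  by apply/funext => v; rewrite powRN.
- exact: measurable_cst.
Qed.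

Lemma wgt_cont v : v < 1 -> {for v, continuous wgt}.
Proof.
move=> v1.
have cs : {for v, continuous (fun v : R => 1 - v)}.
  by apply: cvgB; [exact: cvg_cst|exact: cvg_id].
have cp a : {for v, continuous (fun v : R => (1 - v) `^ a)}.
  have v0 : 0 < 1 - v by rewrite subr_gt0.
  have H : {for (1 - v), continuous (@powR R ^~ a)}.
    apply: differentiable_continuous; apply/derivable1_diffP.
    by case: (is_derive1_powR a v0).
  exact: (cvg_comp _ _ cs H).
have cw : {for v, continuous (fun v : R => (1 - v) `^ A * expR (- B / (1 - v) `^ alpha))}.
  apply: cvgM; first exact: cp.
  have ce : {for v, continuous (fun v : R => - B / (1 - v) `^ alpha)}.
    apply: cvgM; first exact: cvg_cst.
    apply: cvgV; last exact: cp.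
    by rewrite gt_eqF// powR_gt0// subr_gt0.
  exact: (cvg_comp _ _ ce (@continuous_expR R _)).
have nearE : \forall y \near v, (1 - y) `^ A * expR (- B / (1 - y) `^ alpha) = wgt y.
  by near=> y; rewrite /wgt ifT//; near: y; exact: lt_nbhsl.
have wE : wgt v = (1 - v) `^ A * expR (- B / (1 - v) `^ alpha) by rewrite /wgt v1.
have : wgt y @[y --> v] --> (1 - v) `^ A * expR (- B / (1 - v) `^ alpha).
  by apply: cvg_trans cw; apply: near_eq_cvg; exact: nearE.
by rewrite -wE.
Unshelve. all: by end_near.
Qed.

Lemma wgt_noninc v v' : 0 <= v -> v <= v' -> v' < 1 -> wgt v' <= wgt v.
Proof.
move=> v0 vv v1'; have v1 : v < 1 by exact: le_lt_trans v1'.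
rewrite /wgt v1 v1'; apply: ler_pM; rewrite ?powR_ge0 ?expR_ge0//.
  by apply: ge0_ler_powR; rewrite ?nnegrE ?subr_ge0 ?(ltW v1) ?(ltW v1')// lerB.
rewrite ler_expR !mulNr lerN2 ler_wpM2l ?(ltW B0)//.
rewrite lef_pV2 ?posrE ?powR_gt0 ?subr_gt0//.
by apply: ge0_ler_powR; rewrite ?nnegrE ?subr_ge0 ?(ltW v1) ?(ltW v1') ?(ltW alpha0)// lerB.
Qed.

(** The origin of kappa, which is [rate]: with x = 1 - v, the integrand of a moment is roughly
    exp(-(s x + B / x^alpha)), and x = y s^(-1/(1+alpha)) turns the exponent into -(y + B / y^alpha)
    s^beta. *)
Definition rate_set : set R := [set y + B / y `^ alpha | y in [set y | 0 < y]].
Definition rate : R := inf rate_set.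

Lemma rate_has_inf : has_inf rate_set.
Proof.
split; first by exists (1 + B / 1 `^ alpha); exists 1 => //=.
by exists 0 => _ [y /= y0 <-]; rewrite addr_ge0 ?divr_ge0 ?powR_ge0// ltW.
Qed.

Lemma rate_le y : 0 < y -> rate <= y + B / y `^ alpha.
Proof. by move=> y0; apply: ge_inf; [exact: rate_has_inf.2|exists y]. Qed.

Lemma rate_gt0 : 0 < rate.
Proof.
apply: lt_le_trans (_ : Num.min 1 B <= _); first by rewrite lt_min ltr01.
apply: lb_le_inf; first exact: rate_has_inf.1.
move=> _ [y /= y0 <-]; rewrite ge_min; have [y1|y1] := leP 1 y.
  by apply/orP; left; apply: ler_wpDr => //; rewrite divr_ge0 ?powR_ge0// ltW.
apply/orP; right; apply: ler_wpDl; first exact: ltW.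
rewrite ler_pdivlMr ?powR_gt0// ler_piMr ?(ltW B0)//.
by rewrite powR_le1 ?(ltW alpha0)// (ltW y0) ltW.
Qed.

Definition beta := alpha / (1 + alpha).

Lemma beta01 : 0 < beta < 1.
Proof.
rewrite /beta divr_gt0 ?addr_gt0//= ltr_pdivrMr ?addr_gt0// mul1r.
by rewrite ltrDr.
Qed.

Lemma rate_scaling s y : 0 < s -> 0 < y ->
  let x := y * s `^ (- (1 + alpha)^-1) in
  s * x + B / x `^ alpha = (y + B / y `^ alpha) * s `^ beta.
Proof.
move=> s0 y0 x.
have a1 : 1 + alpha != 0 by rewrite gt_eqF// addr_gt0.
have -> : s * x = y * s `^ beta.
  rewrite /x mulrCA; congr (_ * _).
  rewrite -{1}[s]powRr1 ?(ltW s0)// -powRD; last by apply/implyP => _; rewrite gt_eqF.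
  by congr (_ `^ _); rewrite /beta; field.
have -> : x `^ alpha = y `^ alpha / s `^ beta.
  rewrite /x powRM ?powR_ge0 ?(ltW y0)// -powRrM; congr (_ * _).
  by rewrite -powRN; congr (_ `^ _); rewrite /beta; field.
by field; rewrite !gt_eqF ?powR_gt0.
Qed.

(** From ln v <= -(1 - v) and (1 - v)^A <= 1, the exponent is at most -(y + B / y^alpha) s^beta for
    some y > 0. *)
Lemma moment_integrand_upper s v : 0 < s -> 0 <= v < 1 ->
  v `^ s * wgt v <= expR (- (rate * s `^ beta)).
Proof.
move=> s0 /andP[]; rewrite le_eqVlt => /predU1P[<- _|v0 v1].
  by rewrite powR0 ?gt_eqF// mul0r expR_ge0.
pose x := 1 - v; have x0 : 0 < x by rewrite subr_gt0.
have b1 : v `^ s <= expR (- (s * x)).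
  rewrite /powR gt_eqF// ler_expR -mulrN ler_pM2l//.
  by have := expR_ge1Dx (ln v); rewrite lnK ?posrE// /x; lra.
have b2 : wgt v <= expR (- (B / x `^ alpha)).
  rewrite /wgt v1 mulNr -/x ler_piMl ?expR_ge0//.
  by rewrite powR_le1// (ltW x0)/= /x; lra.
apply: le_trans (ler_pM (powR_ge0 _ _) (ltW (wgt_gt0 v1)) b1 b2) _.
rewrite -expRD ler_expR -opprD lerN2.
have y0 : 0 < x * s `^ (1 + alpha)^-1 by rewrite mulr_gt0 ?powR_gt0.
have := rate_scaling s0 y0; rewrite /= -mulrA -powRD; last first.
  by apply/implyP => _; rewrite gt_eqF.
rewrite subrr powRr0 mulr1 => ->.
by rewrite ler_wpM2r ?powR_ge0// rate_le.
Qed.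

Local Notation M1 := (moment1 wgt).
Local Notation M2 := (moment2 wgt).

Lemma moment1_upper s : 0 < s -> M1 s <= expR (- (rate * s `^ beta)).
Proof.
move=> s0; have is0 := moment1_integrable wgt_meas wgt_gt0 wgt_noninc (ltW s0).
set k := expR _.
apply: le_trans (_ : \int[mu1]_(v in `]0, 1[) k <= _).
  apply: le_Rintegral => //.
    apply: measurable_bounded_integrable => //.
      by rewrite /= lebesgue_measure_itv/= lte_fin ltr01 oppr0 adde0 ltry.
    by exists `|k|; split => // x kx y _; exact: ltW.
  move=> v /=; rewrite in_itv/= => /andP[v0 v1].
  by apply: moment_integrand_upper; rewrite ?(ltW v0).
by rewrite Rintegral_cst//= lebesgue_measure_itv/= lte_fin ltr01 oppr0 adde0 mulr1.
Qed.

Lemma moment2_upper s : 0 < s -> M2 s <= 4 * expR (- (rate * s `^ beta)).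
Proof.
move=> s0; have is0 := moment2_integrable wgt_meas wgt_gt0 wgt_noninc (ltW s0).
set k := expR _.
apply: le_trans (_ : \int[dA]_(v in udisc2) k <= _).
  apply: le_Rintegral => //; first exact: measurable_disc.
    by apply: (@bounded_integrable_disc _ _ `|k|) => //; exact: measurable_cst.
  by move=> p /udisc2_normc2 pu; exact: moment_integrand_upper.
rewrite Rintegral_cst; last exact: measurable_disc.
rewrite mulrC ler_wpM2r ?expR_ge0// -lee_fin fineK.
  exact: dA_udisc2.
by rewrite ge0_fin_numE//; apply: le_lt_trans dA_udisc2 _; exact: ltry.
Qed.

Lemma scaling_linear s y : 0 < s -> 
  s * (y * s `^ (- (1 + alpha)^-1)) = y * s `^ beta.
Proof.
move=> s0; have a1 : 1 + alpha != 0 by rewrite gt_eqF// addr_gt0.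
rewrite mulrCA; congr (_ * _).
rewrite -{1}[s]powRr1 ?(ltW s0)// -powRD; last by apply/implyP => _; rewrite gt_eqF.
by congr (_ `^ _); rewrite /beta; field.
Qed.

(* On the window [1 - v] in [[x0, (1 + d) x0]], with [x0] the (almost) optimal
   point, the integrand is at its maximum up to [expR (e s^beta)]. *)
Lemma integrand_window e : 0 < e -> exists y0 d S,
  [/\ 0 < y0, 0 < d <= 1, 0 < S & forall s, S <= s ->
    let x0 := y0 * s `^ (- (1 + alpha)^-1) in
    2 * x0 <= 2^-1 /\ forall v, 1 - (1 + d) * x0 <= v <= 1 - x0 ->
      x0 `^ A * expR (- ((rate + e) * s `^ beta)) <= v `^ s * wgt v].
Proof.
move=> e0.
have e20 : 0 < e / 2 by rewrite divr_gt0.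
have [_ [y0 /= y00 <-] Hy] := inf_adherent e20 rate_has_inf.
rewrite -/rate in Hy.
(* The width of the window costs 3 d y0 <= e / 2 in the coefficient of s^beta; the other e / 2 pays
   for [y0] being only almost optimal. *)
pose d := Num.min 1 (e / (6 * y0)).
have d0 : 0 < d by rewrite lt_min ltr01/= divr_gt0// mulr_gt0.
have d1 : d <= 1 by rewrite ge_min lexx.
have dy : 3 * d * y0 <= e / 2.
  have : d <= e / (6 * y0) by rewrite ge_min lexx orbT.
  by rewrite ler_pdivlMr ?mulr_gt0//; lra.
have a1 : 0 < 1 + alpha by rewrite addr_gt0.
have q0 : 0 < 4 * y0 / d by rewrite divr_gt0// mulr_gt0.
(* This threshold gives 4 x0 <= d, hence 1 / v <= 1 + d on the window. *)
exists y0, d, ((4 * y0 / d) `^ (1 + alpha)); split; [by []|by rewrite d0|by rewrite powR_gt0|].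
move=> s sS; set x0 := y0 * _.
have s0 : 0 < s by apply: lt_le_trans sS; rewrite powR_gt0.
have x00 : 0 < x0 by rewrite mulr_gt0 ?powR_gt0.
have x0d : 4 * x0 <= d.
  have h : 4 * y0 / d <= s `^ (1 + alpha)^-1.
    have := ge0_ler_powR (_ : 0 <= (1 + alpha)^-1) _ _ sS.
    rewrite -powRrM mulfV ?gt_eqF// powRr1 ?(ltW q0)//; apply => //.
    - by rewrite invr_ge0 ltW.
    - by rewrite nnegrE powR_ge0.
    - by rewrite nnegrE ltW.
  rewrite /x0 powRN mulrA ler_pdivrMr ?powR_gt0//.
  by move: h; rewrite ler_pdivrMr// [leRHS]mulrC.
split; first by lra.
move=> v /andP[vl vu].
pose x := 1 - v.
have xl : x0 <= x by rewrite /x; lra.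
have xu : x <= (1 + d) * x0 by rewrite /x; lra.
have xd : x <= d / 2 by apply: le_trans xu _; nra.
have x_gt0 : 0 < x by apply: lt_le_trans xl.
have v0 : 0 < v by rewrite /x in xd; lra.
have v1 : v < 1 by rewrite -subr_gt0.
have vd : 1 <= v * (1 + d) by rewrite /x in xd; nra.
(* -ln v <= 1/v - 1 = x / v <= (1 + d)^2 x0 <= (1 + 3 d) x0, the last step by d <= 1. *)
have b1 : expR (- (s * ((1 + 3 * d) * x0))) <= v `^ s.
  rewrite /powR gt_eqF// ler_expR -mulrN ler_pM2l//.
  have : - ln v <= v^-1 - 1.
    have := expR_ge1Dx (ln v^-1); rewrite lnK ?posrE ?invr_gt0// lnV ?posrE//; lra.
  have : v^-1 - 1 <= (1 + d) * x.
    have -> : v^-1 - 1 = x / v by rewrite /x; field; rewrite gt_eqF.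
    by rewrite ler_pdivrMr// mulrAC mulrC ler_peMr ?(ltW x_gt0)// mulrC.
  have : (1 + d) * x <= (1 + d) * ((1 + d) * x0) by rewrite ler_wpM2l// addr_ge0// ltW.
  have : (1 + d) * ((1 + d) * x0) <= (1 + 3 * d) * x0.
    by rewrite mulrA ler_wpM2r ?(ltW x00)//; nra.
  lra.
have b2 : x0 `^ A * expR (- (B / x0 `^ alpha)) <= wgt v.
  rewrite /wgt v1 mulNr -/x; apply: ler_pM; rewrite ?powR_ge0 ?expR_ge0//.
    by apply: ge0_ler_powR; rewrite ?nnegrE ?(ltW x00) ?(ltW x_gt0).
  rewrite ler_expR lerN2 ler_wpM2l ?(ltW B0)// lef_pV2 ?posrE ?powR_gt0//.
  by apply: ge0_ler_powR; rewrite ?nnegrE ?(ltW x00) ?(ltW x_gt0) ?(ltW alpha0).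
have b20 : 0 <= x0 `^ A * expR (- (B / x0 `^ alpha)).
  by rewrite mulr_ge0 ?powR_ge0 ?expR_ge0.
apply: le_trans (ler_pM (expR_ge0 _) b20 b1 b2).
rewrite mulrCA ler_wpM2l ?powR_ge0// -expRD ler_expR -opprD lerN2.
have E1 := rate_scaling s0 y00; rewrite /= -/x0 in E1.
have E2 := scaling_linear y0 s0; rewrite -/x0 in E2.
have -> : s * ((1 + 3 * d) * x0) + B / x0 `^ alpha =
  s * x0 + B / x0 `^ alpha + 3 * d * (s * x0) by ring.
rewrite E1 E2 mulrA -mulrDl ler_wpM2r ?powR_ge0//; lra.
Qed.

(** The right-hand side is a constant times a negative power of s^beta, so it eventually exceeds the
    exponential. With h = d x0, the factor h^2 / 8 is the area available for a rectangle inside the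
    window in [moment_lower]. *)
Lemma window_polynomial e y0 d : 0 < e -> 0 < y0 -> 0 < d -> exists2 S, 0 < S &
  forall s, S <= s -> let x0 := y0 * s `^ (- (1 + alpha)^-1) in
    expR (- (e * s `^ beta)) <= (d * x0) ^+ 2 / 8 * x0 `^ A.
Proof.
move=> e0 y00 d0.
have /andP[b0 b1] := beta01.
pose K := 8 / d ^+ 2 / y0 `^ (2 + A).
have [T T0 HT] := powR_le_expR K ((2 + A) / alpha) e0.
exists (T `^ beta^-1) => [|s sS /=]; first by rewrite powR_gt0.
set x0 := y0 * _.
have s0 : 0 < s by apply: lt_le_trans sS; rewrite powR_gt0.
have x00 : 0 < x0 by rewrite mulr_gt0 ?powR_gt0.
have sT : T <= s `^ beta.
  have := ge0_ler_powR (ltW b0) _ _ sS.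
  rewrite -powRrM mulVf ?gt_eqF// powRr1 ?(ltW T0)//; apply.
  - by rewrite nnegrE powR_ge0.
  - by rewrite nnegrE ltW.
have := HT _ sT; rewrite -powRrM.
have a1 : 1 + alpha != 0 by rewrite gt_eqF// addr_gt0.
have -> : beta * ((2 + A) / alpha) = (1 + alpha)^-1 * (2 + A).
  by rewrite /beta; field; rewrite a1 gt_eqF.
have xA : x0 ^+ 2 * x0 `^ A = y0 `^ (2 + A) / s `^ ((1 + alpha)^-1 * (2 + A)).
  rewrite -powR_mulrn ?(ltW x00)// -powRD; last by apply/implyP => _; rewrite gt_eqF.
  by rewrite /x0 powRM ?powR_ge0 ?(ltW y00)// -powRrM mulNr powRN.
have -> : (d * x0) ^+ 2 / 8 * x0 `^ A = d ^+ 2 / 8 * (x0 ^+ 2 * x0 `^ A) by ring.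
rewrite xA expRN => h.
have Y0 : 0 < y0 `^ (2 + A) by rewrite powR_gt0.
have Q0 : 0 < s `^ ((1 + alpha)^-1 * (2 + A)) by rewrite powR_gt0.
have D0 : 0 < d ^+ 2 by rewrite exprn_gt0.
have -> : d ^+ 2 / 8 * (y0 `^ (2 + A) / s `^ ((1 + alpha)^-1 * (2 + A))) =
  (K * s `^ ((1 + alpha)^-1 * (2 + A)))^-1.
  by rewrite /K; field; rewrite !gt_eqF.
by rewrite lef_pV2 ?posrE ?expR_gt0// mulr_gt0// /K !divr_gt0.
Qed.

Lemma Rintegral_ge_window d0 (T : measurableType d0) (m : {measure set T -> \bar R})
    (D J : set T) (f : T -> R) (k a : R) :
  measurable D -> measurable J -> J `<=` D -> m.-integrable D (EFin \o f) ->
  (forall z, D z -> 0 <= f z) -> (forall z, J z -> k <= f z) -> 0 <= k ->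
  (a%:E <= m J)%E -> a * k <= \int[m]_(x in D) f x.
Proof.
move=> mD mJ JD iF f0 kf k0 am.
rewrite -lee_fin /Rintegral fineK; last exact: (integrable_fin_num mD iF).
apply: le_trans (_ : (\int[m]_(x in J) (f x)%:E <= _)%E); last first.
  apply: ge0_subset_integral => //; first exact: (measurable_int _ iF).
have mf : measurable_fun J (EFin \o f).
  exact: measurable_funS (measurable_int _ iF).
have leJ : (\int[m]_(x in J) k%:E <= \int[m]_(x in J) (f x)%:E)%E.
  by apply: ge0_le_integral => // z zJ; rewrite lee_fin; exact: kf.
apply: le_trans leJ.
by rewrite integral_cst// EFinM muleC lee_wpmul2l// lee_fin.
Qed.

(** Half of e pays for the height of the integrand on the window, the other half for the size of the
    window. *)
Lemma moment_lower e : 0 < e -> exists2 S, 0 < S & forall s, S <= s ->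
  expR (- ((rate + e) * s `^ beta)) <= M1 s /\
  expR (- ((rate + e) * s `^ beta)) <= M2 s.
Proof.
move=> e0; have e20 : 0 < e / 2 by rewrite divr_gt0.
have [y0 [d [S1 [y00 /andP[d0 d1] S10 H1]]]] := integrand_window e20.
have [S2 S20 H2] := window_polynomial e20 y00 d0.
exists (Num.max S1 S2) => [|s]; first by rewrite lt_max S10.
rewrite ge_max => /andP[/[dup] sS1 /H1 {}H1 /H2 {}H2].
have s0 : 0 < s by apply: lt_le_trans sS1.
rewrite /= in H1 H2; set x0 := y0 * _ in H1 H2.
have {H1} [x0h H1] := H1.
have x00 : 0 < x0 by rewrite mulr_gt0 ?powR_gt0.
pose k := x0 `^ A * expR (- ((rate + e / 2) * s `^ beta)).
have k0 : 0 <= k by rewrite mulr_ge0 ?powR_ge0 ?expR_ge0.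
pose h := d * x0.
have h0 : 0 < h by rewrite mulr_gt0.
have h1 : h <= 2^-1 by rewrite /h; nra.
have key : expR (- ((rate + e) * s `^ beta)) <= h ^+ 2 / 8 * k.
  have -> : - ((rate + e) * s `^ beta) =
    - (e / 2 * s `^ beta) + - ((rate + e / 2) * s `^ beta) by field.
  by rewrite expRD /k mulrA ler_wpM2r ?expR_ge0.
have f0 v : 0 <= v < 1 -> 0 <= v `^ s * wgt v.
  by move=> /andP[_ v1]; rewrite mulr_ge0 ?powR_ge0// ltW// wgt_gt0.
pose a := 1 - (1 + d) * x0; pose b := 1 - x0.
have ab : b = a + h by rewrite /a /b /h; ring.
have a0 : 0 < a by rewrite /a; nra.
have b1 : b < 1 by rewrite /b; lra.
split; apply: (le_trans key).
- apply: le_trans (_ : h * k <= _).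
    by rewrite ler_wpM2r//; nra.
  apply: (@Rintegral_ge_window _ _ mu1 `]0, 1[%classic `]a, b]%classic) => //.
  + move=> v /=; rewrite !in_itv/= => /andP[av vb].
    by rewrite (lt_trans a0 av) (le_lt_trans vb b1).
  + exact: (moment1_integrable wgt_meas wgt_gt0 wgt_noninc (ltW s0)).
  + by move=> v /=; rewrite in_itv/= => /andP[v0 v1]; apply: f0; rewrite ltW.
  + move=> v /=; rewrite in_itv/= => /andP[/ltW av vb]; apply: H1.
    by rewrite -/a -/b av vb.
  + rewrite /= lebesgue_measure_itv/= lte_fin ab ltrDl h0 lee_fin; lra.
(* A rectangle inside the annulus a <= |z|^2 <= b: x^2 ranges over [a, a + h/2] and y^2 over
   [0, h/2]. Its sides are at least h / 4, because x1 + x2 <= 2, and h / 2, because y1 <= 1. *)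
- pose c := a + h / 2.
  pose x1 := Num.sqrt a; pose x2 := Num.sqrt c; pose y1 := Num.sqrt (h / 2).
  have c0 : 0 < c by rewrite /c; lra.
  have sq v : 0 <= v -> Num.sqrt v ^+ 2 = v by move=> ?; rewrite sqr_sqrtr.
  have x10 : 0 <= x1 by exact: sqrtr_ge0.
  have x12 : x1 <= x2 by rewrite ler_sqrt// /c; lra.
  have x21 : x2 <= 1.
    by rewrite -[leRHS]sqrtr1 ler_sqrt// /c -/b; lra.
  have x1a : x1 ^+ 2 = a by rewrite sq// ltW.
  have x2c : x2 ^+ 2 = c by rewrite sq// ltW.
  have y1h : y1 ^+ 2 = h / 2 by rewrite sq//; lra.
  have y10 : 0 <= y1 by exact: sqrtr_ge0.
  have y11 : y1 <= 1 by rewrite -[leRHS]sqrtr1 ler_sqrt//; lra.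
  have dx : h / 4 <= x2 - x1 by rewrite /c in x2c; nra.
  have dy : h / 2 <= y1 by nra.
  have inJ (p : T2) : (`]x1, x2]%classic `*` `]0, y1]%classic) p -> a <= u p <= b.
    case: p => x y [hx hy]; rewrite normcE_Re_Im /=; move: hx hy.
    rewrite /= !in_itv/= => /andP[xx1 xx2] /andP[yy0 yy1].
    have h3 : x1 ^+ 2 <= x ^+ 2 by rewrite lerXn2r ?nnegrE ?(ltW xx1)//; lra.
    have h4 : x ^+ 2 <= x2 ^+ 2 by rewrite lerXn2r ?nnegrE//; lra.
    have h5 : y ^+ 2 <= y1 ^+ 2 by rewrite lerXn2r ?nnegrE//; lra.
    have h6 := sqr_ge0 y.
    by rewrite x1a in h3; rewrite x2c /c in h4; rewrite y1h in h5; lra.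
  have inD (p : T2) : a <= u p <= b -> udisc2 p.
    move=> /andP[_ pb]; have := le_lt_trans pb b1.
    by rewrite expr_lt1 ?normc_ge0.
  apply: (@Rintegral_ge_window _ _ dA udisc2
    (`]x1, x2]%classic `*` `]0, y1]%classic)) => //.
  + exact: measurable_disc.
  + exact: measurableX.
  + by move=> p /inJ/inD.
  + exact: (moment2_integrable wgt_meas wgt_gt0 wgt_noninc (ltW s0)).
  + by move=> p /udisc2_normc2; exact: f0.
  + by move=> p /inJ; exact: H1.
  + have le8 : ((h ^+ 2 / 8)%:E <= ((x2 - x1) * (y1 - 0))%:E)%E.
      by rewrite lee_fin subr0; nra.
    apply: le_trans le8 _; rewrite le_eqVlt; apply/orP; left; apply/eqP.
    by apply/esym; exact: rectangle_measure.
Qed.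

Lemma bergman_unbounded p : 1 < p -> p != 2 ->
  ~ bergman_bounded (radial (exp_weight A B alpha)) p.
Proof.
move=> p1 p2.
pose q := p / (p - 1).
have p10 : 0 < p - 1 by rewrite subr_gt0.
have p0 : 0 < p by lra.
have q0 : 0 < q by rewrite divr_gt0.
have pq : q * (p - 1) = p by rewrite divfK// gt_eqF.
move=> /(moment_inequality wgt_meas wgt_cont wgt_gt0 wgt_noninc radial_wgt p1 pq)
  [K K0 HK].
have := conjugate_exponent_gap beta01 p1 p2 pq.
set gap := (X in 0 < X) => gap0.
have rate0 := rate_gt0.
pose W := p * q `^ beta + p `^ beta.
have W0 : 0 < W by rewrite addr_gt0// ?mulr_gt0// powR_gt0.
(* The errors in the three lower and upper estimates add up to e W, which is made half of the gain
   [rate * gap]. *)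
pose e := rate * gap / (2 * W).
have e0 : 0 < e by rewrite divr_gt0 ?mulr_gt0.
have [S S0 HS] := moment_lower e0.
have /andP[b0 b1] := beta01.
(* The first three entries make [moment_lower] available at m q, m p and 2 m. The last one gives t =
   m^beta >= 8 K / (rate gap), so that exp(t rate gap / 2) >= 1 + 4 K, against the bound 4 K found
   below. *)
pose L := Num.max (S / q) (Num.max (S / p) (Num.max (S / 2) ((8 * K / (rate * gap)) `^ beta^-1))).
pose m := (Num.bound `|L|).+1.
have mL : L <= m%:R.
  apply: le_trans (ler_norm _) (ltW _).
  by apply: lt_le_trans (archi_boundP (normr_ge0 _)) _; rewrite ler_nat.
have m0 : 0 < m%:R :> R by rewrite ltr0n.
move: mL; rewrite !ge_max => /andP[]; rewrite ler_pdivrMr// => mSq.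
move=> /andP[]; rewrite ler_pdivrMr// => mSp.
move=> /andP[]; rewrite ler_pdivrMr// => mS2 mT.
have [M1q _] := HS _ mSq.
have [_ M2p] := HS _ mSp.
have [M12 _] := HS _ mS2.
have M12u := moment1_upper (mulr_gt0 m0 (ltr0Sn R 1)).
have M2q := moment2_upper (mulr_gt0 m0 q0).
have := HK m (ltn0Sn _).
pose t := m%:R `^ beta.
have t0 : 0 < t by rewrite powR_gt0.
have mt x : 0 < x -> (m%:R * x) `^ beta = t * x `^ beta.
  by move=> x0; rewrite powRM ?(ltW m0) ?(ltW x0).
have M12_gt0 : 0 < M1 (m%:R * 2) by apply: lt_le_trans M12; exact: expR_gt0.
rewrite !mt// in M1q M2p M12u M2q.
set Q := M1 (m%:R * q) / M1 (m%:R * 2).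
have Qge : expR (- ((rate + e) * (t * q `^ beta)) + rate * (t * 2 `^ beta)) <= Q.
  rewrite /Q; move: (M1 _) (M1 _) M1q M12u M12_gt0 => M1q' M12' M1q M12u M12_gt0.
  rewrite expRD ler_pdivlMr// -mulrA; apply: le_trans M1q.
  rewrite ler_piMr ?expR_ge0//; apply: le_trans (ler_wpM2l (expR_ge0 _) M12u) _.
  by rewrite -expRD subrr expR0.
have Qp : expR (p * (- ((rate + e) * (t * q `^ beta)) + rate * (t * 2 `^ beta))) <= Q `^ p.
  have := ge0_ler_powR (ltW p0) _ _ Qge.
  rewrite !nnegrE expR_ge0 (le_trans (expR_ge0 _) Qge) => /(_ isT isT).
  by rewrite {1}/powR gt_eqF ?expR_gt0// expRK.
move=> HKm.
have H : expR (t * (rate * gap / 2)) <= 4 * K.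
  have := ler_pM (expR_ge0 _) (expR_ge0 _) Qp M2p.
  move=> /le_trans/(_ HKm)/le_trans.
  move=> /(_ _ (ler_wpM2l (ltW K0) M2q)).
  have -> : K * (4 * expR (- (rate * (t * q `^ beta)))) =
    4 * K * expR (- (rate * (t * q `^ beta))) by ring.
  rewrite -expRD => H.
  have E : expR (t * (rate * gap / 2)) * expR (- (rate * (t * q `^ beta))) =
      expR (p * (- ((rate + e) * (t * q `^ beta)) + rate * (t * 2 `^ beta)) +
        - ((rate + e) * (t * p `^ beta))).
    rewrite -expRD; congr expR.
    have eW : e * W = rate * gap / 2 by rewrite /e; field; rewrite gt_eqF.
    transitivity (t * (rate * gap) - rate * (t * q `^ beta) - t * (e * W)).
      by rewrite eW; field.
    by rewrite /gap /W; ring.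
  by rewrite -E ler_pM2r ?expR_gt0 in H.
have rg : 0 < rate * gap by rewrite mulr_gt0.
have tK : 8 * K / (rate * gap) <= t.
  have := ge0_ler_powR (ltW b0) _ _ mT.
  rewrite -powRrM mulVf ?gt_eqF// powRr1; last by rewrite divr_ge0 ?mulr_ge0 ?ltW.
  by apply; rewrite nnegrE ?powR_ge0// ltW.
rewrite ler_pdivrMr// in tK.
have := le_trans (expR_ge1Dx _) H; move: tK; clear; lra.
Qed.

End moment_asymptotics.

Theorem corollary2p1 (R : realType) (A B alpha : R)
    (hA : 0 <= A) (hB : 0 < B) (halpha : 0 < alpha) :
  let lambda : R -> R := exp_weight A B alpha in
  let I : set R := `[0, 1]%classic in
  [/\ smooth_on I lambda,
      (forall n : nat, deriven_on I n lambda 1 = 0),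
      (forall n : nat, exists2 a : R, 0 < a < 1 &
         forall r : R, a < r < 1 -> 0 <= (-1) ^+ n * deriven_on I n lambda r),
      (forall p : R, 1 < p -> (bergman_bounded (radial lambda) p <-> p = 2)) &
      (forall p : R, 1 < p < 2 -> ~ bergman_bounded (radial lambda) p)].
Proof.
move=> lambda I; split.
- exact: exp_weight_smooth.
- exact: exp_weight_deriven1.
- exact: exp_weight_deriven_sign.
- move=> p p1; split=> [bp|->].
    apply/eqP; apply: contraT => p2.
    by case: (bergman_unbounded hA hB halpha p1 p2 bp).
  apply: bergman_bounded2.
    apply: measurable_mu; [exact: (@wgt_meas R A B alpha)|exact: (@radial_wgt R A B alpha)].
  by apply: mu_gt0; [exact: (@wgt_gt0 R A B alpha)|exact: (@radial_wgt R A B alpha)].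
- move=> p /andP[p1 p2]; apply: bergman_unbounded => //.
  by rewrite lt_eqF.
Qed.
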